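(* Let $h:\Delta\times\overline{\mathbb C}\to\overline{\mathbb C}$ be a normalized holomorphic motion of $\overline{\mathbb C}$ parametrized by $\Delta$ with base point $0$. For $z_1,z_2\in\mathbb C$ write $z_j(c)=h(c,z_j)$ (so $z_j(0)=z_j$) and let $V(z_j(c))=\frac{d}{dc}z_j(c)$ denote the tangent vector to the motion at parameter $c$. Let $0<r<1$ and $R>0$. Then there are constants $M>0$ and $C>0$ such that for all $0<\delta<1$, all $c$ with $|c|\le r$, and all distinct $z_1,z_2\in\mathbb C$ with $|z_1(c)|\le R$, $|z_2(c)|\le R$, $|z_2(c)-z_1(c)|<\delta$ and $|z_1(0)-z_2(0)|\le\delta$, one has $$|V(z_2(c))-V(z_1(c))|\le\frac{2+\epsilon}{1-|c|^2}\,|z_2(c)-z_1(c)|\log\frac1{|z_2(c)-z_1(c)|}$$ for some $\epsilon\le\frac{M}{\log(1/\delta)}$, and moreover $$|z_2(c)-z_1(c)|\le C\,|z_2-z_1|^{\frac{1-|c|}{1+|c|}}.$$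
   Context: $\overline{\mathbb C}$ is the Riemann sphere and $\Delta=\{c\in\mathbb C:|c|<1\}$. A map $h:\Delta\times E\to\overline{\mathbb C}$, $E\subset\overline{\mathbb C}$, is a holomorphic motion of $E$ parametrized by $\Delta$ with base point $0$ if: (1) $h(0,z)=z$ for all $z\in E$; (2) for every $c\in\Delta$, $z\mapsto h(c,z)$ is injective on $E$; (3) for every $z\in E$, $c\mapsto h(c,z)$ is holomorphic on $\Delta$ (as a map into the Riemann sphere). It is normalized if $h(c,0)=0$, $h(c,1)=1$ and $h(c,\infty)=\infty$ for all $c\in\Delta$. *)

(* Defs.v *)
From Stdlib Require Import Reals.
From Coquelicot Require Import Coquelicot.
Open Scope R_scope.

Inductive sphere : Type :=
| Fin : C -> sphere
| Inf : sphere.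

(** The involution z |-> 1/z, exchanging 0 and infinity. *)
Definition sphere_inv (p : sphere) : sphere :=
  match p with
  | Inf => Fin (RtoC 0)
  | Fin z => if Ceq_dec z (RtoC 0) then Inf else Fin (/ z)%C
  end.

(** Inverses of the two charts of the atlas of the sphere: [Fin] parametrizes
    the complement of infinity, [sphere_inv \o Fin] the complement of 0. *)
Definition chart_inv (at_infinity : bool) (z : C) : sphere :=
  if at_infinity then sphere_inv (Fin z) else Fin z.

(** Near [c] the map stays in the domain of one chart, and is complex
    differentiable at [c] when read in that chart.  The derivative is over the
    field [C], because [g : C -> C] is taken with scalars [C_AbsRing]. *)
Definition sphere_derivable_at (f : C -> sphere) (c : C) : Prop :=
  exists (b : bool) (g : C -> C),
    locally c (fun w => f w = chart_inv b (g w)) /\ ex_derive g c.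

(** For open [U] this is the usual notion of a holomorphic map into the Riemann
    surface [sphere]; values of [f] outside [U] are irrelevant. *)
Definition holomorphic_on (U : C -> Prop) (f : C -> sphere) : Prop :=
  forall c, U c -> sphere_derivable_at f c.

Definition unit_disc (c : C) : Prop := Cmod c < 1.

(** [h] is a total function; only its values on [unit_disc] x [E] matter. *)
Definition holomorphic_motion (E : sphere -> Prop) (h : C -> sphere -> sphere) : Prop :=
  (forall p, E p -> h (RtoC 0) p = p) /\
  (forall c, unit_disc c ->
     forall p q, E p -> E q -> h c p = h c q -> p = q) /\
  (forall p, E p -> holomorphic_on unit_disc (fun c => h c p)).

Definition normalized (h : C -> sphere -> sphere) : Prop :=
  forall c, unit_disc c ->
    h c (Fin (RtoC 0)) = Fin (RtoC 0) /\
    h c (Fin (RtoC 1)) = Fin (RtoC 1) /\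
    h c Inf = Inf.

(** The default value at [Inf] is never reached by [traj] below when [h] is
    injective on the whole sphere and fixes [Inf]. *)
Definition finite_part (p : sphere) : C :=
  match p with Fin z => z | Inf => RtoC 0 end.

(** The trajectory c |-> z(c) = h(c,z) of a finite point z. *)
Definition traj (h : C -> sphere -> sphere) (z : C) : C -> C :=
  fun c => finite_part (h c (Fin z)).

(** The tangent vector V(z(c)) = dz(c)/dc, indexed by the starting point z. *)
Definition velocity (h : C -> sphere -> sphere) (z c : C) : C :=
  C_derive (traj h z) c.

(* Main.v *)
Require Import Defs.
From Stdlib Require Import Reals.
From Coquelicot Require Import Coquelicot.
From Stdlib Require Import Lra Lia Classical ClassicalEpsilon.
Open Scope R_scope.

(** For z1, z2 and j in {0, 1} the function F = (z2 - z1) / (j - z1) of the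
    parameter is holomorphic on the disc and omits 0 and 1 (or is constant),
    and j can be chosen so that |j - z1| >= 1/2 at any prescribed parameter.  Both
    estimates then reduce to Landau's theorem in the sharp form
      |F'(c)| (1 - |c|^2) <= 2 |F(c)| (k - ln |F(c)|)   where |F(c)| <= 2:
    the first one by differentiating z2 - z1 = F (j - z1), the second one by
    integrating the inequality along the ray from 0 to c, up to the first
    parameter, if any, at which |F| = 2.

    Landau's theorem is proved by Ahlfors' method, with two metrics.  A metric on
    C \ {0, 1} with explicit density and curvature bounded above by a negative
    constant gives a crude bound for |F'|.  This bound controls |F'| where
    |F| = 2, so that in the region |F| < 2 one can compare the Poincare metric of
    the disc with the hyperbolic metric of a punctured disc 0 < |z| < exp k with
    k large, which is what produces the constant 2.  The maximum principle
    involved needs three derivatives of F; since holomorphy only means complex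
    differentiability at every point, Goursat's theorem and Cauchy's formula come
    first. *)

(** * Complex differentiation *)

(** The constant 2 survives because the second comparison loses nothing: the two metrics have equal
    curvature, so the ratio of their densities is bounded by 1. Every crude estimate is confined to
    [k], which is added to ln(1/|F|); it ends up in epsilon in the first estimate and in the
    multiplicative constant in the second. The hyperbolic metric of C minus {0, 1} would give such
    an inequality directly but calls for the modular function; a crude explicit metric and a
    punctured disc replace it. The exponent (1-|c|)/(1+|c|) comes from the inequality being linear
    in ln |F|, with integrating factor (1+t)/(1-t). If |F| reaches 2 on the ray, |z2 - z1| to that
    exponent is bounded below and the trivial bound |z2(c) - z1(c)| < 1 is enough. The point j is
    chosen at the parameter c for the first estimate and at 0, where the ray starts, for the second.
    Differentiating F (j - z1) also leaves a term F V(z1); the crude bound applies to it because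
    z1(c) itself omits 0 and 1 unless it is constant. Three derivatives occur because ln |F'| is a
    summand of the function whose Laplacian is taken. *)

Lemma is_derive_C_eps (f : C -> C) (z l : C) :
  is_derive f z l <->
  forall eps, 0 < eps -> exists d, 0 < d /\ forall w, Cmod (w - z)%C < d ->
    Cmod (f w - f z - (w - z) * l)%C <= eps * Cmod (w - z)%C.
Proof.
split.
- intros [_ H] eps He.
  destruct (H z (fun P HP => HP) (mkposreal eps He)) as [d Hd].
  exists d; split; [apply cond_pos|].
  intros w Hw. exact (Hd w Hw).
- intros H. split; [apply is_linear_scal_l|].
  intros x Hx.
  apply (@is_filter_lim_locally_unique C_AbsRing (AbsRing_NormedModule C_AbsRing)) in Hx. subst x.
  intros eps. destruct (H eps (cond_pos eps)) as [d [Hd Hd']].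
  exists (mkposreal d Hd). intros w Hw. exact (Hd' w Hw).
Qed.

Lemma ex_derive_C_continuous (f : C -> C) (z : C) :
  ex_derive f z -> forall eps, 0 < eps -> exists d, 0 < d /\
    forall w, Cmod (w - z)%C < d -> Cmod (f w - f z)%C < eps.
Proof.
intros [l Hl] eps He.
destruct (proj1 (is_derive_C_eps _ _ _) Hl 1 Rlt_0_1) as [d [Hd H]].
pose proof (Cmod_ge_0 l) as Hl0.
exists (Rmin d (eps / (2 + Cmod l))). split.
- apply Rmin_pos; auto. apply Rdiv_lt_0_compat; lra.
- intros w Hw.
  assert (H1 := H w (Rlt_le_trans _ _ _ Hw (Rmin_l _ _))).
  assert (H2 := Rlt_le_trans _ _ _ Hw (Rmin_r _ _)).
  replace (f w - f z)%C with ((f w - f z - (w - z) * l) + (w - z) * l)%C by ring.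
  eapply Rle_lt_trans; [apply Cmod_triangle|]. rewrite (Cmod_mult (w - z) l).
  pose proof (Cmod_ge_0 (w - z)%C).
  apply (Rmult_lt_compat_r (2 + Cmod l)) in H2; [|lra].
  replace (eps / (2 + Cmod l) * (2 + Cmod l)) with eps in H2 by (field; lra).
  destruct H0 as [H0|H0]; nra.
Qed.

Lemma is_derive_C_eq (f : C -> C) (z l l' : C) :
  is_derive f z l -> l = l' -> is_derive f z l'.
Proof. now intros H <-. Qed.

(** An explicit quadratic remainder spares the choice of eps; this is the form in which inversion
    and integrals with a parameter are differentiated. *)
Lemma is_derive_C_quadratic (f : C -> C) (z l : C) (B r : R) :
  0 < r -> (forall w, Cmod (w - z)%C < r ->
     Cmod (f w - f z - (w - z) * l)%C <= B * Cmod (w - z)%C ^ 2) ->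
  is_derive f z l.
Proof.
intros Hr H. apply is_derive_C_eps. intros eps He.
exists (Rmin r (eps / (1 + Rabs B))).
pose proof (Rabs_pos B). pose proof (Rle_abs B).
split.
- apply Rmin_pos; auto. apply Rdiv_lt_0_compat; lra.
- intros w Hw.
  assert (H3 := H w (Rlt_le_trans _ _ _ Hw (Rmin_l _ _))).
  assert (H2 := Rlt_le_trans _ _ _ Hw (Rmin_r _ _)).
  apply (Rmult_lt_compat_r (1 + Rabs B)) in H2; [|lra].
  replace (eps / (1 + Rabs B) * (1 + Rabs B)) with eps in H2 by (field; lra).
  pose proof (Cmod_ge_0 (w - z)%C).
  eapply Rle_trans; [exact H3|]. nra.
Qed.

(* [C] carries two propositionally equivalent normed-module structures over
   itself, and Coquelicot's product and chain rules speak of the other one. *)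
Lemma is_derive_C_AbsRing (f : C -> C) (z l : C) :
  is_derive f z l <->
  @is_derive C_AbsRing (AbsRing_NormedModule C_AbsRing) f z l.
Proof.
split; intros [[P1 P2 P3] H]; (split; [split; [exact P1|exact P2|exact P3]|]);
  intros x Hx eps; exact (H x Hx eps).
Qed.

Lemma is_derive_Cmult (f g : C -> C) (z df dg : C) :
  is_derive f z df -> is_derive g z dg ->
  is_derive (fun w => (f w * g w)%C) z (df * g z + f z * dg)%C.
Proof.
rewrite !is_derive_C_AbsRing. intros Hf Hg.
exact (is_derive_mult (K := C_AbsRing) f g z df dg Hf Hg Cmult_comm).
Qed.

Lemma is_derive_Cplus (f g : C -> C) (z df dg : C) :
  is_derive f z df -> is_derive g z dg ->
  is_derive (fun w => (f w + g w)%C) z (df + dg)%C.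
Proof. intros Hf Hg. exact (is_derive_plus (K := C_AbsRing) f g z df dg Hf Hg). Qed.

Lemma is_derive_Cminus (f g : C -> C) (z df dg : C) :
  is_derive f z df -> is_derive g z dg ->
  is_derive (fun w => (f w - g w)%C) z (df - dg)%C.
Proof. intros Hf Hg. exact (is_derive_minus (K := C_AbsRing) f g z df dg Hf Hg). Qed.

Lemma is_derive_Cconst (k z : C) : is_derive (fun _ : C => k) z (RtoC 0).
Proof. exact (is_derive_const (K := C_AbsRing) (V := C_NormedModule) k z). Qed.

Lemma is_derive_Cid (z : C) : is_derive (fun w : C => w) z (RtoC 1).
Proof. apply is_derive_C_AbsRing. exact (is_derive_id (K := C_AbsRing) z). Qed.

Lemma is_derive_Ccomp (f g : C -> C) (z df dg : C) :
  is_derive f (g z) df -> is_derive g z dg ->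
  is_derive (fun w => f (g w)) z (dg * df)%C.
Proof.
rewrite (is_derive_C_AbsRing g). intros Hf Hg.
exact (is_derive_comp (K := C_AbsRing) f g z df dg Hf Hg).
Qed.

Lemma Cmod_triangle_inv (x y : C) : Cmod x - Cmod y <= Cmod (x - y)%C.
Proof.
pose proof (Cmod_triangle (x - y)%C y) as H.
replace (x - y + y)%C with x in H by ring. lra.
Qed.

Lemma Cmod_sub_sym (x y : C) : Cmod (x - y)%C = Cmod (y - x)%C.
Proof. replace (x - y)%C with (- (y - x))%C by ring. apply Cmod_opp. Qed.

Lemma is_derive_Cinv_id (z : C) : z <> RtoC 0 ->
  is_derive (fun w : C => (/ w)%C) z (- / (z * z))%C.
Proof.
intros Hz. pose proof (proj1 (Cmod_gt_0 z) Hz) as Hz'.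
apply (is_derive_C_quadratic _ _ _ (2 / Cmod z ^ 3) (Cmod z / 2)); [lra|].
intros w Hw.
assert (Hw2 : Cmod z / 2 <= Cmod w).
{ pose proof (Cmod_triangle_inv z w). rewrite Cmod_sub_sym in H. lra. }
assert (Hw0 : w <> RtoC 0). { apply Cmod_gt_0. lra. }
replace (/ w - / z - (w - z) * - / (z * z))%C
  with ((w - z) * (w - z) * / (w * (z * z)))%C by (field; auto).
rewrite !Cmod_mult, Cmod_inv, !Cmod_mult.
2: { repeat apply Cmult_neq_0; auto. }
apply Rle_trans with (Cmod (w - z) * Cmod (w - z) * / (Cmod z / 2 * (Cmod z * Cmod z)))%R.
- apply Rmult_le_compat_l. { pose proof (Cmod_ge_0 (w - z)%C); nra. }
  apply Rinv_le_contravar.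
  + repeat apply Rmult_lt_0_compat; lra.
  + apply Rmult_le_compat_r; [nra|lra].
- apply Req_le. simpl. field. lra.
Qed.

Lemma is_derive_Cinv (f : C -> C) (z df : C) :
  is_derive f z df -> f z <> RtoC 0 ->
  is_derive (fun w => (/ f w)%C) z (- df / (f z * f z))%C.
Proof.
intros Hf H0.
replace (- df / (f z * f z))%C with (df * - / (f z * f z))%C by (field; auto).
apply (is_derive_Ccomp (fun w => (/ w)%C)); auto. now apply is_derive_Cinv_id.
Qed.

Lemma is_derive_Cdiv (f g : C -> C) (z df dg : C) :
  is_derive f z df -> is_derive g z dg -> g z <> RtoC 0 ->
  is_derive (fun w => (f w / g w)%C) z ((df * g z - f z * dg) / (g z * g z))%C.
Proof.
intros Hf Hg H0.
replace ((df * g z - f z * dg) / (g z * g z))%C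
  with (df * / g z + f z * (- dg / (g z * g z)))%C by (field; auto).
apply (is_derive_Cmult f (fun w => (/ g w)%C)); auto. now apply is_derive_Cinv.
Qed.

(** * The complex exponential *)

Definition cexp (z : C) : C := (exp (Re z) * cos (Im z), exp (Re z) * sin (Im z)).

Lemma cexp_plus (z w : C) : cexp (z + w)%C = (cexp z * cexp w)%C.
Proof.
destruct z as [a b], w as [c d]. unfold cexp; simpl.
rewrite exp_plus, cos_plus, sin_plus. unfold Cmult; simpl. f_equal; ring.
Qed.

Lemma Cmod_polar (r t : R) : 0 <= r -> Cmod (r * cos t, r * sin t) = r.
Proof.
intros Hr. unfold Cmod; simpl.
replace (r * cos t * (r * cos t * 1) + r * sin t * (r * sin t * 1))
  with (r * r * (Rsqr (sin t) + Rsqr (cos t))) by (unfold Rsqr; ring).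
rewrite sin2_cos2, Rmult_1_r. now apply sqrt_square.
Qed.

Lemma Cmod_cexp (z : C) : Cmod (cexp z) = exp (Re z).
Proof. apply Cmod_polar, Rlt_le, exp_pos. Qed.

Lemma Cmod_le_Re_Im (z : C) : Cmod z <= Rabs (Re z) + Rabs (Im z).
Proof.
replace z with (RtoC (Re z) + Ci * RtoC (Im z))%C at 1.
2: { destruct z as [a b]; unfold RtoC, Ci, Cmult, Cplus; simpl. f_equal; ring. }
eapply Rle_trans; [apply Cmod_triangle|].
rewrite Cmod_mult, Cmod_Ci, !Cmod_R. lra.
Qed.

Lemma Rabs_Re_le (z : C) : Rabs (Re z) <= Cmod z.
Proof. apply re_le_Cmod. Qed.

Lemma Rabs_Im_le (z : C) : Rabs (Im z) <= Cmod z.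
Proof. eapply Rle_trans; [apply Rmax_r|apply (Rmax_Cmod z)]. Qed.

Lemma is_derive_R_eps (f : R -> R) (x l : R) :
  is_derive f x l <->
  forall eps, 0 < eps -> exists d, 0 < d /\ forall y, Rabs (y - x) < d ->
    Rabs (f y - f x - (y - x) * l) <= eps * Rabs (y - x).
Proof.
split.
- intros [_ H] eps He.
  destruct (H x (fun P HP => HP) (mkposreal eps He)) as [d Hd].
  exists d; split; [apply cond_pos|].
  intros w Hw. exact (Hd w Hw).
- intros H. split; [apply is_linear_scal_l|].
  intros y Hx.
  apply (@is_filter_lim_locally_unique R_AbsRing (AbsRing_NormedModule R_AbsRing)) in Hx. subst y.
  intros eps. destruct (H eps (cond_pos eps)) as [d [Hd Hd']].
  exists (mkposreal d Hd). intros w Hw. exact (Hd' w Hw).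
Qed.

Lemma is_derive_cexp_0 : is_derive cexp (RtoC 0) (RtoC 1).
Proof.
apply is_derive_C_eps. intros eps He.
assert (He' : is_derive exp 0 1). { auto_derive; auto. rewrite exp_0; ring. }
assert (Hc : is_derive cos 0 0). { auto_derive; auto. rewrite sin_0; ring. }
assert (Hs : is_derive sin 0 1). { auto_derive; auto. rewrite cos_0; ring. }
rewrite is_derive_R_eps in He', Hc, Hs.
(* The bound 1 yields |sin y| <= 2m and |1 + x| <= 2; the bound eps/8 is spent three times on the
   real part and four times on the imaginary part. *)
destruct (He' (Rmin 1 (eps / 8))) as [d1 [Hd1 H1]]. { apply Rmin_pos; lra. }
destruct (Hc (eps / 8)) as [d2 [Hd2 H2]]. { lra. }
destruct (Hs (Rmin 1 (eps / 8))) as [d3 [Hd3 H3]]. { apply Rmin_pos; lra. }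
exists (Rmin (Rmin 1 (eps / 8)) (Rmin d1 (Rmin d2 d3))). split.
{ repeat apply Rmin_pos; lra. }
intros [x y] Hw.
assert (Hx := Rabs_Re_le ((x, y) - RtoC 0)%C).
assert (Hy := Rabs_Im_le ((x, y) - RtoC 0)%C).
set (m := Cmod ((x, y) - RtoC 0)%C) in *.
unfold Re, Im in Hx, Hy; simpl in Hx, Hy.
replace (x + - 0) with (x - 0) in Hx by ring.
replace (y + - 0) with (y - 0) in Hy by ring.
pose proof (Rmin_l (Rmin 1 (eps / 8)) (Rmin d1 (Rmin d2 d3))).
pose proof (Rmin_r (Rmin 1 (eps / 8)) (Rmin d1 (Rmin d2 d3))).
pose proof (Rmin_l 1 (eps / 8)). pose proof (Rmin_r 1 (eps / 8)).
pose proof (Rmin_l d1 (Rmin d2 d3)). pose proof (Rmin_r d1 (Rmin d2 d3)).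
pose proof (Rmin_l d2 d3). pose proof (Rmin_r d2 d3).
assert (K1 := H1 x ltac:(lra)). assert (K2 := H2 y ltac:(lra)). assert (K3 := H3 y ltac:(lra)).
rewrite exp_0 in K1. rewrite cos_0 in K2. rewrite sin_0 in K3.
rewrite !Rminus_0_r in * .
assert (Hm : 0 <= m) by apply Cmod_ge_0.
assert (Hmin : 0 <= Rmin 1 (eps / 8)) by (apply Rlt_le, Rmin_pos; lra).
assert (L1 : Rabs (exp x - 1 - x * 1) <= eps / 8 * m).
{ eapply Rle_trans; [exact K1|]. apply Rmult_le_compat; auto using Rabs_pos; lra. }
assert (L1' : Rabs (exp x - 1 - x * 1) <= m).
{ eapply Rle_trans; [exact K1|]. rewrite <- (Rmult_1_l m). apply Rmult_le_compat; auto using Rabs_pos; lra. }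
assert (L2 : Rabs (cos y - 1 - y * 0) <= eps / 8 * m).
{ eapply Rle_trans; [eassumption|]. apply Rmult_le_compat_l; lra. }
assert (L3 : Rabs (sin y - y * 1) <= eps / 8 * m).
{ eapply Rle_trans; [exact K3|]. apply Rmult_le_compat; auto using Rabs_pos; lra. }
assert (L3' : Rabs (sin y - y * 1) <= m).
{ eapply Rle_trans; [exact K3|]. rewrite <- (Rmult_1_l m). apply Rmult_le_compat; auto using Rabs_pos; lra. }
assert (Hcos : Rabs (cos y) <= 1) by (apply Rabs_le; split; pose proof (COS_bound y); lra).
assert (Hsin : Rabs (sin y) <= 1) by (apply Rabs_le; split; pose proof (SIN_bound y); lra).
assert (Hsy : Rabs (sin y) <= 2 * m).
{ replace (sin y) with ((sin y - y * 1) + y) by ring.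
  eapply Rle_trans; [apply Rabs_triang|].
  lra. }
eapply Rle_trans; [apply Cmod_le_Re_Im|].
unfold cexp, Re, Im; simpl.
rewrite exp_0, cos_0, sin_0.
(* Regrouped so that each term contains one of the three first-order errors, except x sin y, which
   is a product of two small factors. *)
match goal with |- Rabs ?u + Rabs ?v <= _ =>
  replace u with ((exp x - 1 - x * 1) * cos y + (1 + x) * (cos y - 1 - y * 0)) by ring;
  replace v with ((sin y - y * 1) + (exp x - 1 - x * 1) * sin y + x * sin y) by ring end.
assert (T1 : Rabs ((exp x - 1 - x * 1) * cos y + (1 + x) * (cos y - 1 - y * 0)) <= 3 * (eps / 8 * m)).
{ eapply Rle_trans; [apply Rabs_triang|]. rewrite !Rabs_mult.
  assert (Rabs (1 + x) <= 2). { eapply Rle_trans; [apply Rabs_triang|]. rewrite Rabs_R1. lra. }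
  pose proof (Rabs_pos (exp x - 1 - x * 1)). pose proof (Rabs_pos (cos y - 1 - y * 0)).
  pose proof (Rabs_pos (cos y)).
  assert (Rabs (exp x - 1 - x * 1) * Rabs (cos y) <= eps / 8 * m * 1) by (apply Rmult_le_compat; lra).
  assert (Rabs (1 + x) * Rabs (cos y - 1 - y * 0) <= 2 * (eps / 8 * m)) by (apply Rmult_le_compat; auto using Rabs_pos; lra).
  lra. }
assert (T2 : Rabs ((sin y - y * 1) + (exp x - 1 - x * 1) * sin y + x * sin y) <= 4 * (eps / 8 * m)).
{ eapply Rle_trans; [apply Rabs_triang|].
  eapply Rle_trans; [apply Rplus_le_compat_r, Rabs_triang|]. rewrite !Rabs_mult.
  assert (Rabs (exp x - 1 - x * 1) * Rabs (sin y) <= eps / 8 * m).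
  { rewrite <- (Rmult_1_r (eps / 8 * m)). apply Rmult_le_compat; auto using Rabs_pos. }
  assert (Rabs x * Rabs (sin y) <= m * (2 * m)).
  { apply Rmult_le_compat; auto using Rabs_pos; lra. }
  assert (m * m <= eps / 8 * m) by (apply Rmult_le_compat_r; lra).
  lra. }
assert (0 <= eps * m) by (apply Rmult_le_pos; lra).
lra.
Qed.

Lemma is_derive_cexp (z : C) : is_derive cexp z (cexp z).
Proof.
apply (is_derive_ext (fun w => (cexp z * cexp (w - z))%C)).
{ intros w. rewrite <- cexp_plus. f_equal. ring. }
apply is_derive_C_eq with (RtoC 0 * cexp (z - z) + cexp z * ((RtoC 1 - RtoC 0) * RtoC 1))%C;
  [|ring].
apply (is_derive_Cmult (fun _ => cexp z) (fun w => cexp (w - z)%C)).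
- apply is_derive_Cconst.
- apply (is_derive_Ccomp cexp (fun w => (w - z)%C)).
  + replace (z - z)%C with (RtoC 0) by ring. apply is_derive_cexp_0.
  + apply is_derive_Cminus; [apply is_derive_Cid|apply is_derive_Cconst].
Qed.

(** * Integrals of complex-valued functions *)

(** The passage from complex to real calculus: the complex remainder dominates those of the real and
    imaginary parts along any line. *)
Lemma is_derive_Re_line (f : C -> C) (z e l : C) (t : R) :
  is_derive f (z + RtoC t * e)%C l ->
  is_derive (fun s => Re (f (z + RtoC s * e)%C)) t (Re (l * e)%C) /\
  is_derive (fun s => Im (f (z + RtoC s * e)%C)) t (Im (l * e)%C).
Proof.
intros H. rewrite is_derive_C_eps in H.
assert (H' : forall eps, 0 < eps -> exists d, 0 < d /\ forall s, Rabs (s - t) < d ->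
  Cmod (f (z + RtoC s * e) - f (z + RtoC t * e) - RtoC (s - t) * (l * e))%C
   <= eps * Rabs (s - t)).
{ intros eps He. pose proof (Cmod_ge_0 e) as He0.
  destruct (H (eps / (1 + Cmod e))) as [d [Hd K]]. { apply Rdiv_lt_0_compat; lra. }
  exists (d / (1 + Cmod e)). split. { apply Rdiv_lt_0_compat; lra. }
  intros s Hs.
  assert (E : ((z + RtoC s * e) - (z + RtoC t * e) = RtoC (s - t) * e)%C).
  { rewrite RtoC_minus. ring. }
  assert (E' : Cmod ((z + RtoC s * e) - (z + RtoC t * e))%C = Rabs (s - t) * Cmod e).
  { rewrite E, Cmod_mult, Cmod_R. reflexivity. }
  pose proof (Rabs_pos (s - t)).
  replace (RtoC (s - t) * (l * e))%C with (((z + RtoC s * e) - (z + RtoC t * e)) * l)%C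
    by (rewrite E; ring).
  eapply Rle_trans; [apply K|].
  - rewrite E'. apply Rle_lt_trans with (Rabs (s - t) * (1 + Cmod e)); [nra|].
    apply (Rmult_lt_compat_r (1 + Cmod e)) in Hs; [|lra].
    replace (d / (1 + Cmod e) * (1 + Cmod e)) with d in Hs by (field; lra). exact Hs.
  - rewrite E'.
    replace (eps / (1 + Cmod e) * (Rabs (s - t) * Cmod e))
      with (eps * Rabs (s - t) * (Cmod e / (1 + Cmod e))) by (field; lra).
    assert (Cmod e / (1 + Cmod e) <= 1).
    { apply Rmult_le_reg_r with (1 + Cmod e); [lra|].
      replace (Cmod e / (1 + Cmod e) * (1 + Cmod e)) with (Cmod e) by (field; lra). lra. }
    assert (0 <= eps * Rabs (s - t)) by (apply Rmult_le_pos; lra). nra. }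
split; apply is_derive_R_eps; intros eps He; destruct (H' eps He) as [d [Hd K]];
  exists d; (split; [exact Hd|]); intros s Hs; (eapply Rle_trans; [|apply (K s Hs)]).
- eapply Rle_trans; [|apply Rabs_Re_le]. apply Req_le. f_equal.
  unfold Re. simpl. ring.
- eapply Rle_trans; [|apply Rabs_Im_le]. apply Req_le. f_equal.
  unfold Im. simpl. ring.
Qed.

Definition Ccont (f : R -> C) (t : R) : Prop :=
  continuous (fun s => Re (f s)) t /\ continuous (fun s => Im (f s)) t.

Lemma continuous_R_eps (f : R -> R) (t : R) :
  continuous f t <-> forall eps, 0 < eps -> exists d, 0 < d /\
    forall s, Rabs (s - t) < d -> Rabs (f s - f t) < eps.
Proof.
split.
- intros H eps He.
  destruct (proj1 (filterlim_locally (F := locally t) f (f t)) H (mkposreal eps He)) as [d Hd].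
  exists d. split; [apply cond_pos|]. intros s Hs. exact (Hd s Hs).
- intros H. apply (filterlim_locally (F := locally t) f (f t)). intros eps.
  destruct (H eps (cond_pos eps)) as [d [Hd K]]. exists (mkposreal d Hd).
  intros s Hs. exact (K s Hs).
Qed.

Lemma Ccont_eps (f : R -> C) (t : R) :
  Ccont f t <-> forall eps, 0 < eps -> exists d, 0 < d /\
    forall s, Rabs (s - t) < d -> Cmod (f s - f t)%C < eps.
Proof.
unfold Ccont. rewrite !continuous_R_eps. split.
- intros [H1 H2] eps He.
  destruct (H1 (eps / 2)) as [d1 [Hd1 K1]]; [lra|].
  destruct (H2 (eps / 2)) as [d2 [Hd2 K2]]; [lra|].
  exists (Rmin d1 d2). split; [now apply Rmin_pos|]. intros s Hs.
  specialize (K1 s (Rlt_le_trans _ _ _ Hs (Rmin_l _ _))).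
  specialize (K2 s (Rlt_le_trans _ _ _ Hs (Rmin_r _ _))).
  eapply Rle_lt_trans; [apply Cmod_le_Re_Im|].
  unfold Re, Im in *; simpl. unfold Rminus in *. lra.
- intros H. split; intros eps He; destruct (H eps He) as [d [Hd K]]; exists d;
  (split; [exact Hd|]); intros s Hs; (eapply Rle_lt_trans; [|apply (K s Hs)]).
  + eapply Rle_trans; [|apply Rabs_Re_le]. apply Req_le. reflexivity.
  + eapply Rle_trans; [|apply Rabs_Im_le]. apply Req_le. reflexivity.
Qed.

Lemma Ccont_comp (f : C -> C) (g : R -> C) (t : R) :
  ex_derive f (g t) -> Ccont g t -> Ccont (fun s => f (g s)) t.
Proof.
rewrite !Ccont_eps. intros Hf Hg eps He.
destruct (ex_derive_C_continuous f _ Hf eps He) as [d [Hd K]].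
destruct (Hg d Hd) as [d' [Hd' K']]. exists d'; split; auto.
Qed.

Definition Cint (f : R -> C) (a b : R) : C :=
  (RInt (fun t => Re (f t)) a b, RInt (fun t => Im (f t)) a b).

Definition ex_Cint (f : R -> C) (a b : R) : Prop :=
  ex_RInt (fun t => Re (f t)) a b /\ ex_RInt (fun t => Im (f t)) a b.

Lemma ex_Cint_cont (f : R -> C) (a b : R) :
  a <= b -> (forall t, a <= t <= b -> Ccont f t) -> ex_Cint f a b.
Proof.
intros Hab H. split; apply (ex_RInt_continuous (V := R_CompleteNormedModule));
rewrite Rmin_left, Rmax_right by lra; intros z Hz; apply (H z Hz).
Qed.

Lemma Cint_ext (f g : R -> C) (a b : R) :
  a <= b -> (forall t, a <= t <= b -> f t = g t) -> Cint f a b = Cint g a b.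
Proof.
intros Hab H. unfold Cint. f_equal; apply RInt_ext;
rewrite Rmin_left, Rmax_right by lra; intros z Hz; rewrite H by lra; reflexivity.
Qed.

Lemma Cint_plus (f g : R -> C) (a b : R) : ex_Cint f a b -> ex_Cint g a b ->
  ex_Cint (fun t => f t + g t)%C a b /\
  Cint (fun t => f t + g t)%C a b = (Cint f a b + Cint g a b)%C.
Proof.
intros [H1 H2] [H3 H4]. split.
- split; [exact (ex_RInt_plus _ _ _ _ H1 H3)|exact (ex_RInt_plus _ _ _ _ H2 H4)].
- unfold Cint, Cplus; simpl. f_equal;
  [exact (RInt_plus _ _ _ _ H1 H3)|exact (RInt_plus _ _ _ _ H2 H4)].
Qed.

Lemma Cint_scal (k : C) (f : R -> C) (a b : R) : ex_Cint f a b ->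
  ex_Cint (fun t => k * f t)%C a b /\
  Cint (fun t => k * f t)%C a b = (k * Cint f a b)%C.
Proof.
intros [H1 H2].
pose proof (fun l => ex_RInt_scal _ _ _ l H1) as E1.
pose proof (fun l => ex_RInt_scal _ _ _ l H2) as E2.
pose proof (fun l => RInt_scal _ _ _ l H1) as S1.
pose proof (fun l => RInt_scal _ _ _ l H2) as S2.
split; [split|].
- exact (ex_RInt_minus _ _ _ _ (E1 (Re k)) (E2 (Im k))).
- exact (ex_RInt_plus _ _ _ _ (E2 (Re k)) (E1 (Im k))).
- unfold Cint, Cmult; simpl. f_equal.
  + etransitivity; [exact (RInt_minus _ _ _ _ (E1 (Re k)) (E2 (Im k)))|].
    exact (f_equal2 Rminus (S1 (Re k)) (S2 (Im k))).
  + etransitivity; [exact (RInt_plus _ _ _ _ (E2 (Re k)) (E1 (Im k)))|].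
    exact (f_equal2 Rplus (S2 (Re k)) (S1 (Im k))).
Qed.

Lemma Cint_minus (f g : R -> C) (a b : R) : ex_Cint f a b -> ex_Cint g a b ->
  ex_Cint (fun t => f t - g t)%C a b /\
  Cint (fun t => f t - g t)%C a b = (Cint f a b - Cint g a b)%C.
Proof.
intros [H1 H2] [H3 H4]. split.
- split; [exact (ex_RInt_minus _ _ _ _ H1 H3)|exact (ex_RInt_minus _ _ _ _ H2 H4)].
- unfold Cint, Cminus, Cplus, Copp; simpl. f_equal;
  [exact (RInt_minus _ _ _ _ H1 H3)|exact (RInt_minus _ _ _ _ H2 H4)].
Qed.

Lemma Cint_const (k : C) (a b : R) :
  ex_Cint (fun _ => k) a b /\ Cint (fun _ => k) a b = (RtoC (b - a) * k)%C.
Proof.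
split.
- split; apply ex_RInt_const.
- unfold Cint. rewrite !RInt_const. unfold Cmult, scal; simpl. unfold mult; simpl.
  unfold Re, Im. f_equal; ring.
Qed.

Lemma Cint_Chasles (f : R -> C) (a b c : R) : ex_Cint f a b -> ex_Cint f b c ->
  Cint f a c = (Cint f a b + Cint f b c)%C.
Proof.
intros [H1 H2] [H3 H4]. unfold Cint, Cplus; simpl. f_equal; symmetry;
[exact (RInt_Chasles _ _ _ _ H1 H3)|exact (RInt_Chasles _ _ _ _ H2 H4)].
Qed.

Lemma Cmod_sqr (z : C) : Cmod z * Cmod z = Re z * Re z + Im z * Im z.
Proof. pose proof (Cmod2_alt z) as H. simpl in H. lra. Qed.

(** With I the integral, |I|^2 is the integral of the real function Re(conj(I) f), which is at most
    |I| M. Bounding the two components separately would lose a factor. *)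
Lemma Cint_norm_le (f : R -> C) (a b M : R) : a <= b -> ex_Cint f a b ->
  (forall t, a <= t <= b -> Cmod (f t) <= M) -> Cmod (Cint f a b) <= (b - a) * M.
Proof.
intros Hab Hf HM. set (I := Cint f a b).
destruct (Req_dec (Cmod I) 0) as [H0|H0].
{ rewrite H0. apply Rmult_le_pos; [lra|].
  eapply Rle_trans; [apply Cmod_ge_0|apply (HM a); lra]. }
pose proof (Cmod_ge_0 I).
apply Rmult_le_reg_l with (Cmod I); [lra|].
destruct (Cint_scal (Cconj I) f a b Hf) as [[E _] S].
apply (f_equal Re) in S.
replace (Cmod I * Cmod I) with (Re (Cconj I * Cint f a b)%C).
2: { fold I. rewrite Cmod_sqr. unfold Re, Im, Cconj; simpl. ring. }
rewrite <- S.
replace (Cmod I * ((b - a) * M)) with (RInt (fun _ => Cmod I * M) a b).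
2: { rewrite RInt_const. unfold scal; simpl. unfold mult; simpl. ring. }
apply RInt_le; auto.
{ apply ex_RInt_const. }
intros t Ht. eapply Rle_trans; [apply Rle_abs|]. eapply Rle_trans; [apply Rabs_Re_le|].
rewrite Cmod_mult, Cmod_conj. apply Rmult_le_compat_l; [lra|]. apply HM; lra.
Qed.

(** * Goursat's theorem *)

Lemma two_pow_pos (n : nat) : 0 < 2 ^ n.
Proof. apply pow_lt; lra. Qed.

(** Nested rectangles with lower left corner (x, y) and sides a/2^n, b/2^n. The property [P] is left
    abstract because the construction serves both Goursat's theorem and the existence of maxima. *)
Lemma quadrisection (P : nat -> R -> R -> Prop) (a b x0 y0 : R) :
  0 <= a -> 0 <= b -> P 0%nat x0 y0 ->
  (forall n x y, P n x y -> exists i j : R, 0 <= i <= 1 /\ 0 <= j <= 1 /\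
     P (S n) (x + i * (a / 2 ^ S n)) (y + j * (b / 2 ^ S n))) ->
  exists X Y : R, forall n, exists x y,
    P n x y /\ x <= X <= x + a / 2 ^ n /\ y <= Y <= y + b / 2 ^ n.
Proof.
intros Ha Hb H0 HS.
(* Dependent choice: each corner is bundled with its proof of [P], so that [nat_rect] can iterate
   the step. *)
assert (next : forall n (p : {q : R * R | P n (fst q) (snd q)}),
  {q : {q : R * R | P (S n) (fst q) (snd q)} |
     fst (proj1_sig p) <= fst (proj1_sig q) /\
     fst (proj1_sig q) + a / 2 ^ S n <= fst (proj1_sig p) + a / 2 ^ n /\
     snd (proj1_sig p) <= snd (proj1_sig q) /\
     snd (proj1_sig q) + b / 2 ^ S n <= snd (proj1_sig p) + b / 2 ^ n}).
{ intros n [[x y] Hp]; simpl in *. apply constructive_indefinite_description.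
  destruct (HS n x y Hp) as [i [j [Hi [Hj K]]]].
  exists (exist _ (x + i * (a / 2 ^ S n), y + j * (b / 2 ^ S n)) K); simpl.
  pose proof (two_pow_pos n).
  replace (a / 2 ^ n) with (2 * (a / (2 * 2 ^ n))) by (field; lra).
  replace (b / 2 ^ n) with (2 * (b / (2 * 2 ^ n))) by (field; lra).
  assert (0 <= a / (2 * 2 ^ n)) by (apply Rdiv_le_0_compat; lra).
  assert (0 <= b / (2 * 2 ^ n)) by (apply Rdiv_le_0_compat; lra).
  repeat split; nra. }
set (u := nat_rect (fun n => {q : R * R | P n (fst q) (snd q)})
            (exist _ (x0, y0) H0) (fun n p => proj1_sig (next n p))).
set (x := fun n => fst (proj1_sig (u n))). set (y := fun n => snd (proj1_sig (u n))).
assert (Hu : forall n, x n <= x (S n) /\ x (S n) + a / 2 ^ S n <= x n + a / 2 ^ n /\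
                       y n <= y (S n) /\ y (S n) + b / 2 ^ S n <= y n + b / 2 ^ n).
{ intros n. exact (proj2_sig (next n (u n))). }
assert (lim : forall (z : nat -> R) c, 0 <= c ->
  (forall n, z n <= z (S n) /\ z (S n) + c / 2 ^ S n <= z n + c / 2 ^ n) ->
  exists Z, forall n, z n <= Z <= z n + c / 2 ^ n).
{ clear. intros z c Hc H.
  assert (Hc' : forall n, 0 <= c / 2 ^ n).
  { intros n. apply Rdiv_le_0_compat; [lra|apply two_pow_pos]. }
  assert (M : forall n k, z n <= z (n + k)%nat /\ z (n + k)%nat + c / 2 ^ (n + k) <= z n + c / 2 ^ n).
  { intros n k. induction k as [|k IH].
    - rewrite Nat.add_0_r. lra.
    - rewrite Nat.add_succ_r. specialize (H (n + k)%nat). lra. }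
  assert (B : forall n m, z n <= z m + c / 2 ^ m).
  { intros n m. destruct (Nat.le_ge_cases n m) as [h|h].
    - replace m with (n + (m - n))%nat by lia. specialize (M n (m - n)%nat).
      specialize (Hc' (n + (m - n))%nat). lra.
    - replace n with (m + (n - m))%nat by lia. specialize (M m (n - m)%nat).
      specialize (Hc' (m + (n - m))%nat). lra. }
  destruct (completeness (fun v => exists n, v = z n)) as [Z [HZ1 HZ2]].
  - exists (z 0%nat + c / 2 ^ 0). intros v [n ->]. apply B.
  - exists (z 0%nat), 0%nat. reflexivity.
  - exists Z. intros n. split.
    + apply HZ1. now exists n.
    + apply HZ2. intros v [k ->]. apply B. }
destruct (lim x a Ha) as [X HX]. { intros n. destruct (Hu n) as [? [? [? ?]]]. lra. }
destruct (lim y b Hb) as [Y HY]. { intros n. destruct (Hu n) as [? [? [? ?]]]. lra. }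
exists X, Y. intros n. exists (x n), (y n). split; [exact (proj2_sig (u n))|].
split; [apply HX|apply HY].
Qed.

(* The integral of [f] along the positively oriented boundary of [x1,x2] x [y1,y2]. *)
Definition rect (f : C -> C) (x1 x2 y1 y2 : R) : C :=
  (Cint (fun t => f (t, y1)) x1 x2 - Cint (fun t => f (t, y2)) x1 x2
   + Ci * (Cint (fun t => f (x2, t)) y1 y2 - Cint (fun t => f (x1, t)) y1 y2))%C.

Definition derivable_rect (f : C -> C) (x1 x2 y1 y2 : R) : Prop :=
  forall x y, x1 <= x <= x2 -> y1 <= y <= y2 -> ex_derive f (x, y).

Lemma Ccont_horizontal (f : C -> C) (x y : R) :
  ex_derive f (x, y) -> Ccont (fun t => f (t, y)) x.
Proof.
intros H. apply (Ccont_comp f (fun t => (t, y))); auto. split.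
- apply continuous_id.
- apply continuous_const.
Qed.

Lemma Ccont_vertical (f : C -> C) (x y : R) :
  ex_derive f (x, y) -> Ccont (fun t => f (x, t)) y.
Proof.
intros H. apply (Ccont_comp f (fun t => (x, t))); auto. split.
- apply continuous_const.
- apply continuous_id.
Qed.

Lemma ex_Cint_horizontal (f : C -> C) (x1 x2 y1 y2 a b y : R) :
  derivable_rect f x1 x2 y1 y2 -> x1 <= a -> a <= b -> b <= x2 -> y1 <= y <= y2 ->
  ex_Cint (fun t => f (t, y)) a b.
Proof.
intros H Ha Hab Hb Hy. apply ex_Cint_cont; auto.
intros t Ht. apply Ccont_horizontal, H; lra.
Qed.

Lemma ex_Cint_vertical (f : C -> C) (x1 x2 y1 y2 a b x : R) :
  derivable_rect f x1 x2 y1 y2 -> y1 <= a -> a <= b -> b <= y2 -> x1 <= x <= x2 ->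
  ex_Cint (fun t => f (x, t)) a b.
Proof.
intros H Ha Hab Hb Hx. apply ex_Cint_cont; auto.
intros t Ht. apply Ccont_vertical, H; lra.
Qed.

Lemma rect_split (f : C -> C) (x1 xm x2 y1 ym y2 : R) :
  x1 <= xm <= x2 -> y1 <= ym <= y2 -> derivable_rect f x1 x2 y1 y2 ->
  rect f x1 x2 y1 y2 =
    (rect f x1 xm y1 ym + rect f xm x2 y1 ym + rect f x1 xm ym y2 + rect f xm x2 ym y2)%C.
Proof.
intros Hx Hy H.
assert (B : forall y, y1 <= y <= y2 -> Cint (fun t => f (t, y)) x1 x2 =
  (Cint (fun t => f (t, y)) x1 xm + Cint (fun t => f (t, y)) xm x2)%C).
{ intros y Hy'. apply Cint_Chasles; eapply ex_Cint_horizontal; eauto; lra. }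
assert (L : forall x, x1 <= x <= x2 -> Cint (fun t => f (x, t)) y1 y2 =
  (Cint (fun t => f (x, t)) y1 ym + Cint (fun t => f (x, t)) ym y2)%C).
{ intros x Hx'. apply Cint_Chasles; eapply ex_Cint_vertical; eauto; lra. }
unfold rect. rewrite !B, !L by lra. ring.
Qed.

Lemma Cint_minus_plus (f g : R -> C) (a b : R) : ex_Cint f a b -> ex_Cint g a b ->
  Cint f a b = (Cint (fun t => f t - g t)%C a b + Cint g a b)%C /\
  ex_Cint (fun t => f t - g t)%C a b.
Proof.
intros Hf Hg. destruct (Cint_minus f g a b Hf Hg) as [E1 E2].
split; [rewrite E2; ring|exact E1].
Qed.

(** An affine function has zero integral around the rectangle ([DH] and [DV] cancel since Ci^2 =
    -1), so only the deviation counts, and it is bounded by perimeter times [M]. *)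
Lemma rect_affine_approx (f : C -> C) (x1 x2 y1 y2 M : R) (k l : C) :
  x1 <= x2 -> y1 <= y2 -> derivable_rect f x1 x2 y1 y2 ->
  (forall x y, x1 <= x <= x2 -> y1 <= y <= y2 -> Cmod (f (x, y) - (k + (x, y) * l))%C <= M) ->
  Cmod (rect f x1 x2 y1 y2) <= 2 * ((x2 - x1) + (y2 - y1)) * M.
Proof.
intros Hx Hy H HM.
set (g := fun z : C => (f z - (k + z * l))%C).
assert (Hlin : derivable_rect (fun z => (k + z * l)%C) x1 x2 y1 y2).
{ intros x y _ _. eexists.
  apply (is_derive_Cplus (fun _ => k) (fun z => (z * l)%C)); [apply is_derive_Cconst|].
  apply (is_derive_Cmult (fun z => z) (fun _ => l)); [apply is_derive_Cid|apply is_derive_Cconst]. }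
assert (EB : Cint (fun t => f (t, y1)) x1 x2 = (Cint (fun t => g (t, y1)) x1 x2 + Cint (fun t => k + (t, y1) * l) x1 x2)%C
  /\ ex_Cint (fun t => g (t, y1)) x1 x2).
{ apply (Cint_minus_plus (fun t => f (t, y1)) (fun t => (k + (t, y1) * l)%C)).
  - eapply ex_Cint_horizontal; eauto; lra.
  - apply (ex_Cint_horizontal _ _ _ _ _ _ _ _ Hlin); lra. }
assert (ET : Cint (fun t => f (t, y2)) x1 x2 = (Cint (fun t => g (t, y2)) x1 x2 + Cint (fun t => k + (t, y2) * l) x1 x2)%C
  /\ ex_Cint (fun t => g (t, y2)) x1 x2).
{ apply (Cint_minus_plus (fun t => f (t, y2)) (fun t => (k + (t, y2) * l)%C)).
  - eapply ex_Cint_horizontal; eauto; lra.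
  - apply (ex_Cint_horizontal _ _ _ _ _ _ _ _ Hlin); lra. }
assert (EL : Cint (fun t => f (x1, t)) y1 y2 = (Cint (fun t => g (x1, t)) y1 y2 + Cint (fun t => k + (x1, t) * l) y1 y2)%C
  /\ ex_Cint (fun t => g (x1, t)) y1 y2).
{ apply (Cint_minus_plus (fun t => f (x1, t)) (fun t => (k + (x1, t) * l)%C)).
  - eapply ex_Cint_vertical; eauto; lra.
  - apply (ex_Cint_vertical _ _ _ _ _ _ _ _ Hlin); lra. }
assert (ER : Cint (fun t => f (x2, t)) y1 y2 = (Cint (fun t => g (x2, t)) y1 y2 + Cint (fun t => k + (x2, t) * l) y1 y2)%C
  /\ ex_Cint (fun t => g (x2, t)) y1 y2).
{ apply (Cint_minus_plus (fun t => f (x2, t)) (fun t => (k + (x2, t) * l)%C)).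
  - eapply ex_Cint_vertical; eauto; lra.
  - apply (ex_Cint_vertical _ _ _ _ _ _ _ _ Hlin); lra. }
assert (DH : (Cint (fun t => k + (t, y1) * l) x1 x2 - Cint (fun t => k + (t, y2) * l) x1 x2
   = RtoC (x2 - x1) * (Ci * RtoC (y1 - y2) * l))%C).
{ rewrite <- (proj2 (Cint_const _ _ _)).
  rewrite <- (proj2 (Cint_minus _ _ _ _
    (ex_Cint_horizontal _ _ _ _ _ x1 x2 y1 Hlin ltac:(lra) ltac:(lra) ltac:(lra) ltac:(lra))
    (ex_Cint_horizontal _ _ _ _ _ x1 x2 y2 Hlin ltac:(lra) ltac:(lra) ltac:(lra) ltac:(lra)))).
  apply Cint_ext; auto. intros t _.
  apply injective_projections; simpl; ring. }
assert (DV : (Cint (fun t => k + (x2, t) * l) y1 y2 - Cint (fun t => k + (x1, t) * l) y1 y2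
   = RtoC (y2 - y1) * (RtoC (x2 - x1) * l))%C).
{ rewrite <- (proj2 (Cint_const _ _ _)).
  rewrite <- (proj2 (Cint_minus _ _ _ _
    (ex_Cint_vertical _ _ _ _ _ y1 y2 x2 Hlin ltac:(lra) ltac:(lra) ltac:(lra) ltac:(lra))
    (ex_Cint_vertical _ _ _ _ _ y1 y2 x1 Hlin ltac:(lra) ltac:(lra) ltac:(lra) ltac:(lra)))).
  apply Cint_ext; auto. intros t _.
  apply injective_projections; simpl; ring. }
destruct EB as [EB XB], ET as [ET XT], EL as [EL XL], ER as [ER XR].
assert (NB := Cint_norm_le _ _ _ M Hx XB ltac:(intros; apply HM; lra)).
assert (NT := Cint_norm_le _ _ _ M Hx XT ltac:(intros; apply HM; lra)).
assert (NL := Cint_norm_le _ _ _ M Hy XL ltac:(intros; apply HM; lra)).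
assert (NR := Cint_norm_le _ _ _ M Hy XR ltac:(intros; apply HM; lra)).
replace (rect f x1 x2 y1 y2) with
  ((Cint (fun t => g (t, y1)) x1 x2 + - Cint (fun t => g (t, y2)) x1 x2
   + Ci * (Cint (fun t => g (x2, t)) y1 y2 + - Cint (fun t => g (x1, t)) y1 y2)))%C.
- eapply Rle_trans; [apply Cmod_triangle|].
  rewrite Cmod_mult, Cmod_Ci.
  pose proof (Cmod_triangle (Cint (fun t => g (t, y1)) x1 x2) (- Cint (fun t => g (t, y2)) x1 x2)%C).
  pose proof (Cmod_triangle (Cint (fun t => g (x2, t)) y1 y2) (- Cint (fun t => g (x1, t)) y1 y2)%C).
  rewrite Cmod_opp in *. lra.
- unfold rect. rewrite EB, ET, EL, ER.
  match goal with |- ?u = (?B1 + ?B2 - (?T1 + ?T2) + Ci * (?R1 + ?R2 - (?L1 + ?L2)))%C =>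
    replace (B1 + B2 - (T1 + T2) + Ci * (R1 + R2 - (L1 + L2)))%C
    with (B1 - T1 + Ci * (R1 - L1) + ((B2 - T2) + Ci * (R2 - L2)))%C by ring end.
  rewrite DH, DV, !RtoC_minus. ring.
Qed.

Lemma goursat (f : C -> C) (x1 x2 y1 y2 : R) :
  x1 <= x2 -> y1 <= y2 -> derivable_rect f x1 x2 y1 y2 -> rect f x1 x2 y1 y2 = RtoC 0.
Proof.
intros Hx Hy H. apply Cmod_eq_0.
set (m := Cmod (rect f x1 x2 y1 y2)).
destruct (Req_dec m 0) as [|Hm0]; auto. exfalso.
assert (Hm : 0 < m) by (pose proof (Cmod_ge_0 (rect f x1 x2 y1 y2)); fold m in H0; lra).
set (a := x2 - x1). set (b := y2 - y1).
(* Of the four quarters, one carries at least a quarter of the integral. *)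
set (P := fun n x y => m / 4 ^ n <= Cmod (rect f x (x + a / 2 ^ n) y (y + b / 2 ^ n)) /\
   x1 <= x /\ x + a / 2 ^ n <= x2 /\ y1 <= y /\ y + b / 2 ^ n <= y2).
assert (Hab : forall n, 0 <= a / 2 ^ n /\ 0 <= b / 2 ^ n).
{ intros n. unfold a, b. split; (apply Rdiv_le_0_compat; [lra|apply two_pow_pos]). }
destruct (quadrisection P a b x1 y1) as [X [Y HXY]].
- unfold a; lra.
- unfold b; lra.
- unfold P; simpl. replace (x1 + a / 1) with x2 by (unfold a; field).
  replace (y1 + b / 1) with y2 by (unfold b; field). fold m. unfold Rdiv. rewrite Rinv_1. lra.
- intros n x y [K [B1 [B2 [B3 B4]]]].
  pose proof (two_pow_pos n). pose proof (Hab (S n)) as [Ha' Hb'].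
  set (a' := a / 2 ^ S n) in *. set (b' := b / 2 ^ S n) in *.
  assert (Ea : a / 2 ^ n = a' + a') by (unfold a'; simpl; field; lra).
  assert (Eb : b / 2 ^ n = b' + b') by (unfold b'; simpl; field; lra).
  rewrite Ea, Eb in *.
  rewrite (rect_split f x (x + a') _ y (y + b')) in K; [|lra|lra|].
  2: { intros u v Hu Hv; apply H; lra. }
  assert (Em : m / 4 ^ n = 4 * (m / 4 ^ S n)).
  { simpl. field. apply pow_nonzero; lra. }
  rewrite Em in K.
  set (q := m / 4 ^ S n) in *.
  assert (Q : exists i j, 0 <= i <= 1 /\ 0 <= j <= 1 /\
    q <= Cmod (rect f (x + i * a') (x + i * a' + a') (y + j * b') (y + j * b' + b'))).
  { apply NNPP; intros HN.
    assert (N : forall i j, 0 <= i <= 1 -> 0 <= j <= 1 ->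
      Cmod (rect f (x + i * a') (x + i * a' + a') (y + j * b') (y + j * b' + b')) < q).
    { intros i j Hi Hj. apply Rnot_le_lt. intros HH. apply HN. now exists i, j. }
    pose proof (N 0 0 ltac:(lra) ltac:(lra)) as N1.
    pose proof (N 1 0 ltac:(lra) ltac:(lra)) as N2.
    pose proof (N 0 1 ltac:(lra) ltac:(lra)) as N3.
    pose proof (N 1 1 ltac:(lra) ltac:(lra)) as N4.
    replace (x + 0 * a') with x in * by ring. replace (y + 0 * b') with y in * by ring.
    replace (x + 1 * a') with (x + a') in * by ring. replace (y + 1 * b') with (y + b') in * by ring.
    replace (x + (a' + a')) with (x + a' + a') in K by ring.
    replace (y + (b' + b')) with (y + b' + b') in K by ring.
    revert K. apply Rlt_not_le.
    eapply Rle_lt_trans; [apply Cmod_triangle|].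
    eapply Rle_lt_trans; [apply Rplus_le_compat_r, Cmod_triangle|].
    eapply Rle_lt_trans; [apply Rplus_le_compat_r, Rplus_le_compat_r, Cmod_triangle|].
    lra. }
  destruct Q as [i [j [Hi [Hj Q]]]]. exists i, j. split; [exact Hi|split; [exact Hj|]].
  unfold P. fold a' b' q. split; [exact Q|]. nra.
- assert (HB : x1 <= X <= x2 /\ y1 <= Y <= y2).
  { destruct (HXY 0%nat) as [x [y [[_ K] K']]]. lra. }
  destruct (H X Y ltac:(lra) ltac:(lra)) as [l Hl].
  rewrite is_derive_C_eps in Hl.
  assert (Hab0 : 0 <= a + b) by (unfold a, b; lra).
  set (s := a + b) in *.
  (* With e this constant and h = 1/2^N, the small rectangle gives m h^2 <= 2 e s^2 h^2, hence m <=
     m/2. Writing 1 + s keeps the denominators positive for a degenerate rectangle. *)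
  destruct (Hl (m / (4 * (1 + s) ^ 2))) as [d [Hd K]].
  { apply Rdiv_lt_0_compat; auto. apply Rmult_lt_0_compat; [lra|apply pow_lt; lra]. }
  destruct (pow_lt_1_zero (/ 2) ltac:(rewrite Rabs_pos_eq; lra) (d / (1 + s))) as [N HN].
  { apply Rdiv_lt_0_compat; lra. }
  specialize (HN N (Nat.le_refl N)).
  rewrite Rabs_pos_eq in HN by (apply pow_le; lra). rewrite pow_inv in HN.
  destruct (HXY N) as [x [y [[K1 [B1 [B2 [B3 B4]]]] [K2 K3]]]].
  pose proof (two_pow_pos N) as H2N. pose proof (Hab N) as [Ha' Hb'].
  set (h := / 2 ^ N) in *.
  assert (Hh : 0 < h) by now apply Rinv_0_lt_compat.
  unfold Rdiv in Ha', Hb', K1, K2, K3, B1, B2, B3, B4; fold h in Ha', Hb', K1, K2, K3, B1, B2, B3, B4.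
  assert (Hsd : s * h < d).
  { apply (Rmult_lt_compat_r (1 + s)) in HN; [|lra].
    replace (d / (1 + s) * (1 + s)) with d in HN by (field; lra). nra. }
  set (e := m / (4 * (1 + s) ^ 2)) in *.
  assert (He : 0 < e).
  { apply Rdiv_lt_0_compat; auto. apply Rmult_lt_0_compat; [lra|apply pow_lt; lra]. }
  assert (A := rect_affine_approx f x (x + a * h) y (y + b * h) (e * (s * h))
     (f (X, Y) - (X, Y) * l)%C l ltac:(lra) ltac:(lra)).
  assert (A1 : Cmod (rect f x (x + a * h) y (y + b * h)) <= 2 * (s * h) * (e * (s * h))).
  { eapply Rle_trans; [apply A|].
    - intros u v Hu Hv; apply H; lra.
    - intros u v Hu Hv.
      assert (D : Cmod ((u, v) - (X, Y))%C <= s * h).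
      { eapply Rle_trans; [apply Cmod_le_Re_Im|]. unfold Re, Im; simpl.
        replace (s * h) with (a * h + b * h) by (unfold s; ring).
        apply Rplus_le_compat; apply Rabs_le; lra. }
      replace (f (u, v) - (f (X, Y) - (X, Y) * l + (u, v) * l))%C
        with (f (u, v) - f (X, Y) - ((u, v) - (X, Y)) * l)%C by ring.
      eapply Rle_trans; [apply K; lra|]. apply Rmult_le_compat_l; lra.
    - apply Req_le. unfold s; ring. }
  assert (E4 : m * / 4 ^ N = m * (h * h)).
  { unfold h. replace 4 with (2 * 2) by ring. rewrite Rpow_mult_distr, Rinv_mult. ring. }
  rewrite E4 in K1.
  assert (E5 : e * (4 * (1 + s) ^ 2) = m).
  { unfold e. field. lra. }
  assert (0 < h * h) by nra.
  assert (m * (h * h) <= 2 * e * s ^ 2 * (h * h)).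
  { eapply Rle_trans; [exact K1|]. eapply Rle_trans; [exact A1|]. apply Req_le; ring. }
  assert (m <= 2 * e * s ^ 2) by (eapply Rmult_le_reg_r; eauto).
  assert (s ^ 2 <= (1 + s) ^ 2) by nra.
  assert (e * s ^ 2 <= e * (1 + s) ^ 2) by (apply Rmult_le_compat_l; lra).
  nra.
Qed.

(** * Cauchy's formula on circles *)

Lemma is_derive_C_ext_loc (f g : C -> C) (z l : C) (r : R) :
  0 < r -> (forall w, Cmod (w - z)%C < r -> f w = g w) ->
  is_derive f z l -> is_derive g z l.
Proof.
intros Hr Hfg. rewrite !is_derive_C_eps. intros H eps He.
destruct (H eps He) as [d [Hd K]].
exists (Rmin d r). split; [now apply Rmin_pos|]. intros w Hw.
pose proof (Rmin_l d r). pose proof (Rmin_r d r).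
rewrite <- !Hfg; [apply K; lra| |lra].
replace (z - z)%C with (RtoC 0) by ring. rewrite Cmod_0. exact Hr.
Qed.

Lemma exp_le_exp (x y : R) : x <= y -> exp x <= exp y.
Proof. intros [h| ->]; [left; now apply exp_increasing|lra]. Qed.

Definition circle (r t : R) : C := (r * cos t, r * sin t).

Lemma Cmod_circle (r t : R) : 0 <= r -> Cmod (circle r t) = r.
Proof. apply Cmod_polar. Qed.

Lemma cexp_ln (r t : R) : 0 < r -> cexp (ln r, t) = circle r t.
Proof. intros Hr. unfold cexp, circle; simpl. now rewrite exp_ln. Qed.

Lemma Ccont_circle (r t : R) : Ccont (circle r) t.
Proof.
split; apply (ex_derive_continuous (V := R_NormedModule)); unfold circle; simpl; auto_derive; auto.
Qed.

(** This is the integral of g(w) dw / (i w). In this normalization it does not depend on the radius,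
    and Cauchy's kernel takes the form w / (w - z). *)
Definition circle_int (g : C -> C) (r : R) : C := Cint (fun t => g (circle r t)) 0 (2 * PI).

Lemma two_PI_pos : 0 < 2 * PI.
Proof. pose proof PI_RGT_0. lra. Qed.

Lemma ex_circle_int (g : C -> C) (r : R) :
  0 <= r -> (forall w, Cmod w = r -> ex_derive g w) ->
  ex_Cint (fun t => g (circle r t)) 0 (2 * PI).
Proof.
intros Hr H. apply ex_Cint_cont; [pose proof two_PI_pos; lra|].
intros t _. apply Ccont_comp; [apply H, Cmod_circle; auto|apply Ccont_circle].
Qed.

(* Goursat's theorem for the rectangle which the exponential maps onto the annulus. *)
Lemma circle_int_annulus (g : C -> C) (r1 r2 : R) :
  0 < r1 <= r2 -> (forall w, r1 <= Cmod w <= r2 -> ex_derive g w) ->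
  circle_int g r1 = circle_int g r2.
Proof.
intros Hr H. pose proof two_PI_pos as Hpi.
assert (G := goursat (fun z => g (cexp z)) (ln r1) (ln r2) 0 (2 * PI)).
unfold rect in G.
(* The exponential has period 2 PI i, so the two horizontal sides have the same image and cancel. *)
replace (Cint (fun t => g (cexp (t, 2 * PI))) (ln r1) (ln r2))
  with (Cint (fun t => g (cexp (t, 0))) (ln r1) (ln r2)) in G.
2: { f_equal. unfold cexp; simpl. rewrite cos_2PI, sin_2PI, cos_0, sin_0. reflexivity. }
assert (E : forall r, 0 < r -> Cint (fun t => g (cexp (ln r, t))) 0 (2 * PI) = circle_int g r).
{ intros r Hr0. apply Cint_ext; [lra|]. intros t _. now rewrite cexp_ln. }
rewrite !E in G by lra.
assert (Hln : ln r1 <= ln r2).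
{ destruct (proj2 Hr) as [h|h]; [left; apply ln_increasing; lra|rewrite h; lra]. }
specialize (G Hln ltac:(lra)).
assert (D : derivable_rect (fun z => g (cexp z)) (ln r1) (ln r2) 0 (2 * PI)).
{ intros x y Hx _. destruct (H (cexp (x, y))) as [l Hl].
  - rewrite Cmod_cexp. simpl. rewrite <- (exp_ln r1), <- (exp_ln r2) by lra.
    split; apply exp_le_exp; lra.
  - exists (cexp (x, y) * l)%C. apply is_derive_Ccomp; auto. apply is_derive_cexp. }
specialize (G D).
replace (circle_int g r1) with (circle_int g r2
   + Ci * (Cint (fun t => g (cexp (t, 0))) (ln r1) (ln r2) -
       Cint (fun t => g (cexp (t, 0))) (ln r1) (ln r2) +
       Ci * (circle_int g r2 - circle_int g r1)))%C.
- rewrite G. ring.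
- replace (Ci * (Cint (fun t => g (cexp (t, 0))) (ln r1) (ln r2) -
       Cint (fun t => g (cexp (t, 0))) (ln r1) (ln r2) +
       Ci * (circle_int g r2 - circle_int g r1)))%C
  with ((Ci * Ci) * (circle_int g r2 - circle_int g r1))%C by ring.
  replace (Ci * Ci)%C with (- RtoC 1)%C; [ring|].
  apply injective_projections; simpl; ring.
Qed.

Lemma circle_int_approx (g : C -> C) (k : C) (r e : R) :
  0 <= r -> (forall w, Cmod w = r -> ex_derive g w) ->
  (forall w, Cmod w = r -> Cmod (g w - k)%C <= e) ->
  Cmod (circle_int g r - RtoC (2 * PI) * k)%C <= 2 * PI * e.
Proof.
intros Hr Hg He. pose proof two_PI_pos.
destruct (Cint_const k 0 (2 * PI)) as [K1 K2]. rewrite Rminus_0_r in K2.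
destruct (Cint_minus _ _ _ _ (ex_circle_int g r Hr Hg) K1) as [E1 E2].
rewrite <- K2. unfold circle_int. rewrite <- E2.
rewrite <- (Rminus_0_r (2 * PI)) at 2.
apply Cint_norm_le; [lra|exact E1|].
intros t _. apply He, Cmod_circle; auto.
Qed.

Lemma Cmod_small_eq (x y : C) (k : R) :
  0 < k -> (forall e, 0 < e -> Cmod (x - y)%C <= k * e) -> x = y.
Proof.
intros Hk H. assert (E : Cmod (x - y)%C = 0).
{ apply Rle_antisym; [|apply Cmod_ge_0]. apply Rnot_lt_le. intros h.
  specialize (H (Cmod (x - y)%C / (2 * k)) ltac:(apply Rdiv_lt_0_compat; lra)).
  replace (k * (Cmod (x - y) / (2 * k)))%R with (Cmod (x - y)%C / 2) in H by (field; lra). lra. }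
apply Cmod_eq_0 in E. replace x with (x - y + y)%C by ring. rewrite E. ring.
Qed.

(** The radius can be shrunk to 0. The centre is only asked to be a point of continuity, since [g]
    may be a difference quotient at 0. *)
Lemma circle_int_center (g : C -> C) (r : R) :
  0 < r -> (forall w, 0 < Cmod w <= r -> ex_derive g w) ->
  (forall e, 0 < e -> exists d, 0 < d /\ forall w, Cmod w < d -> Cmod (g w - g (RtoC 0))%C < e) ->
  circle_int g r = (RtoC (2 * PI) * g (RtoC 0))%C.
Proof.
intros Hr H Hc. apply Cmod_small_eq with (2 * PI); [apply two_PI_pos|].
intros e He. destruct (Hc e He) as [d [Hd K]].
set (rho := Rmin r (d / 2)).
assert (0 < rho) by (apply Rmin_pos; lra).
assert (rho <= r) by apply Rmin_l. assert (rho <= d / 2) by apply Rmin_r.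
rewrite <- (circle_int_annulus g rho r); [|lra|].
- apply circle_int_approx; [lra| |].
  + intros w Hw. apply H. lra.
  + intros w Hw. left. apply K. lra.
- intros w Hw. apply H. lra.
Qed.

(** Here the radius is enlarged instead: w / (w - z) tends to 1 at infinity. *)
Lemma circle_int_kernel (z : C) (r : R) : Cmod z < r ->
  circle_int (fun w => (w / (w - z))%C) r = RtoC (2 * PI).
Proof.
intros Hz. pose proof (Cmod_ge_0 z) as Hz0.
assert (D : forall w, Cmod z < Cmod w -> w <> z /\ ex_derive (fun w => (w / (w - z))%C) w).
{ intros w Hw. assert (Hwz : w <> z) by (intros ->; lra). split; auto.
  assert ((w - z)%C <> RtoC 0).
  { intros E. apply Hwz. replace w with (w - z + z)%C by ring. rewrite E. ring. }
  eexists. apply (is_derive_Cdiv (fun w => w) (fun w => (w - z)%C)); auto.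
  - apply is_derive_Cid.
  - apply is_derive_Cminus; [apply is_derive_Cid|apply is_derive_Cconst]. }
replace (RtoC (2 * PI)) with (RtoC (2 * PI) * RtoC 1)%C by ring.
apply Cmod_small_eq with (2 * PI); [apply two_PI_pos|].
intros e He. set (rho := Rmax r (Cmod z + (Cmod z + 1) / e)).
assert (r <= rho) by apply Rmax_l.
assert (He2 : 0 < (Cmod z + 1) / e) by (apply Rdiv_lt_0_compat; lra).
assert (Hrho : Cmod z + (Cmod z + 1) / e <= rho) by apply Rmax_r.
rewrite (circle_int_annulus _ r rho); [|lra|].
2: { intros w Hw. apply D. lra. }
apply circle_int_approx; [lra| |].
- intros w Hw. apply D. lra.
- intros w Hw. destruct (D w ltac:(lra)) as [Hwz _].
  assert (Hwz' : (w - z)%C <> RtoC 0).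
  { intros E. apply Hwz. replace w with (w - z + z)%C by ring. rewrite E. ring. }
  replace (w / (w - z) - RtoC 1)%C with (z / (w - z))%C by (field; auto).
  rewrite Cmod_div by auto.
  pose proof (Cmod_triangle_inv w z).
  assert (Hden : (Cmod z + 1) / e <= Cmod (w - z)%C) by lra.
  apply Rmult_le_reg_r with (Cmod (w - z)%C); [lra|].
  replace (Cmod z / Cmod (w - z) * Cmod (w - z))%R with (Cmod z) by (field; lra).
  apply Rle_trans with (e * ((Cmod z + 1) / e)).
  + replace (e * ((Cmod z + 1) / e)) with (Cmod z + 1) by (field; lra). lra.
  + apply Rmult_le_compat_l; lra.
Qed.

(** Compactness of the circle compares integrals over two nearby radii, also when a point where [H]
    is merely continuous lies between them. *)
Lemma circle_uniform (H : C -> C) (r : R) :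
  (forall t e, 0 < e -> exists d, 0 < d /\ forall w, Cmod (w - circle r t)%C < d ->
     Cmod (H w - H (circle r t))%C < e) ->
  forall e, 0 < e -> exists d, 0 < d /\ forall t r1 r2, 0 <= t <= 2 * PI ->
    Rabs (r1 - r) < d -> Rabs (r2 - r) < d ->
    Cmod (H (circle r1 t) - H (circle r2 t))%C <= e.
Proof.
intros Hc e He.
assert (L : forall t, {d : posreal | forall r' t', Rabs (r' - r) < d -> Rabs (t' - t) < d ->
   Cmod (H (circle r' t') - H (circle r t))%C < e / 2}).
{ intros t. apply constructive_indefinite_description.
  destruct (Hc t (e / 2)) as [d [Hd K]]; [lra|].
  destruct (proj1 (Ccont_eps _ _) (Ccont_circle r t) (d / 2)) as [d' [Hd' K']]; [lra|].
  assert (Hm : 0 < Rmin (d / 2) d') by (apply Rmin_pos; lra).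
  exists (mkposreal _ Hm). simpl. intros r' t' Hr' Ht'.
  pose proof (Rmin_l (d / 2) d'). pose proof (Rmin_r (d / 2) d').
  apply K.
  replace (circle r' t' - circle r t)%C
    with (RtoC (r' - r) * circle 1 t' + (circle r t' - circle r t))%C.
  - eapply Rle_lt_trans; [apply Cmod_triangle|].
    rewrite Cmod_mult, Cmod_R, Cmod_circle by lra. specialize (K' t' ltac:(lra)). lra.
  - unfold circle. apply injective_projections; simpl; ring. }
(* The covering property comes doubly negated, hence the argument by contradiction. *)
destruct (compactness_value_1d 0 (2 * PI) (fun t => proj1_sig (L t))) as [d Hd].
exists d. split; [apply cond_pos|].
intros t r1 r2 Ht Hr1 Hr2. apply Rnot_lt_le. intros Hlt.
apply (Hd t Ht). intros [u [Hu [Htu Hdu]]].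
pose proof (proj2_sig (L u)) as Lu. simpl in Lu.
set (du := proj1_sig (L u)) in *.
pose proof (Lu r1 t ltac:(lra) Htu) as A1. pose proof (Lu r2 t ltac:(lra) Htu) as A2.
revert Hlt. apply Rle_not_lt.
replace (H (circle r1 t) - H (circle r2 t))%C with
  ((H (circle r1 t) - H (circle r u)) + - (H (circle r2 t) - H (circle r u)))%C by ring.
eapply Rle_trans; [apply Cmod_triangle|]. rewrite Cmod_opp. lra.
Qed.

(** Let [H] be (F w - F z) w / (w - z), with the limit value z F'(z) at z. Given the kernel
    integral, it remains to see that [H] has integral 0. If z = 0, its value at the centre is 0.
    Otherwise H(0) = 0 settles the radii below |z|, the radii above |z| share one value, and uniform
    continuity joins the two sides across |w| = |z|. *)
Theorem cauchy_formula (F : C -> C) (R0 r : R) (z : C) :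
  (forall w, Cmod w < R0 -> ex_derive F w) -> r < R0 -> Cmod z < r ->
  circle_int (fun w => (F w * (w / (w - z)))%C) r = (RtoC (2 * PI) * F z)%C.
Proof.
intros HF HrR Hzr. pose proof (Cmod_ge_0 z) as Hz0. pose proof two_PI_pos as Hpi.
destruct (HF z ltac:(lra)) as [l Hl].
set (H := fun w => if Ceq_dec w z then (z * l)%C else ((F w - F z) * (w / (w - z)))%C).
assert (Hne : forall w, w <> z -> (w - z)%C <> RtoC 0).
{ intros w Hw E. apply Hw. replace w with (w - z + z)%C by ring. rewrite E. ring. }
assert (K1 : forall w, w <> z -> ex_derive (fun w => (w / (w - z))%C) w).
{ intros w Hw. eexists. apply (is_derive_Cdiv (fun w => w) (fun w => (w - z)%C)); auto.
  - apply is_derive_Cid.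
  - apply is_derive_Cminus; [apply is_derive_Cid|apply is_derive_Cconst]. }
assert (HD : forall w, Cmod w < R0 -> w <> z -> ex_derive H w).
{ intros w Hw Hwz. destruct (K1 w Hwz) as [k Hk]. destruct (HF w Hw) as [m Hm].
  eexists. apply is_derive_C_ext_loc with (fun w => ((F w - F z) * (w / (w - z)))%C) (Cmod (w - z)%C).
  - now apply Cmod_gt_0, Hne.
  - intros v Hv. unfold H. destruct (Ceq_dec v z) as [->|]; auto.
    rewrite Cmod_sub_sym in Hv. lra.
  - apply (is_derive_Cmult (fun w => (F w - F z)%C)); [|exact Hk].
    apply is_derive_Cminus; [exact Hm|apply is_derive_Cconst]. }
assert (HC : forall e, 0 < e -> exists d, 0 < d /\ forall w, Cmod (w - z)%C < d -> Cmod (H w - H z)%C < e).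
{ intros e He. pose proof (Cmod_ge_0 l) as Hl0.
  destruct (proj1 (is_derive_C_eps _ _ _) Hl (e / (2 * (1 + Cmod z)))) as [d [Hd K]].
  { apply Rdiv_lt_0_compat; lra. }
  exists (Rmin (Rmin d 1) (e / (2 * (1 + Cmod l)))). split.
  { repeat apply Rmin_pos; try lra. apply Rdiv_lt_0_compat; lra. }
  intros w Hw.
  assert (Hw1 := Rlt_le_trans _ _ _ Hw (Rmin_l _ _)).
  assert (Hw2 := Rlt_le_trans _ _ _ Hw (Rmin_r _ _)).
  pose proof (Rmin_l d 1). pose proof (Rmin_r d 1).
  unfold H. destruct (Ceq_dec z z) as [_|n]; [|now elim n].
  destruct (Ceq_dec w z) as [->|Hwz].
  { replace (z * l - z * l)%C with (RtoC 0) by ring. rewrite Cmod_0. exact He. }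
  pose proof (Hne w Hwz) as Hn. pose proof (proj1 (Cmod_gt_0 _) Hn) as Hn'.
  replace ((F w - F z) * (w / (w - z)) - z * l)%C
    with (((F w - F z - (w - z) * l) / (w - z)) * w + (w - z) * l)%C by (field; auto).
  eapply Rle_lt_trans; [apply Cmod_triangle|]. rewrite !Cmod_mult, Cmod_div by auto.
  assert (Hww : Cmod w < 1 + Cmod z).
  { replace w with (w - z + z)%C by ring. eapply Rle_lt_trans; [apply Cmod_triangle|]. lra. }
  set (q := Cmod (F w - F z - (w - z) * l)%C / Cmod (w - z)%C).
  assert (Hq : 0 <= q <= e / (2 * (1 + Cmod z))).
  { unfold q. split.
    - apply Rdiv_le_0_compat; [apply Cmod_ge_0|lra].
    - apply Rmult_le_reg_r with (Cmod (w - z)%C); auto.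
      replace (Cmod (F w - F z - (w - z) * l) / Cmod (w - z) * Cmod (w - z))%R
       with (Cmod (F w - F z - (w - z) * l)) by (field; lra). apply K; lra. }
  pose proof (Cmod_ge_0 w).
  assert (q * Cmod w <= e / 2).
  { apply Rle_trans with (e / (2 * (1 + Cmod z)) * (1 + Cmod z)).
    - apply Rmult_le_compat; lra.
    - apply Req_le; field; lra. }
  assert (Cmod (w - z)%C * Cmod l < e / 2).
  { apply (Rmult_lt_compat_r (1 + Cmod l)) in Hw2; [|lra].
    replace (e / (2 * (1 + Cmod l)) * (1 + Cmod l)) with (e / 2) in Hw2 by (field; lra). nra. }
  lra. }
assert (J : circle_int H r = RtoC 0).
{ destruct (Req_dec (Cmod z) 0) as [Ez|Ez].
  { apply Cmod_eq_0 in Ez. rewrite (circle_int_center H r).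
    - unfold H. destruct (Ceq_dec (RtoC 0) z) as [_|n]; [|now elim n]. rewrite Ez. ring.
    - lra.
    - intros w Hw. apply HD; [lra|]. intros ->. rewrite Ez, Cmod_0 in Hw. lra.
    - intros e He. destruct (HC e He) as [d [Hd K]]. exists d; split; auto.
      intros w Hw. rewrite <- Ez. apply K. rewrite Ez.
      replace (w - RtoC 0)%C with w by ring. exact Hw. }
  apply Cmod_small_eq with (2 * PI); auto.
  intros e He.
  destruct (circle_uniform H (Cmod z)) with (e := e) as [d [Hd K]]; auto.
  { intros t e' He'. destruct (Ceq_dec (circle (Cmod z) t) z) as [E|E].
    - rewrite E. apply HC; auto.
    - apply ex_derive_C_continuous; auto. apply HD; auto. rewrite Cmod_circle; lra. }
  (* The radii |z| - h and |z| + h stay positive, below r, and within d of |z|. *)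
  set (h := Rmin (d / 2) (Rmin (Cmod z / 2) ((r - Cmod z) / 2))).
  assert (Hh : 0 < h) by (repeat apply Rmin_pos; lra).
  assert (Hh1 : h <= d / 2) by apply Rmin_l.
  assert (Hh2 : h <= Cmod z / 2) by (eapply Rle_trans; [apply Rmin_r|apply Rmin_l]).
  assert (Hh3 : h <= (r - Cmod z) / 2) by (eapply Rle_trans; [apply Rmin_r|apply Rmin_r]).
  assert (J1 : circle_int H (Cmod z - h) = RtoC 0).
  { rewrite (circle_int_center H (Cmod z - h)).
    - unfold H. destruct (Ceq_dec (RtoC 0) z) as [n|_].
      + elim Ez. rewrite <- n. apply Cmod_0.
      + unfold Cdiv. ring.
    - lra.
    - intros w Hw. apply HD; [lra|]. intros ->. lra.
    - intros e' He'. destruct (ex_derive_C_continuous H (RtoC 0)) with (eps := e') as [d' [Hd' K']]; auto.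
      + apply HD. rewrite Cmod_0; lra. intros n. apply Ez. rewrite <- n. apply Cmod_0.
      + exists d'. split; auto. intros w Hw. apply K'.
        replace (w - RtoC 0)%C with w by ring. exact Hw. }
  rewrite <- J1, <- (circle_int_annulus H (Cmod z + h) r).
  2: { lra. }
  2: { intros w Hw. apply HD; [lra|]. intros ->. lra. }
  assert (X1 : ex_Cint (fun t => H (circle (Cmod z + h) t)) 0 (2 * PI)).
  { apply (ex_circle_int H); [lra|]. intros w Hw. apply HD; [lra|]. intros ->. lra. }
  assert (X2 : ex_Cint (fun t => H (circle (Cmod z - h) t)) 0 (2 * PI)).
  { apply (ex_circle_int H); [lra|]. intros w Hw. apply HD; [lra|]. intros ->. lra. }
  destruct (Cint_minus _ _ _ _ X1 X2) as [X3 X4].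
  unfold circle_int. rewrite <- X4. rewrite <- (Rminus_0_r (2 * PI)) at 2.
  apply Cint_norm_le; auto; [lra|].
  intros t Ht. apply K; auto.
  - replace (Cmod z + h - Cmod z) with h by ring. rewrite Rabs_pos_eq; lra.
  - replace (Cmod z - h - Cmod z) with (- h) by ring. rewrite Rabs_Ropp, Rabs_pos_eq; lra. }
assert (Y1 : ex_Cint (fun t => (fun w => w / (w - z))%C (circle r t)) 0 (2 * PI)).
{ apply (ex_circle_int (fun w => w / (w - z))%C); [lra|]. intros w Hw. apply K1. intros ->. lra. }
assert (Y2 : ex_Cint (fun t => H (circle r t)) 0 (2 * PI)).
{ apply (ex_circle_int H); [lra|]. intros w Hw. apply HD; [lra|]. intros ->. lra. }
destruct (Cint_scal (F z) _ _ _ Y1) as [Y3 Y4].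
destruct (Cint_plus _ _ _ _ Y2 Y3) as [_ Y5].
assert (Y6 : Cint (fun t => H (circle r t) + F z * (circle r t / (circle r t - z)))%C 0 (2 * PI)
  = (circle_int H r + F z * circle_int (fun w => w / (w - z))%C r)%C).
{ exact (eq_trans Y5 (f_equal (Cplus _) Y4)). }
rewrite J, circle_int_kernel in Y6 by auto.
rewrite Cplus_0_l, Cmult_comm in Y6. rewrite <- Y6.
apply Cint_ext; [lra|]. intros t _. unfold H.
destruct (Ceq_dec (circle r t) z) as [E|E].
- assert (Cmod z = r) by (rewrite <- E; apply Cmod_circle; lra). lra.
- pose proof (Hne _ E). field. auto.
Qed.

(** * Derivatives of holomorphic functions *)

Lemma Ccont_bounded (f : R -> C) (a b : R) : a <= b ->
  (forall t, a <= t <= b -> Ccont f t) ->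
  exists M, forall t, a <= t <= b -> Cmod (f t) <= M.
Proof.
intros Hab H. destruct (continuity_ab_maj (fun t => Cmod (f t)) a b Hab) as [m [Hm _]].
- intros t Ht. apply continuity_pt_filterlim.
  change (continuous (fun t => Cmod (f t)) t). apply continuous_R_eps. intros eps He.
  destruct (proj1 (Ccont_eps _ _) (H t Ht) eps He) as [d [Hd K]].
  exists d. split; auto. intros s Hs. specialize (K s Hs).
  pose proof (Cmod_triangle_inv (f s) (f t)).
  pose proof (Cmod_triangle_inv (f t) (f s)). rewrite (Cmod_sub_sym (f t)) in H1.
  apply Rabs_def1; lra.
- exists (Cmod (f m)). exact Hm.
Qed.

Lemma Cint_is_derive (k : C -> R -> C) (k' : R -> C) (z : C) (a b B d : R) :
  a <= b -> 0 < d ->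
  (forall w, Cmod (w - z)%C < d -> ex_Cint (k w) a b) -> ex_Cint k' a b ->
  (forall w t, Cmod (w - z)%C < d -> a <= t <= b ->
     Cmod (k w t - k z t - (w - z) * k' t)%C <= B * Cmod (w - z)%C ^ 2) ->
  is_derive (fun w => Cint (k w) a b) z (Cint k' a b).
Proof.
intros Hab Hd Hk Hk' HB.
apply is_derive_C_quadratic with ((b - a) * B) d; auto.
intros w Hw.
assert (Hz : ex_Cint (k z) a b).
{ apply Hk. replace (z - z)%C with (RtoC 0) by ring. now rewrite Cmod_0. }
destruct (Cint_scal (w - z) _ _ _ Hk') as [E1 E2].
destruct (Cint_minus _ _ _ _ (Hk w Hw) Hz) as [E3 E4].
destruct (Cint_minus _ _ _ _ E3 E1) as [E5 E6].
rewrite <- E2, <- E4, <- E6, Rmult_assoc.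
apply Cint_norm_le; auto.
Qed.

Lemma Cpow_neq_0 (z : C) (n : nat) : z <> RtoC 0 -> (z ^ n)%C <> RtoC 0.
Proof.
intros Hz. apply Cmod_gt_0. rewrite Cmod_pow. now apply pow_lt, Cmod_gt_0.
Qed.

(** Cauchy's integral is differentiated twice under the integral sign: the kernels are 1/(w - z) to
    the powers 1, 2 and 3, multiplied by F(w) w. *)
Lemma ex_derive_derive_0 (F : C -> C) (R0 : R) :
  0 < R0 -> (forall w, Cmod w < R0 -> ex_derive F w) ->
  exists (F1 : C -> C) (r : R), 0 < r /\ ex_derive F1 (RtoC 0) /\
    forall w, Cmod w < r -> is_derive F w (F1 w).
Proof.
intros HR HF. pose proof two_PI_pos as Hpi.
set (r := R0 / 2).
assert (Hr : 0 < r) by (unfold r; lra).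
set (p := fun t => (F (circle r t) * circle r t)%C).
assert (Hp : forall t, Ccont p t).
{ intros t. apply (Ccont_comp (fun w => (F w * w)%C)); [|apply Ccont_circle].
  destruct (HF (circle r t)) as [l Hl]. { rewrite Cmod_circle; unfold r; lra. }
  eexists. apply (is_derive_Cmult F (fun w => w)); [exact Hl|apply is_derive_Cid]. }
destruct (Ccont_bounded p 0 (2 * PI)) as [M HM]; [lra|auto|].
assert (HM0 : 0 <= M) by (eapply Rle_trans; [apply Cmod_ge_0|apply (HM 0); lra]).
(* Base points with |z| < r/2 and increments below r/4 stay in |z| < 3r/4, at distance at least r/4
   from the circle. *)
assert (Hfar : forall z t, Cmod z < 3 * r / 4 -> r / 4 <= Cmod (circle r t - z)%C /\ (circle r t - z)%C <> RtoC 0).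
{ intros z t Hz. pose proof (Cmod_triangle_inv (circle r t) z) as K.
  rewrite Cmod_circle in K by lra. split; [lra|]. apply Cmod_gt_0; lra. }
assert (Hker : forall n z, Cmod z < 3 * r / 4 -> ex_Cint (fun t => (p t * / (circle r t - z) ^ n)%C) 0 (2 * PI)).
{ intros n z Hz. apply ex_Cint_cont; [lra|]. intros t _.
  apply (Ccont_comp (fun w => (F w * w * / (w - z) ^ n)%C) (circle r)); [|apply Ccont_circle].
  destruct (HF (circle r t)) as [l Hl]. { rewrite Cmod_circle; unfold r; lra. }
  assert (Hpow : exists l, is_derive (fun w => ((w - z) ^ n)%C) (circle r t) l).
  { induction n as [|n [l' IH]].
    - exists (RtoC 0). exact (is_derive_Cconst (RtoC 1) (circle r t)).
    - eexists. apply (is_derive_Cmult (fun w => (w - z)%C) (fun w => ((w - z) ^ n)%C)); [|exact IH].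
      apply is_derive_Cminus; [apply is_derive_Cid|apply is_derive_Cconst]. }
  destruct Hpow as [l' Hl'].
  eexists. apply (is_derive_Cmult (fun w => (F w * w)%C) (fun w => (/ (w - z) ^ n)%C)).
  - apply (is_derive_Cmult F (fun w => w)); [exact Hl|apply is_derive_Cid].
  - apply (is_derive_Cinv (fun w => ((w - z) ^ n)%C)); [exact Hl'|].
    apply Cpow_neq_0, Hfar, Hz. }
assert (D1 : forall z, Cmod z < r / 2 ->
  is_derive (fun w => Cint (fun t => (p t * / (circle r t - w) ^ 1)%C) 0 (2 * PI)) z
    (Cint (fun t => (p t * / (circle r t - z) ^ 2)%C) 0 (2 * PI))).
{ intros z Hz.
  apply (Cint_is_derive (fun w t => (p t * / (circle r t - w) ^ 1)%C) _ z 0 (2 * PI)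
     (M * / ((r / 4) ^ 3)) (r / 4)); [lra|lra| |apply Hker; lra|].
  - intros w Hw. apply Hker.
    replace w with (w - z + z)%C by ring. eapply Rle_lt_trans; [apply Cmod_triangle|]. lra.
  - intros w t Hw Ht.
    assert (Hw' : Cmod w < 3 * r / 4).
    { replace w with (w - z + z)%C by ring. eapply Rle_lt_trans; [apply Cmod_triangle|]. lra. }
    destruct (Hfar w t Hw') as [A1 A2]. destruct (Hfar z t ltac:(lra)) as [B1 B2].
    replace (p t * / (circle r t - w) ^ 1 - p t * / (circle r t - z) ^ 1 - (w - z) * (p t * / (circle r t - z) ^ 2))%C
     with (p t * / ((circle r t - w) * (circle r t - z) ^ 2) * (w - z) ^ 2)%C by (simpl; field; auto).
    rewrite !Cmod_mult, Cmod_pow. apply Rmult_le_compat_r; [apply pow2_ge_0|].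
    apply Rmult_le_compat; auto using Cmod_ge_0.
    rewrite Cmod_inv, Cmod_mult, Cmod_pow.
    2: { apply Cmult_neq_0; auto. now apply Cpow_neq_0. }
    apply Rinv_le_contravar; [apply pow_lt; lra|].
    replace ((r / 4) ^ 3) with (r / 4 * (r / 4) ^ 2) by ring.
    apply Rmult_le_compat; [lra|apply pow2_ge_0|lra|apply pow_incr; lra]. }
assert (D2 : is_derive (fun w => Cint (fun t => (p t * / (circle r t - w) ^ 2)%C) 0 (2 * PI)) (RtoC 0)
    (Cint (fun t => (RtoC 2 * (p t * / (circle r t - RtoC 0) ^ 3))%C) 0 (2 * PI))).
{ pose proof Cmod_0 as C0. set (z := RtoC 0) in *.
  (* With u the distance vector from z to the circle and v = w - z, the remainder is v^2 (3u - 2v) /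
     ((u - v)^2 u^3). Its factor 3u - 2v is at most 3r + r/2, bounded here by 5r. *)
  apply (Cint_is_derive (fun w t => (p t * / (circle r t - w) ^ 2)%C) _ z 0 (2 * PI)
     (M * (5 * r * / ((r / 4) ^ 5))) (r / 4)); [lra|lra| | |].
  - intros w Hw. apply Hker.
    replace w with (w - z + z)%C by ring. eapply Rle_lt_trans; [apply Cmod_triangle|]. lra.
  - apply (Cint_scal (RtoC 2)), Hker; lra.
  - intros w t Hw Ht.
    assert (Hw' : Cmod w < 3 * r / 4).
    { replace w with (w - z + z)%C by ring. eapply Rle_lt_trans; [apply Cmod_triangle|]. lra. }
    destruct (Hfar w t Hw') as [A1 A2]. destruct (Hfar z t ltac:(lra)) as [B1 B2].
    replace (p t * / (circle r t - w) ^ 2 - p t * / (circle r t - z) ^ 2 - (w - z) * (RtoC 2 * (p t * / (circle r t - z) ^ 3)))%C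
     with (p t * ((RtoC 3 * (circle r t - z) - RtoC 2 * (w - z)) * / ((circle r t - w) ^ 2 * (circle r t - z) ^ 3)) * (w - z) ^ 2)%C by (simpl; field; auto).
    rewrite !Cmod_mult, Cmod_pow. apply Rmult_le_compat_r; [apply pow2_ge_0|].
    apply Rmult_le_compat; auto using Cmod_ge_0.
    { apply Rmult_le_pos; apply Cmod_ge_0. }
    apply Rmult_le_compat; auto using Cmod_ge_0.
    { unfold Cminus at 1. eapply Rle_trans; [apply Cmod_triangle|].
      rewrite Cmod_opp, !Cmod_mult, !Cmod_R, !Rabs_pos_eq by lra.
      assert (Cmod (circle r t - z)%C <= r).
      { unfold Cminus. eapply Rle_trans; [apply Cmod_triangle|].
        rewrite Cmod_opp, Cmod_circle by lra. lra. }
      lra. }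
    rewrite Cmod_inv, Cmod_mult, !Cmod_pow.
    2: { apply Cmult_neq_0; auto; now apply Cpow_neq_0. }
    apply Rinv_le_contravar; [apply pow_lt; lra|].
    replace ((r / 4) ^ 5) with ((r / 4) ^ 2 * (r / 4) ^ 3) by ring.
    apply Rmult_le_compat; [apply pow2_ge_0|apply pow_le; lra|apply pow_incr; lra|apply pow_incr; lra]. }
assert (Hpi' : RtoC (2 * PI) <> RtoC 0).
{ intros E. apply (f_equal fst) in E. simpl in E. lra. }
exists (fun w => (/ RtoC (2 * PI) * Cint (fun t => p t * / (circle r t - w) ^ 2) 0 (2 * PI))%C), (r / 2).
split; [lra|]. split.
- eexists. apply (is_derive_Cmult (fun _ => / RtoC (2 * PI))%C); [apply is_derive_Cconst|exact D2].
- intros w Hw.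
  apply is_derive_C_ext_loc with (fun w => (/ RtoC (2 * PI) * Cint (fun t => p t * / (circle r t - w) ^ 1) 0 (2 * PI))%C) (r / 2 - Cmod w).
  + lra.
  + intros v Hv.
    assert (Hv' : Cmod v < r / 2).
    { replace v with (v - w + w)%C by ring. eapply Rle_lt_trans; [apply Cmod_triangle|]. lra. }
    pose proof (cauchy_formula F R0 r v HF ltac:(unfold r; lra) ltac:(lra)) as CF.
    replace (F v) with (/ RtoC (2 * PI) * (RtoC (2 * PI) * F v))%C by (field; auto).
    rewrite <- CF. f_equal. apply Cint_ext; [lra|]. intros t _.
    unfold p. simpl. rewrite Cmult_1_r. unfold Cdiv. ring.
  + eapply is_derive_C_eq.
    * apply (is_derive_Cmult (fun _ => / RtoC (2 * PI))%C); [apply is_derive_Cconst|apply D1, Hw].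
    * ring.
Qed.

Theorem ex_derive_C_derive (F : C -> C) (z : C) (r : R) :
  0 < r -> (forall w, Cmod (w - z)%C < r -> ex_derive F w) -> ex_derive (C_derive F) z.
Proof.
intros Hr HF.
destruct (ex_derive_derive_0 (fun w => F (w + z)%C) r Hr) as [F1 [d [Hd [[l Hl] H1]]]].
{ intros w Hw. destruct (HF (w + z)%C) as [l Hl].
  { replace (w + z - z)%C with w by ring. exact Hw. }
  eexists. apply (is_derive_Ccomp F (fun w => (w + z)%C)); [exact Hl|].
  apply is_derive_Cplus; [apply is_derive_Cid|apply is_derive_Cconst]. }
assert (T : forall w, is_derive (fun v => (v - z)%C) w (RtoC 1 - RtoC 0)%C).
{ intros w. apply is_derive_Cminus; [apply is_derive_Cid|apply is_derive_Cconst]. }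
exists ((RtoC 1 - RtoC 0) * l)%C.
apply is_derive_C_ext_loc with (fun w => F1 (w - z)%C) d; auto.
- intros w Hw. symmetry. apply is_C_derive_unique.
  apply is_derive_C_ext_loc with (fun v => F (v - z + z)%C) 1; [lra| |].
  { intros v _. f_equal. ring. }
  apply is_derive_C_eq with ((RtoC 1 - RtoC 0) * F1 (w - z))%C; [|ring].
  apply (is_derive_Ccomp (fun v => F (v + z)%C) (fun v => (v - z)%C)); auto.
- apply (is_derive_Ccomp F1 (fun v => (v - z)%C)); auto.
  replace (z - z)%C with (RtoC 0) by ring. exact Hl.
Qed.

(** * The Laplacian at a maximum *)

(** Squares are subdivided so that every point of [K] is dominated, in the sense of [Phi], by a
    point of [K] in the current square. Upper semicontinuity at the common point then makes it a
    maximum. *)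
Lemma usc_max_on_compact (K : C -> Prop) (Phi : C -> R) (B : R) :
  (exists z, K z) -> (forall z, K z -> Cmod z <= B) ->
  (forall q, (forall eps, 0 < eps -> exists z, K z /\ Cmod (z - q)%C < eps) -> K q) ->
  (forall q, K q -> forall eps, 0 < eps -> exists d, 0 < d /\
     forall z, K z -> Cmod (z - q)%C < d -> Phi z < Phi q + eps) ->
  exists q, K q /\ forall z, K z -> Phi z <= Phi q.
Proof.
intros [z0 Hz0] HB Hcl Husc.
assert (HB0 : 0 <= B) by (eapply Rle_trans; [apply Cmod_ge_0|apply (HB z0 Hz0)]).
set (a := 2 * B).
set (In := fun (z : C) n x y => x <= Re z <= x + a / 2 ^ n /\ y <= Im z <= y + a / 2 ^ n).
set (P := fun n x y => forall z, K z -> exists z', K z' /\ Phi z <= Phi z' /\ In z' n x y).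
destruct (quadrisection P a a (- B) (- B)) as [X [Y HXY]].
- unfold a; lra.
- unfold a; lra.
- intros z Hz. exists z. split; [exact Hz|split; [lra|]].
  unfold In. replace (- B + a / 2 ^ 0) with B by (unfold a; simpl; field).
  specialize (HB z Hz). pose proof (Rabs_Re_le z) as h1. pose proof (Rabs_Im_le z) as h2.
  apply Rabs_le_between in h1. apply Rabs_le_between in h2.
  destruct h1, h2. repeat split; lra.
- intros n x y HP. apply NNPP. intros HN.
  set (h := a / 2 ^ S n).
  assert (Eh : a / 2 ^ n = 2 * h).
  { unfold h. rewrite <- tech_pow_Rmult. field. apply pow_nonzero; lra. }
  assert (W : forall i j, 0 <= i <= 1 -> 0 <= j <= 1 -> exists z, K z /\
    forall z', K z' -> In z' (S n) (x + i * h) (y + j * h) -> Phi z' < Phi z).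
  { intros i j Hi Hj. apply NNPP. intros HM. apply HN. exists i, j.
    split; [exact Hi|split; [exact Hj|]]. intros z Hz. apply NNPP. intros HE.
    apply HM. exists z. split; auto. intros z' Hz' HI. apply Rnot_le_lt. intros hh.
    apply HE. exists z'. auto. }
  destruct (W 0 0) as [z1 [K1 M1]]; try lra.
  destruct (W 1 0) as [z2 [K2 M2]]; try lra.
  destruct (W 0 1) as [z3 [K3 M3]]; try lra.
  destruct (W 1 1) as [z4 [K4 M4]]; try lra.
  (* If each quarter failed for some point of [K], the best of the four points would be dominated in
     the square, hence in one of its quarters. *)
  assert (Best : exists z, K z /\ Phi z1 <= Phi z /\ Phi z2 <= Phi z /\ Phi z3 <= Phi z /\ Phi z4 <= Phi z).
  { assert (T : forall u v, K u -> K v -> exists w, K w /\ Phi u <= Phi w /\ Phi v <= Phi w).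
    { intros u v Hu Hv. destruct (Rle_dec (Phi u) (Phi v)).
      - exists v. repeat split; auto; lra.
      - exists u. repeat split; auto; lra. }
    destruct (T z1 z2 K1 K2) as [u [Hu [? ?]]]. destruct (T z3 z4 K3 K4) as [v [Hv [? ?]]].
    destruct (T u v Hu Hv) as [w [Hw [? ?]]]. exists w. repeat split; auto; lra. }
  destruct Best as [z [Hz [L1 [L2 [L3 L4]]]]].
  destruct (HP z Hz) as [z' [Hz' [Hle [I1 I2]]]]. rewrite Eh in I1, I2.
  unfold In in M1, M2, M3, M4. fold h in M1, M2, M3, M4.
  destruct (Rle_dec (Re z') (x + h)); destruct (Rle_dec (Im z') (y + h)).
  + specialize (M1 z' Hz' ltac:(lra)). lra.
  + specialize (M3 z' Hz' ltac:(lra)). lra.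
  + specialize (M2 z' Hz' ltac:(lra)). lra.
  + specialize (M4 z' Hz' ltac:(lra)). lra.
- set (q := (X, Y) : C).
  assert (Near : forall z, K z -> forall d, 0 < d -> exists z', K z' /\ Phi z <= Phi z' /\ Cmod (z' - q)%C < d).
  { intros z Hz d Hd.
    destruct (pow_lt_1_zero (/ 2) ltac:(rewrite Rabs_pos_eq; lra) (d / (2 * a + 1))) as [N HN].
    { apply Rdiv_lt_0_compat; unfold a; lra. }
    specialize (HN N (Nat.le_refl N)).
    rewrite Rabs_pos_eq in HN by (apply pow_le; lra). rewrite pow_inv in HN.
    destruct (HXY N) as [x [y [HP [HX HY]]]].
    destruct (HP z Hz) as [z' [Hz' [Hle [I1 I2]]]]. exists z'. split; [exact Hz'|split; [exact Hle|]].
    eapply Rle_lt_trans; [apply Cmod_le_Re_Im|].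
    assert (Hh : 0 < / 2 ^ N) by (apply Rinv_0_lt_compat, two_pow_pos).
    assert (Hs : 2 * (a / 2 ^ N) < d).
    { apply (Rmult_lt_compat_r (2 * a + 1)) in HN; [|unfold a; lra].
      replace (d / (2 * a + 1) * (2 * a + 1)) with d in HN by (field; unfold a; lra).
      unfold Rdiv. nra. }
    unfold Re, Im in *. simpl.
    apply Rle_lt_trans with (2 * (a / 2 ^ N)); [|exact Hs].
    replace (2 * (a / 2 ^ N)) with (a / 2 ^ N + a / 2 ^ N) by ring.
    apply Rplus_le_compat; apply Rabs_le; lra. }
  assert (Kq : K q).
  { apply Hcl. intros eps He. destruct (Near z0 Hz0 eps He) as [z' [? [_ ?]]]. now exists z'. }
  exists q. split; auto. intros z Hz. apply Rnot_lt_le. intros Hlt.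
  destruct (Husc q Kq (Phi z - Phi q)) as [d [Hd Kd]]; [lra|].
  destruct (Near z Hz d Hd) as [z' [Hz' [Hle Hd']]].
  specialize (Kd z' Hz' Hd'). lra.
Qed.

(** A relational second derivative: the witness [v] is u' near x. Both values travel through the sum
    and chain rules without iterating [Derive]. *)
Definition deriv2_at (u : R -> R) (x v0 k : R) : Prop :=
  exists (v : R -> R) (eta : R), 0 < eta /\
    (forall t, Rabs (t - x) < eta -> is_derive u t (v t)) /\ v x = v0 /\ is_derive v x k.

Lemma deriv2_at_plus (u w : R -> R) (x u1 u2 w1 w2 : R) :
  deriv2_at u x u1 u2 -> deriv2_at w x w1 w2 ->
  deriv2_at (fun t => u t + w t) x (u1 + w1) (u2 + w2).
Proof.
intros [v [e [He [D [E K]]]]] [v' [e' [He' [D' [E' K']]]]].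
exists (fun t => v t + v' t), (Rmin e e'). split; [now apply Rmin_pos|]. split; [|split].
- intros t Ht. pose proof (Rmin_l e e'). pose proof (Rmin_r e e').
  apply (is_derive_plus (V := R_NormedModule)); [apply D|apply D']; lra.
- now rewrite E, E'.
- now apply (is_derive_plus (V := R_NormedModule)).
Qed.

Lemma deriv2_at_comp (P L : R -> R) (x p1 p2 l1 l2 : R) :
  deriv2_at P (L x) p1 p2 -> deriv2_at L x l1 l2 ->
  deriv2_at (fun t => P (L t)) x (p1 * l1) (p2 * l1 ^ 2 + p1 * l2).
Proof.
intros [P1 [e [He [D [E K]]]]] [L1 [e' [He' [D' [E' K']]]]].
assert (C : continuous L x).
{ apply (ex_derive_continuous (V := R_NormedModule)). exists (L1 x). apply D'.
  rewrite Rminus_diag_eq, Rabs_R0; auto. }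
destruct (proj1 (continuous_R_eps _ _) C e He) as [d [Hd Kd]].
exists (fun t => P1 (L t) * L1 t), (Rmin e' d). split; [now apply Rmin_pos|]. split; [|split].
- intros t Ht. pose proof (Rmin_l e' d). pose proof (Rmin_r e' d).
  rewrite Rmult_comm.
  apply (is_derive_comp P L); [apply D, Kd; lra|apply D'; lra].
- now rewrite E, E'.
- rewrite <- E, <- E'.
  assert (DL : is_derive L x (L1 x)). { apply D'. rewrite Rminus_diag_eq, Rabs_R0; auto. }
  replace (p2 * L1 x ^ 2 + P1 (L x) * l2) with ((L1 x * p2) * L1 x + P1 (L x) * l2) by ring.
  apply (is_derive_mult (K := R_AbsRing) (fun t => P1 (L t)) L1); auto using Rmult_comm.
  apply (is_derive_comp P1 L); auto.
Qed.

(** At an interior maximum u' vanishes; if k were positive, u' would be positive just to the right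
    of x and u would increase there. *)
Lemma deriv2_at_local_max (u : R -> R) (x v0 k r : R) :
  deriv2_at u x v0 k -> 0 < r -> (forall t, Rabs (t - x) < r -> u t <= u x) -> k <= 0.
Proof.
intros [v [e [He [D [E K]]]]] Hr Hmax. apply Rnot_lt_le. intros Hk.
destruct (proj1 (is_derive_R_eps _ _ _) K (k / 2)) as [d [Hd Kd]]; [lra|].
assert (Dx : is_derive u x (v x)). { apply D. rewrite Rminus_diag_eq, Rabs_R0; auto. }
assert (V0 : v x = 0).
{ apply is_derive_Reals in Dx.
  pose (pr := exist _ (v x) Dx : derivable_pt u x).
  change (v x) with (derive_pt u x pr).
  apply (deriv_maximum u (x - r) (x + r) x pr); try lra.
  intros t H1 H2. apply Hmax, Rabs_def1; lra. }
set (h := Rmin (Rmin e d) r / 2).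
assert (Hh : 0 < h). { unfold h. apply Rdiv_lt_0_compat; [|lra]. repeat apply Rmin_pos; lra. }
assert (h < e /\ h < d /\ h < r).
{ unfold h in *. pose proof (Rmin_l (Rmin e d) r). pose proof (Rmin_r (Rmin e d) r).
  pose proof (Rmin_l e d). pose proof (Rmin_r e d). lra. }
destruct (MVT_cor2 u v x (x + h)) as [y [Ey Hy]]; [lra| |].
{ intros t Ht. apply is_derive_Reals, D, Rabs_def1; lra. }
assert (u (x + h) <= u x) by (apply Hmax, Rabs_def1; lra).
pose proof (Kd y ltac:(apply Rabs_def1; lra)) as Ky.
rewrite V0, (Rabs_pos_eq (y - x)) in Ky by lra. apply Rabs_le_between in Ky.
assert (0 < v y) by nra. nra.
Qed.

Lemma is_derive_ln_Cmod (a b : R -> R) (t a' b' : R) :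
  is_derive a t a' -> is_derive b t b' -> (a t, b t) <> RtoC 0 ->
  is_derive (fun s => ln (Cmod (a s, b s))) t ((a t * a' + b t * b') / (a t * a t + b t * b t)).
Proof.
intros Ha Hb H0.
assert (Hp : 0 < a t * a t + b t * b t).
{ assert (H := proj1 (Cmod_gt_0 _) H0). pose proof (Cmod_sqr (a t, b t)) as S.
  unfold Re, Im in S; simpl in S. nra. }
apply (is_derive_ext (fun s => ln (sqrt (a s ^ 2 + b s ^ 2)))).
{ intros s. reflexivity. }
assert (Hsq : is_derive (fun s => a s ^ 2 + b s ^ 2) t (2 * (a t * a' + b t * b'))).
{ replace (2 * (a t * a' + b t * b')) with ((a' * a t + a t * a') + (b' * b t + b t * b')) by ring.
  apply (is_derive_ext (fun s => a s * a s + b s * b s)). { intros s; simpl; ring. }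
  apply (is_derive_plus (V := R_NormedModule)); apply (is_derive_mult (K := R_AbsRing)); auto using Rmult_comm. }
replace ((a t * a' + b t * b') / (a t * a t + b t * b t))
  with (2 * (a t * a' + b t * b') * (/ 2 * / (a t ^ 2 + b t ^ 2))) by (field; simpl; lra).
apply (is_derive_comp (fun y => ln (sqrt y)) (fun s => a s ^ 2 + b s ^ 2)); auto.
set (y := a t ^ 2 + b t ^ 2).
assert (Hy : 0 < y) by (unfold y; simpl; lra).
pose proof (sqrt_lt_R0 y Hy). pose proof (sqrt_sqrt y (Rlt_le _ _ Hy)).
auto_derive; [lra|]. rewrite <- H1 at 3. field. lra.
Qed.

Lemma Re_Cdiv (z w : C) : w <> RtoC 0 ->
  Re (z / w)%C = (Re w * Re z + Im w * Im z) / (Re w * Re w + Im w * Im w).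
Proof.
intros Hw. unfold Cdiv, Cinv, Cmult, Re, Im; simpl. field.
assert (H := proj1 (Cmod_gt_0 _) Hw). pose proof (Cmod_sqr w) as S.
unfold Re, Im in S; simpl in S. nra.
Qed.

Lemma is_derive_ln_Cmod_line (g : C -> C) (z e l : C) (t : R) :
  is_derive g (z + RtoC t * e)%C l -> g (z + RtoC t * e)%C <> RtoC 0 ->
  is_derive (fun s => ln (Cmod (g (z + RtoC s * e)%C))) t
    (Re (l / g (z + RtoC t * e) * e)%C).
Proof.
set (w := (z + RtoC t * e)%C). intros Dg Hgw.
destruct (is_derive_Re_line g z e _ t Dg) as [D1 D2].
replace (Re (l / g w * e)%C) with (Re ((l * e) / g w)%C) by (f_equal; field; auto).
rewrite Re_Cdiv by auto.
apply (is_derive_ext (fun s => ln (Cmod (Re (g (z + RtoC s * e)%C), Im (g (z + RtoC s * e)%C))))).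
{ intros s. unfold Re, Im. now rewrite <- surjective_pairing. }
apply (is_derive_ln_Cmod (fun s => Re (g (z + RtoC s * e)%C)) (fun s => Im (g (z + RtoC s * e)%C))); auto.
fold w. intros E. apply Hgw. rewrite <- E. apply surjective_pairing.
Qed.

(** No branch of the logarithm is needed: the derivative of ln |g| along a line is the real part of
    g'/g times the direction, and g'/g can be differentiated again. *)
Lemma deriv2_at_ln_Cmod_line (g : C -> C) (z e q' : C) (r : R) :
  0 < r -> (forall w, Cmod (w - z)%C < r -> ex_derive g w) -> g z <> RtoC 0 ->
  is_derive (fun w => (C_derive g w / g w)%C) z q' ->
  deriv2_at (fun t => ln (Cmod (g (z + RtoC t * e)%C))) 0
    (Re (C_derive g z / g z * e)%C) (Re (q' * e * e)%C).
Proof.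
intros Hr Hg H0 Hq.
assert (E0 : (z + RtoC 0 * e)%C = z) by ring.
destruct (ex_derive_C_continuous g z) with (eps := Cmod (g z)) as [d [Hd Kd]].
{ apply Hg. replace (z - z)%C with (RtoC 0) by ring. now rewrite Cmod_0. }
{ now apply Cmod_gt_0. }
pose proof (Cmod_ge_0 e) as He.
assert (Hdr : 0 < Rmin d r) by now apply Rmin_pos.
exists (fun t => Re ((fun w => C_derive g w / g w)%C (z + RtoC t * e) * e)%C), (Rmin d r / (1 + Cmod e)).
split; [|split; [|split]].
- apply Rdiv_lt_0_compat; lra.
- intros t Ht. rewrite Rminus_0_r in Ht.
  set (w := (z + RtoC t * e)%C).
  assert (Hw : Cmod (w - z)%C < Rmin d r).
  { replace (w - z)%C with (RtoC t * e)%C by (unfold w; ring). rewrite Cmod_mult, Cmod_R.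
    apply (Rmult_lt_compat_r (1 + Cmod e)) in Ht; [|lra].
    replace (Rmin d r / (1 + Cmod e) * (1 + Cmod e)) with (Rmin d r) in Ht by (field; lra).
    pose proof (Rabs_pos t). nra. }
  pose proof (Rmin_l d r). pose proof (Rmin_r d r).
  assert (Hgw : g w <> RtoC 0).
  { intros E. specialize (Kd w ltac:(lra)). rewrite E, Cmod_sub_sym in Kd.
    replace (g z - RtoC 0)%C with (g z) in Kd by ring. lra. }
  assert (Dg : is_derive g w (C_derive g w)) by (apply C_derive_correct; [exact w|apply Hg; lra]).
  now apply is_derive_ln_Cmod_line.
- now rewrite E0.
- rewrite <- E0 in Hq.
  assert (Dq : is_derive (fun w => (C_derive g w / g w * e)%C) (z + RtoC 0 * e)%C (q' * e)%C).
  { eapply is_derive_C_eq.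
    - apply (is_derive_Cmult (fun w => (C_derive g w / g w)%C) (fun _ => e)); [exact Hq|apply is_derive_Cconst].
    - ring. }
  apply (is_derive_Re_line _ _ _ _ _ Dq).
Qed.

Lemma deriv2_at_ln_disc (s a b : R) : a ^ 2 + b ^ 2 < s ^ 2 ->
  deriv2_at (fun t => ln (s ^ 2 - ((a + t) ^ 2 + b ^ 2))) 0
    (- 2 * a / (s ^ 2 - (a ^ 2 + b ^ 2)))
    (- 2 / (s ^ 2 - (a ^ 2 + b ^ 2)) - 4 * a ^ 2 / (s ^ 2 - (a ^ 2 + b ^ 2)) ^ 2).
Proof.
intros H.
assert (Cn : continuous (fun t => s ^ 2 - ((a + t) ^ 2 + b ^ 2)) 0).
{ apply (ex_derive_continuous (V := R_NormedModule)). auto_derive; auto. }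
set (h := s ^ 2 - (a ^ 2 + b ^ 2)) in *.
destruct (proj1 (continuous_R_eps _ _) Cn h) as [d [Hd Kd]]; [unfold h; lra|].
exists (fun t => - 2 * (a + t) / (s ^ 2 - ((a + t) ^ 2 + b ^ 2))), d.
split; auto. split; [|split].
- intros t Ht. specialize (Kd t Ht). rewrite Rplus_0_r in Kd. fold h in Kd.
  apply Rabs_def2 in Kd. auto_derive; [lra|]. field. lra.
- rewrite Rplus_0_r. reflexivity.
- auto_derive; rewrite ?Rplus_0_r.
  + replace (s * (s * 1) + - (a * (a * 1) + b * (b * 1))) with h by (unfold h; ring). unfold h; lra.
  + fold h. unfold h; field. lra.
Qed.

(** The second derivatives of [Z] in the directions 1 and i are at most 0, and so is their sum. As
    ln |f|, ln |f - 1| and ln |f'| are harmonic, the terms Re(q e^2) cancel (i^2 = -1). What remains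
    are the terms with P'' and Q'' and the Laplacian -4 s^2 / (s^2 - |c|^2)^2 of the last
    summand. *)
Lemma laplacian_at_max (f : C -> C) (c : C) (s r p1 p2 q1 q2 : R) (P Q : R -> R) :
  0 < r -> (forall w, Cmod (w - c)%C < r -> ex_derive f w) -> Cmod c < s ->
  f c <> RtoC 0 -> f c <> RtoC 1 -> C_derive f c <> RtoC 0 ->
  deriv2_at P (ln (Cmod (f c))) p1 p2 -> deriv2_at Q (ln (Cmod (f c - RtoC 1)%C)) q1 q2 ->
  let Z := fun w => P (ln (Cmod (f w))) + Q (ln (Cmod (f w - RtoC 1)%C))
     + ln (Cmod (C_derive f w)) + ln (s ^ 2 - Cmod w ^ 2) in
  (forall w, Cmod (w - c)%C < r -> Z w <= Z c) ->
  Cmod (C_derive f c) ^ 2 * (p2 / Cmod (f c) ^ 2 + q2 / Cmod (f c - RtoC 1)%C ^ 2)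
    <= 4 * s ^ 2 / (s ^ 2 - Cmod c ^ 2) ^ 2.
Proof.
intros Hr Hf Hcs H0 H1 Hd HP HQ Z HZ.
assert (ball_ex : forall g, (forall w, Cmod (w - c)%C < r -> ex_derive g w) ->
  forall w, Cmod (w - c)%C < r -> ex_derive (C_derive g) w).
{ intros g Hg w Hw. apply (ex_derive_C_derive g w (r - Cmod (w - c)%C)); [lra|].
  intros v Hv. apply Hg. replace (v - c)%C with ((v - w) + (w - c))%C by ring.
  eapply Rle_lt_trans; [apply Cmod_triangle|]. lra. }
assert (Hcc : Cmod (c - c)%C < r).
{ replace (c - c)%C with (RtoC 0) by ring. now rewrite Cmod_0. }
assert (logder : forall g, (forall w, Cmod (w - c)%C < r -> ex_derive g w) -> g c <> RtoC 0 ->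
  exists q', is_derive (fun w => (C_derive g w / g w)%C) c q').
{ intros g Hg Hgc. destruct (ball_ex g Hg c Hcc) as [l Hl]. destruct (Hg c Hcc) as [m Hm].
  eexists. apply (is_derive_Cdiv (C_derive g) g); eauto. }
set (f1 := fun w => (f w - RtoC 1)%C).
assert (Hf1d : forall w, Cmod (w - c)%C < r -> is_derive f1 w (C_derive f w)).
{ intros w Hw. apply is_derive_C_eq with (C_derive f w - RtoC 0)%C; [|ring].
  apply is_derive_Cminus; [|apply is_derive_Cconst].
  apply C_derive_correct; auto. }
assert (Hf1 : forall w, Cmod (w - c)%C < r -> ex_derive f1 w).
{ intros w Hw. eexists. apply (Hf1d w Hw). }
assert (H1' : f1 c <> RtoC 0).
{ unfold f1. intros E. apply H1. replace (f c) with (f c - RtoC 1 + RtoC 1)%C by ring. rewrite E. ring. }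
assert (E1 : C_derive f1 c = C_derive f c) by (apply is_C_derive_unique, Hf1d, Hcc).
destruct (logder f Hf H0) as [x Hx].
destruct (logder f1 Hf1 H1') as [y Hy].
destruct (logder (C_derive f) (ball_ex f Hf) Hd) as [v Hv].
assert (Hh : Re c ^ 2 + Im c ^ 2 < s ^ 2).
{ rewrite <- Cmod2_alt. pose proof (Cmod_ge_0 c). nra. }
assert (Dir : forall e h1 h2, Cmod e = 1 ->
  deriv2_at (fun t => ln (s ^ 2 - Cmod (c + RtoC t * e)%C ^ 2)) 0 h1 h2 ->
  p2 * Re (C_derive f c / f c * e)%C ^ 2 + p1 * Re (x * e * e)%C
  + (q2 * Re (C_derive f c / f1 c * e)%C ^ 2 + q1 * Re (y * e * e)%C)
  + Re (v * e * e)%C + h2 <= 0).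
{ intros e h1 h2 He Dh.
  assert (E0 : (c + RtoC 0 * e)%C = c) by ring.
  pose proof (deriv2_at_ln_Cmod_line f c e x r Hr Hf H0 Hx) as A1.
  pose proof (deriv2_at_ln_Cmod_line f1 c e y r Hr Hf1 H1' Hy) as A2. rewrite E1 in A2.
  pose proof (deriv2_at_ln_Cmod_line (C_derive f) c e v r Hr (ball_ex f Hf) Hd Hv) as A3.
  rewrite <- E0 in HP at 1.
  change (f c - RtoC 1)%C with (f1 c) in HQ. rewrite <- E0 in HQ at 1.
  pose proof (deriv2_at_comp P _ 0 _ _ _ _ HP A1) as B1.
  pose proof (deriv2_at_comp Q _ 0 _ _ _ _ HQ A2) as B2.
  pose proof (deriv2_at_plus _ _ _ _ _ _ _ (deriv2_at_plus _ _ _ _ _ _ _ (deriv2_at_plus _ _ _ _ _ _ _ B1 B2) A3) Dh) as D.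
  apply (deriv2_at_local_max _ _ _ _ r D Hr).
  intros t Ht. rewrite Rminus_0_r in Ht. rewrite E0.
  apply (HZ (c + RtoC t * e)%C).
  replace (c + RtoC t * e - c)%C with (RtoC t * e)%C by ring.
  rewrite Cmod_mult, Cmod_R, He, Rmult_1_r. exact Ht. }
set (h := s ^ 2 - Cmod c ^ 2).
assert (Hhpos : 0 < h). { unfold h. rewrite Cmod2_alt. lra. }
assert (X1 := Dir (RtoC 1) (- 2 * Re c / h) (- 2 / h - 4 * Re c ^ 2 / h ^ 2) Cmod_1).
assert (X2 := Dir Ci (- 2 * Im c / h) (- 2 / h - 4 * Im c ^ 2 / h ^ 2) Cmod_Ci).
destruct (deriv2_at_ln_disc s (Re c) (Im c) Hh) as [v1 [e1 [K1 [K2 [K3 K4]]]]].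
assert (Hh' : Im c ^ 2 + Re c ^ 2 < s ^ 2) by lra.
destruct (deriv2_at_ln_disc s (Im c) (Re c) Hh') as [v2 [e2 [M1 [M2 [M3 M4]]]]].
assert (Y1 : deriv2_at (fun t => ln (s ^ 2 - Cmod (c + RtoC t * RtoC 1)%C ^ 2)) 0
    (- 2 * Re c / h) (- 2 / h - 4 * Re c ^ 2 / h ^ 2)).
{ exists v1, e1. split; [exact K1|]. unfold h. rewrite Cmod2_alt. split; [|split; auto].
  intros t Ht. apply (is_derive_ext (fun t => ln (s ^ 2 - ((Re c + t) ^ 2 + Im c ^ 2)))); auto.
  intros u. rewrite Cmod2_alt. f_equal. f_equal. unfold Re, Im; simpl. ring. }
assert (Y2 : deriv2_at (fun t => ln (s ^ 2 - Cmod (c + RtoC t * Ci)%C ^ 2)) 0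
    (- 2 * Im c / h) (- 2 / h - 4 * Im c ^ 2 / h ^ 2)).
{ exists v2, e2. split; [exact M1|]. unfold h. rewrite Cmod2_alt.
  rewrite (Rplus_comm (Re c ^ 2)). split; [|split; auto].
  intros t Ht. apply (is_derive_ext (fun t => ln (s ^ 2 - ((Im c + t) ^ 2 + Re c ^ 2)))); auto.
  intros u. rewrite Cmod2_alt. f_equal. f_equal. unfold Re, Im; simpl. ring. }
specialize (X1 Y1). specialize (X2 Y2).
change (f c - RtoC 1)%C with (f1 c).
set (ph := (C_derive f c / f c)%C) in *. set (ps := (C_derive f c / f1 c)%C) in *.
assert (Nph : Cmod (C_derive f c) ^ 2 / Cmod (f c) ^ 2 = Re ph ^ 2 + Im ph ^ 2).
{ rewrite <- Cmod2_alt. unfold ph. rewrite Cmod_div by auto. field.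
  apply Cmod_gt_0 in H0. lra. }
assert (Nps : Cmod (C_derive f c) ^ 2 / Cmod (f1 c) ^ 2 = Re ps ^ 2 + Im ps ^ 2).
{ rewrite <- Cmod2_alt. unfold ps. rewrite Cmod_div by auto. field.
  apply Cmod_gt_0 in H1'. lra. }
replace (Cmod (C_derive f c) ^ 2 * (p2 / Cmod (f c) ^ 2 + q2 / Cmod (f1 c) ^ 2))
  with (p2 * (Cmod (C_derive f c) ^ 2 / Cmod (f c) ^ 2) + q2 * (Cmod (C_derive f c) ^ 2 / Cmod (f1 c) ^ 2))
  by (unfold Rdiv; ring).
rewrite Nph, Nps.
replace (4 * s ^ 2 / h ^ 2) with (4 / h + 4 * (Re c ^ 2 + Im c ^ 2) / h ^ 2).
2: { rewrite <- Cmod2_alt. replace (Cmod c ^ 2) with (s ^ 2 - h) by (unfold h; ring). field. lra. }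
assert (F1 : Re (ph * RtoC 1)%C = Re ph) by (unfold Re; simpl; ring).
assert (F2 : Re (ps * RtoC 1)%C = Re ps) by (unfold Re; simpl; ring).
assert (F3 : Re (ph * Ci)%C = - Im ph) by (unfold Re, Im; simpl; ring).
assert (F4 : Re (ps * Ci)%C = - Im ps) by (unfold Re, Im; simpl; ring).
assert (G1 : forall z, Re (z * RtoC 1 * RtoC 1)%C = Re z) by (intros; unfold Re; simpl; ring).
assert (G2 : forall z, Re (z * Ci * Ci)%C = - Re z) by (intros; unfold Re; simpl; ring).
rewrite F1, F2, !G1 in X1. rewrite F3, F4, !G2 in X2.
unfold Rdiv in *. nra.
Qed.

(** * A crude form of Landau's theorem *)

Definition omits_0_1 (f : C -> C) : Prop :=
  forall w, Cmod w < 1 -> ex_derive f w /\ f w <> RtoC 0 /\ f w <> RtoC 1.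

Lemma Cminus_neq_0 (x y : C) : x <> y -> (x - y)%C <> RtoC 0.
Proof.
intros H E. apply H. replace x with (x - y + y)%C by ring. rewrite E. ring.
Qed.

Lemma ex_derive_C_derive_disc (f : C -> C) :
  (forall w, Cmod w < 1 -> ex_derive f w) ->
  forall w, Cmod w < 1 -> ex_derive (C_derive f) w.
Proof.
intros Hf w Hw. apply (ex_derive_C_derive f w (1 - Cmod w)); [lra|].
intros v Hv. apply Hf. replace v with ((v - w) + w)%C by ring.
eapply Rle_lt_trans; [apply Cmod_triangle|]. lra.
Qed.

(* The density at [w] of the pull-back by [f] of the conformal metric
   exp (P (ln |z|) + Q (ln |z - 1|)) |dz|, divided by that of the Poincare
   metric of the disc of radius [s] (up to a factor [s]). *)
Definition density_ratio (P Q : R -> R) (f : C -> C) (s : R) (w : C) : R :=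
  Cmod (C_derive f w) * exp (P (ln (Cmod (f w))) + Q (ln (Cmod (f w - RtoC 1)%C)))
  * (s ^ 2 - Cmod w ^ 2).

(** The uniform structure is fixed to the one given by [Cmod], so that neighbourhoods are discs. *)
Definition Ccontinuous (u : C -> R) (w : C) : Prop :=
  @continuous (AbsRing_UniformSpace C_AbsRing) R_UniformSpace u w.

Lemma Ccontinuous_eps (u : C -> R) (w : C) : Ccontinuous u w ->
  forall eps, 0 < eps -> exists d, 0 < d /\
    forall v, Cmod (v - w)%C < d -> Rabs (u v - u w) < eps.
Proof.
intros H eps He.
destruct (proj1 (filterlim_locally u (u w)) H (mkposreal eps He)) as [d Hd].
exists d. split; [apply cond_pos|]. intros v Hv. exact (Hd v Hv).
Qed.

Lemma Ccontinuous_Cmod (f : C -> C) (w : C) : ex_derive f w -> Ccontinuous (fun v => Cmod (f v)) w.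
Proof.
intros H.
apply (continuous_comp (U := AbsRing_UniformSpace C_AbsRing) (V := C_UniformSpace) f Cmod).
- exact (ex_derive_continuous (V := C_NormedModule) f w H).
- exact (filterlim_norm (V := C_NormedModule) (f w)).
Qed.

Lemma Ccontinuous_comp (u : C -> R) (p : R -> R) (w : C) :
  Ccontinuous u w -> continuous p (u w) -> Ccontinuous (fun v => p (u v)) w.
Proof. intros Hu Hp. exact (continuous_comp (U := AbsRing_UniformSpace C_AbsRing) u p w Hu Hp). Qed.

Lemma Ccontinuous_ln_Cmod (f : C -> C) (w : C) : ex_derive f w -> f w <> RtoC 0 ->
  Ccontinuous (fun v => ln (Cmod (f v))) w.
Proof.
intros H H0. apply (Ccontinuous_comp (fun v => Cmod (f v)) ln); [now apply Ccontinuous_Cmod|].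
apply (ex_derive_continuous (V := R_NormedModule)). auto_derive. now apply Cmod_gt_0.
Qed.

Lemma ex_derive_Cminus_const (f : C -> C) (k w : C) :
  ex_derive f w -> ex_derive (fun v => (f v - k)%C) w.
Proof.
intros [l Hl]. eexists. apply is_derive_Cminus; [exact Hl|apply is_derive_Cconst].
Qed.

Lemma Ccontinuous_density_ratio (P Q : R -> R) (f : C -> C) (s : R) (w : C) :
  omits_0_1 f -> Cmod w < 1 ->
  continuous P (ln (Cmod (f w))) -> continuous Q (ln (Cmod (f w - RtoC 1)%C)) ->
  Ccontinuous (density_ratio P Q f s) w.
Proof.
intros Hf Hw HP HQ. destruct (Hf w Hw) as [Df [F0 F1]].
assert (Cf' := ex_derive_C_derive_disc f (fun w Hw => proj1 (Hf w Hw)) w Hw).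
apply (continuous_mult (U := AbsRing_UniformSpace C_AbsRing) (K := R_AbsRing)).
- apply (continuous_mult (U := AbsRing_UniformSpace C_AbsRing) (K := R_AbsRing)).
  + exact (Ccontinuous_Cmod (C_derive f) w Cf').
  + apply (Ccontinuous_comp (fun v => P (ln (Cmod (f v))) + Q (ln (Cmod (f v - RtoC 1)%C))) exp).
    * apply (continuous_plus (U := AbsRing_UniformSpace C_AbsRing) (V := R_NormedModule)).
      -- apply (Ccontinuous_comp (fun v => ln (Cmod (f v))) P); auto.
         now apply Ccontinuous_ln_Cmod.
      -- apply (Ccontinuous_comp (fun v => ln (Cmod (f v - RtoC 1)%C)) Q); auto.
         apply (Ccontinuous_ln_Cmod (fun v => (f v - RtoC 1)%C)).
         ++ now apply ex_derive_Cminus_const.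
         ++ now apply Cminus_neq_0.
    * apply (ex_derive_continuous (V := R_NormedModule)). auto_derive. auto.
- apply (Ccontinuous_comp (fun v => Cmod v) (fun x => s ^ 2 - x ^ 2)).
  + apply (Ccontinuous_Cmod (fun v => v)). eexists. apply is_derive_Cid.
  + apply (ex_derive_continuous (V := R_NormedModule)). auto_derive. auto.
Qed.

(* The Ahlfors-Schwarz lemma: at a point where the ratio of the densities has
   a positive local maximum, the curvatures of the two metrics compare. *)
Lemma density_ratio_local_max (P Q : R -> R) (f : C -> C) (c : C) (s r p1 p2 q1 q2 : R) :
  omits_0_1 f -> Cmod c < s -> s <= 1 -> 0 < r ->
  deriv2_at P (ln (Cmod (f c))) p1 p2 -> deriv2_at Q (ln (Cmod (f c - RtoC 1)%C)) q1 q2 ->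
  0 < density_ratio P Q f s c ->
  (forall w, Cmod w < s -> Cmod (w - c)%C < r -> density_ratio P Q f s w <= density_ratio P Q f s c) ->
  Cmod (C_derive f c) ^ 2 * (p2 / Cmod (f c) ^ 2 + q2 / Cmod (f c - RtoC 1)%C ^ 2)
    <= 4 * s ^ 2 / (s ^ 2 - Cmod c ^ 2) ^ 2.
Proof.
intros Hf Hcs Hs1 Hr HP HQ Hpos Hmax.
destruct (Hf c ltac:(lra)) as [Df [F0 F1]].
pose proof (Cmod_ge_0 c) as Hc0.
assert (Hfc : C_derive f c <> RtoC 0).
{ intros E. unfold density_ratio in Hpos. rewrite E, Cmod_0 in Hpos. lra. }
pose proof (proj1 (Cmod_gt_0 _) Hfc) as Hfc'.
assert (Cf' := ex_derive_C_derive_disc f (fun w Hw => proj1 (Hf w Hw)) c ltac:(lra)).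
destruct (ex_derive_C_continuous _ _ Cf' _ Hfc') as [d [Hd Kd]].
(* On this smaller disc f' does not vanish and |w| < s, so logarithms can be taken and maximizing
   the ratio is maximizing their sum. *)
set (r' := Rmin (Rmin r d) (s - Cmod c)).
assert (Hr' : 0 < r') by (unfold r'; repeat apply Rmin_pos; lra).
assert (L1 : r' <= r) by (unfold r'; eapply Rle_trans; [apply Rmin_l|apply Rmin_l]).
assert (L2 : r' <= d) by (unfold r'; eapply Rle_trans; [apply Rmin_l|apply Rmin_r]).
assert (L3 : r' <= s - Cmod c) by apply Rmin_r.
assert (Hball : forall w, Cmod (w - c)%C < r' -> Cmod w < s).
{ intros w Hw. replace w with ((w - c) + c)%C by ring.
  eapply Rle_lt_trans; [apply Cmod_triangle|]. lra. }
apply (laplacian_at_max f c s r' p1 p2 q1 q2 P Q); auto.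
{ intros w Hw. apply Hf. specialize (Hball w Hw). lra. }
assert (LnD : forall w, Cmod w < s -> C_derive f w <> RtoC 0 ->
  0 < density_ratio P Q f s w /\
  P (ln (Cmod (f w))) + Q (ln (Cmod (f w - RtoC 1)%C)) + ln (Cmod (C_derive f w))
   + ln (s ^ 2 - Cmod w ^ 2) = ln (density_ratio P Q f s w)).
{ intros w Hw H0. apply Cmod_gt_0 in H0. pose proof (Cmod_ge_0 w).
  assert (0 < s ^ 2 - Cmod w ^ 2) by nra.
  unfold density_ratio. split.
  - apply Rmult_lt_0_compat; [apply Rmult_lt_0_compat|]; auto. apply exp_pos.
  - rewrite !ln_mult, ln_exp; auto using exp_pos; [ring|].
    apply Rmult_lt_0_compat; auto. apply exp_pos. }
intros w Hw.
assert (C_derive f w <> RtoC 0).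
{ intros E. specialize (Kd w ltac:(lra)). rewrite E, Cmod_sub_sym in Kd.
  replace (C_derive f c - RtoC 0)%C with (C_derive f c) in Kd by ring. lra. }
destruct (LnD w (Hball w Hw) H) as [W1 W2]. destruct (LnD c Hcs Hfc) as [C1 C2].
rewrite W2, C2.
assert (Hle : density_ratio P Q f s w <= density_ratio P Q f s c) by (apply Hmax; auto; lra).
destruct Hle as [h|h]; [left; now apply ln_increasing|rewrite h; lra].
Qed.

Lemma deriv2_at_continuous (u : R -> R) (x a b : R) : deriv2_at u x a b -> continuous u x.
Proof.
intros [v [e [He [D _]]]]. apply (ex_derive_continuous (V := R_NormedModule)).
exists (v x). apply D. rewrite Rminus_diag_eq, Rabs_R0; auto.
Qed.

(** The maximum principle is applied on |w| <= s with s < 1, where the maximum exists and the ratio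
    vanishes on the boundary; this lemma lets s tend to 1. *)
Lemma le_of_smaller_discs (X a B : R) : 0 <= X -> 0 <= a < 1 ->
  (forall s, a < s < 1 -> X * (s ^ 2 - a ^ 2) <= B) -> X * (1 - a ^ 2) <= B.
Proof.
intros HX Ha H. apply Rnot_lt_le. intros Hlt.
set (g := X * (1 - a ^ 2) - B).
assert (Hg : 0 < g) by (unfold g; lra).
set (e := Rmin ((1 - a) / 2) (g / (4 * (X + 1)))).
assert (He : 0 < e). { apply Rmin_pos; [lra|]. apply Rdiv_lt_0_compat; lra. }
assert (He1 : e <= (1 - a) / 2) by apply Rmin_l.
assert (He2 : e <= g / (4 * (X + 1))) by apply Rmin_r.
specialize (H (1 - e) ltac:(lra)).
assert (e * (4 * (X + 1)) <= g).
{ apply (Rmult_le_compat_r (4 * (X + 1))) in He2; [|lra].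
  replace (g / (4 * (X + 1)) * (4 * (X + 1))) with g in He2 by (field; lra). exact He2. }
assert (X * (2 * e - e ^ 2) >= g).
{ unfold g. replace ((1 - e) ^ 2) with (1 - (2 * e - e ^ 2)) in H by ring. nra. }
nra.
Qed.

(* The metric exp (crude_weight (ln |z|) + crude_weight (ln |z - 1|)) |dz| has density
   |z (z - 1)|^(-7/8) (1 + |z|^(1/4)) (1 + |z - 1|^(1/4)); the exponents are such
   that its curvature stays below a negative constant near 0, 1 and infinity. *)
Definition crude_weight (x : R) : R := ln (1 + exp (x / 4)) - 7 / 8 * x.

Lemma deriv2_at_crude_weight (x : R) :
  deriv2_at crude_weight x (1 / 4 * (exp (x / 4) / (1 + exp (x / 4))) - 7 / 8)
    (1 / 16 * (exp (x / 4) / (1 + exp (x / 4)) ^ 2)).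
Proof.
exists (fun x => 1 / 4 * (exp (x / 4) / (1 + exp (x / 4))) - 7 / 8), 1.
split; [lra|]. split; [|split; [reflexivity|]].
- intros t _. pose proof (exp_pos (t / 4)). unfold crude_weight. auto_derive.
  + unfold Rdiv in H. lra.
  + unfold Rdiv in *. field. lra.
- pose proof (exp_pos (x / 4)). unfold crude_weight. auto_derive.
  + unfold Rdiv in H. lra.
  + unfold Rdiv in *. field. lra.
Qed.

(** In terms of a = x^(1/4) the squared density and its curvature become rational: x^(7/4) is
    a^7. *)
Lemma exp_quarter_ln (x : R) : 0 < x ->
  0 < exp (ln x / 4) /\ exp (ln x / 4) ^ 4 = x /\
  exp (crude_weight (ln x)) ^ 2 = (1 + exp (ln x / 4)) ^ 2 / exp (ln x / 4) ^ 7.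
Proof.
intros Hx. pose proof (exp_pos (ln x / 4)) as HA. split; auto. split.
- simpl. rewrite Rmult_1_r, <- !exp_plus.
  replace (ln x / 4 + (ln x / 4 + (ln x / 4 + ln x / 4))) with (ln x) by field.
  now apply exp_ln.
- unfold crude_weight, Rminus. rewrite exp_plus, exp_ln by lra.
  rewrite Rpow_mult_distr.
  enough (E : exp (- (7 / 8 * ln x)) ^ 2 = / exp (ln x / 4) ^ 7) by (rewrite E; reflexivity).
  apply Rmult_eq_reg_r with (exp (ln x / 4) ^ 7).
  2: { apply pow_nonzero. lra. }
  rewrite Rinv_l by (apply pow_nonzero; lra).
  simpl. rewrite !Rmult_1_r, <- !exp_plus.
  match goal with |- exp ?u = 1 => replace u with 0 by field end. apply exp_0.
Qed.

(** Only the term in b, the smaller variable, is kept. After clearing denominators, (1+a)^2 (1+b)^4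
    <= (1+a)^6 <= (3a)^6 = 729 a^6 <= 1458 a^7, where both last steps use a >= 1/2. *)
Lemma crude_curvature_poly (a b : R) : 0 < a -> b <= a -> 0 < b -> 1 / 2 <= a ^ 4 ->
  1 / 1458 * (1 + a) ^ 2 * (1 + b) ^ 2 / (a ^ 7 * b ^ 7) <=
  1 / (a ^ 7 * (1 + a) ^ 2) + 1 / (b ^ 7 * (1 + b) ^ 2).
Proof.
intros Ha Hba Hb H4.
assert (Ha2 : 1 / 2 <= a).
{ apply Rnot_lt_le. intros h. assert (a ^ 2 < 1 / 4) by nra.
  assert (a ^ 4 = a ^ 2 * a ^ 2) by ring. pose proof (pow2_ge_0 a). nra. }
assert (P7 : 0 < a ^ 7) by now apply pow_lt. assert (Q7 : 0 < b ^ 7) by now apply pow_lt.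
assert (P2 : 0 < (1 + a) ^ 2) by (apply pow_lt; lra).
assert (Q2 : 0 < (1 + b) ^ 2) by (apply pow_lt; lra).
apply Rle_trans with (1 / (b ^ 7 * (1 + b) ^ 2)).
2: { assert (0 < 1 / (a ^ 7 * (1 + a) ^ 2)).
     { apply Rdiv_lt_0_compat; [lra|]. now apply Rmult_lt_0_compat. } lra. }
apply Rmult_le_reg_r with (1458 * (a ^ 7 * (b ^ 7 * (1 + b) ^ 2))).
{ repeat apply Rmult_lt_0_compat; lra. }
replace (1 / 1458 * (1 + a) ^ 2 * (1 + b) ^ 2 / (a ^ 7 * b ^ 7) * (1458 * (a ^ 7 * (b ^ 7 * (1 + b) ^ 2))))
  with ((1 + a) ^ 2 * ((1 + b) ^ 2 * (1 + b) ^ 2)) by (field; lra).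
replace (1 / (b ^ 7 * (1 + b) ^ 2) * (1458 * (a ^ 7 * (b ^ 7 * (1 + b) ^ 2))))
  with (1458 * a ^ 7) by (field; lra).
assert (B1 : (1 + b) ^ 2 <= (1 + a) ^ 2) by (apply pow_incr; lra).
apply Rle_trans with ((1 + a) ^ 2 * ((1 + a) ^ 2 * (1 + a) ^ 2)).
{ apply Rmult_le_compat_l; [lra|]. apply Rmult_le_compat; lra. }
replace ((1 + a) ^ 2 * ((1 + a) ^ 2 * (1 + a) ^ 2)) with ((1 + a) ^ 6) by ring.
apply Rle_trans with ((3 * a) ^ 6); [apply pow_incr; lra|].
replace ((3 * a) ^ 6) with (729 * a ^ 6) by ring.
replace (1458 * a ^ 7) with (729 * a ^ 6 * (2 * a)) by ring.
assert (0 < a ^ 6) by now apply pow_lt. nra.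
Qed.

(** With x = |z| and y = |z - 1| the right side is the Laplacian of the logarithm of the density, so
    the curvature is at most -1/23328, where 23328 = 16 * 1458. The triangle inequality provides 1
    <= x + y, so the larger of x and y is at least 1/2. *)
Lemma crude_curvature (x y : R) : 0 < x -> 0 < y -> 1 <= x + y ->
  1 / 23328 * exp (crude_weight (ln x) + crude_weight (ln y)) ^ 2 <=
  1 / 16 * (exp (ln x / 4) / (1 + exp (ln x / 4)) ^ 2) / x ^ 2 +
  1 / 16 * (exp (ln y / 4) / (1 + exp (ln y / 4)) ^ 2) / y ^ 2.
Proof.
intros Hx Hy Hxy. rewrite exp_plus, Rpow_mult_distr.
destruct (exp_quarter_ln x Hx) as [A1 [A2 A3]]. destruct (exp_quarter_ln y Hy) as [B1 [B2 B3]].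
rewrite A3, B3. set (a := exp (ln x / 4)) in *. set (b := exp (ln y / 4)) in *.
rewrite <- A2, <- B2 in Hxy |- *.
assert (K : 1 / 1458 * (1 + a) ^ 2 * (1 + b) ^ 2 / (a ^ 7 * b ^ 7) <=
  1 / (a ^ 7 * (1 + a) ^ 2) + 1 / (b ^ 7 * (1 + b) ^ 2)).
{ destruct (Rle_dec b a) as [h|h].
  - apply crude_curvature_poly; auto. assert (b ^ 4 <= a ^ 4) by (apply pow_incr; lra). lra.
  - assert (a ^ 4 <= b ^ 4) by (apply pow_incr; lra).
    pose proof (crude_curvature_poly b a B1 ltac:(lra) A1 ltac:(lra)) as K.
    rewrite (Rmult_comm (a ^ 7) (b ^ 7)).
    replace (1 / 1458 * (1 + a) ^ 2 * (1 + b) ^ 2) with (1 / 1458 * (1 + b) ^ 2 * (1 + a) ^ 2) by ring.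
    lra. }
replace (1 / 23328 * ((1 + a) ^ 2 / a ^ 7 * ((1 + b) ^ 2 / b ^ 7)))
  with (1 / 16 * (1 / 1458 * (1 + a) ^ 2 * (1 + b) ^ 2 / (a ^ 7 * b ^ 7))) by (field; lra).
replace (1 / 16 * (a / (1 + a) ^ 2) / (a ^ 4) ^ 2 + 1 / 16 * (b / (1 + b) ^ 2) / (b ^ 4) ^ 2)
  with (1 / 16 * (1 / (a ^ 7 * (1 + a) ^ 2) + 1 / (b ^ 7 * (1 + b) ^ 2))) by (field; lra).
lra.
Qed.

Lemma exp_crude_weight_ge (x : R) : 0 < x -> / (1 + x) <= exp (crude_weight (ln x)).
Proof.
intros Hx. rewrite <- (exp_ln (/ (1 + x))) by (apply Rinv_0_lt_compat; lra).
apply exp_le_exp. rewrite ln_Rinv by lra. unfold crude_weight.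
assert (0 < ln (1 + exp (ln x / 4))).
{ rewrite <- ln_1. apply ln_increasing; [lra|]. pose proof (exp_pos (ln x / 4)). lra. }
assert (0 < ln (1 + x)) by (rewrite <- ln_1; apply ln_increasing; lra).
assert (ln x < ln (1 + x)) by (apply ln_increasing; lra). lra.
Qed.

Lemma Cmod_plus_Cmod_minus_1 (w : C) : 1 <= Cmod w + Cmod (w - RtoC 1)%C.
Proof.
pose proof (Cmod_triangle w (- (w - RtoC 1))%C) as H. rewrite Cmod_opp in H.
replace (w + - (w - RtoC 1))%C with (RtoC 1) in H by ring. now rewrite Cmod_1 in H.
Qed.

Lemma usc_of_Ccontinuous (u : C -> R) (w : C) : Ccontinuous u w ->
  forall eps, 0 < eps -> exists d, 0 < d /\ forall v, Cmod (v - w)%C < d -> u v < u w + eps.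
Proof.
intros H eps He. destruct (Ccontinuous_eps u w H eps He) as [d [Hd K]].
exists d. split; auto. intros v Hv. specialize (K v Hv). apply Rabs_def2 in K. lra.
Qed.

Lemma closed_disc_closed (s : R) (q : C) :
  (forall eps, 0 < eps -> exists z, Cmod z <= s /\ Cmod (z - q)%C < eps) -> Cmod q <= s.
Proof.
intros H. apply Rnot_lt_le. intros Hlt.
destruct (H (Cmod q - s)) as [z [Hz Hzq]]; [lra|].
pose proof (Cmod_triangle_inv q z). rewrite Cmod_sub_sym in H0. lra.
Qed.

(** Curvature comparison bounds the density ratio by a constant. The factor (1 + |f|)(2 + |f|) is
    the reciprocal of a lower bound for the density, obtained from |f - 1| <= 1 + |f|. *)
Lemma landau_crude (f : C -> C) (c : C) : omits_0_1 f -> Cmod c < 1 ->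
  Cmod (C_derive f c) * (1 - Cmod c ^ 2) <= 306 * ((1 + Cmod (f c)) * (2 + Cmod (f c))).
Proof.
intros Hf Hc.
destruct (Hf c Hc) as [_ [F0 F1]].
set (D := density_ratio crude_weight crude_weight f).
assert (Bound : forall s, Cmod c < s < 1 -> D s c <= 306).
{ intros s Hs. pose proof (Cmod_ge_0 c) as Hc0.
  destruct (usc_max_on_compact (fun w => Cmod w <= s) (D s) s) as [q [Hq Hmax]].
  - exists c. lra.
  - auto.
  - apply closed_disc_closed.
  - intros q Hq eps He.
    destruct (usc_of_Ccontinuous (D s) q) with (eps := eps) as [d [Hd K]]; auto.
    + apply Ccontinuous_density_ratio; auto; [lra| |];
      (eapply deriv2_at_continuous; apply deriv2_at_crude_weight).
    + exists d. auto.
  - eapply Rle_trans; [apply Hmax; lra|].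
    destruct (Rle_dec (D s q) 0) as [h|h]; [lra|]. apply Rnot_le_lt in h.
    pose proof (Cmod_ge_0 q) as Hq0.
    (* The ratio vanishes on |w| = s, so a positive maximum is interior. *)
    assert (Hqs : Cmod q < s).
    { destruct Hq as [|E]; auto. unfold D, density_ratio in h. rewrite E in h.
      rewrite Rminus_diag_eq in h by reflexivity. lra. }
    destruct (Hf q ltac:(lra)) as [_ [G0 G1]].
    pose proof (density_ratio_local_max crude_weight crude_weight f q s 1 _ _ _ _ Hf Hqs
      ltac:(lra) Rlt_0_1 (deriv2_at_crude_weight _) (deriv2_at_crude_weight _) h
      (fun w Hw _ => Hmax w (Rlt_le _ _ Hw))) as K.
    pose proof (proj1 (Cmod_gt_0 _) G0) as X0.
    pose proof (proj1 (Cmod_gt_0 _) (Cminus_neq_0 _ _ G1)) as Y0.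
    pose proof (crude_curvature _ _ X0 Y0 (Cmod_plus_Cmod_minus_1 (f q))) as Cv.
    unfold D, density_ratio in *.
    set (m := exp (crude_weight (ln (Cmod (f q))) + crude_weight (ln (Cmod (f q - RtoC 1)%C)))) in *.
    set (k := Cmod (C_derive f q)) in *.
    set (u := s ^ 2 - Cmod q ^ 2) in *.
    assert (Hu : 0 < u) by (unfold u; nra).
    assert (K' : k ^ 2 * (1 / 23328 * m ^ 2) <= 4 * s ^ 2 / u ^ 2).
    { eapply Rle_trans; [|exact K]. apply Rmult_le_compat_l; [apply pow2_ge_0|exact Cv]. }
    (* 93312 = 4 * 23328, and 306 is the least integer whose square exceeds it. *)
    assert (K2 : (k * m * u) ^ 2 <= 93312 * s ^ 2).
    { apply (Rmult_le_compat_r (23328 * u ^ 2)) in K'; [|nra].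
      replace (4 * s ^ 2 / u ^ 2 * (23328 * u ^ 2)) with (93312 * s ^ 2) in K' by (field; lra).
      replace (k ^ 2 * (1 / 23328 * m ^ 2) * (23328 * u ^ 2)) with ((k * m * u) ^ 2) in K' by field.
      exact K'. }
    assert (s ^ 2 <= 1) by nra.
    apply Rnot_lt_le. intros Hlt. nra. }
set (m := exp (crude_weight (ln (Cmod (f c))) + crude_weight (ln (Cmod (f c - RtoC 1)%C)))).
assert (Hm : 0 < m) by apply exp_pos.
assert (E : Cmod (C_derive f c) * m * (1 - Cmod c ^ 2) <= 306).
{ apply le_of_smaller_discs.
  - apply Rmult_le_pos; [apply Cmod_ge_0|lra].
  - split; [apply Cmod_ge_0|exact Hc].
  - exact Bound. }
pose proof (proj1 (Cmod_gt_0 _) F0) as X0.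
pose proof (proj1 (Cmod_gt_0 _) (Cminus_neq_0 _ _ F1)) as Y0.
assert (Y1 : Cmod (f c - RtoC 1)%C <= 1 + Cmod (f c)).
{ unfold Cminus. eapply Rle_trans; [apply Cmod_triangle|]. rewrite Cmod_opp, Cmod_1. lra. }
assert (Hm2 : / ((1 + Cmod (f c)) * (2 + Cmod (f c))) <= m).
{ unfold m. rewrite exp_plus, Rinv_mult.
  apply Rmult_le_compat.
  - apply Rlt_le, Rinv_0_lt_compat; lra.
  - apply Rlt_le, Rinv_0_lt_compat; lra.
  - now apply exp_crude_weight_ge.
  - eapply Rle_trans; [|now apply exp_crude_weight_ge]. apply Rinv_le_contravar; lra. }
set (N := (1 + Cmod (f c)) * (2 + Cmod (f c))) in *.
assert (HN : 0 < N) by (unfold N; nra).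
assert (H1 : 1 <= m * N).
{ apply (Rmult_le_compat_r N) in Hm2; [|lra]. rewrite Rinv_l in Hm2 by lra. exact Hm2. }
set (X := Cmod (C_derive f c) * (1 - Cmod c ^ 2)).
assert (HX : 0 <= X).
{ apply Rmult_le_pos; [apply Cmod_ge_0|]. pose proof (Cmod_ge_0 c). nra. }
replace (Cmod (C_derive f c) * m * (1 - Cmod c ^ 2)) with (X * m) in E by (unfold X; ring).
apply Rle_trans with (X * (m * N)); nra.
Qed.

(** * Landau's theorem *)

(* exp (punctured_weight k (ln |z|)) |dz| is the hyperbolic metric of the
   punctured disc 0 < |z| < exp k. *)
Definition punctured_weight (k x : R) : R := - x - ln (2 * (k - x)).

Lemma deriv2_at_punctured_weight (k x : R) : x < k ->
  deriv2_at (punctured_weight k) x (- 1 + 1 / (k - x)) (1 / (k - x) ^ 2).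
Proof.
intros Hx. exists (fun x => - 1 + 1 / (k - x)), (k - x).
split; [lra|]. split; [|split; [reflexivity|]].
- intros t Ht. apply Rabs_def2 in Ht. unfold punctured_weight. auto_derive; [lra|field; lra].
- auto_derive; [lra|field; lra].
Qed.

Lemma deriv2_at_zero (x : R) : deriv2_at (fun _ => 0) x 0 0.
Proof.
exists (fun _ => 0), 1. split; [lra|]. split; [|split; [reflexivity|]];
intros; apply (is_derive_const (V := R_NormedModule)).
Qed.

Lemma exp_punctured_weight (k x : R) : 0 < x -> ln x < k ->
  exp (punctured_weight k (ln x)) = / (2 * x * (k - ln x)).
Proof.
intros Hx Hk. unfold punctured_weight.
rewrite <- (exp_ln (/ (2 * x * (k - ln x)))).
- f_equal. rewrite ln_Rinv, (ln_mult (2 * x)), !(ln_mult 2) by nra. ring.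
- apply Rinv_0_lt_compat. apply Rmult_lt_0_compat; lra.
Qed.

(* The crude bound controls the boundary part |f| = R1 of the region where the
   metric of the punctured disc is used; the constant [k] is chosen accordingly. *)
Theorem landau (R1 : R) : 1 <= R1 -> exists k, ln R1 < k /\
  forall f c, omits_0_1 f -> Cmod c < 1 -> Cmod (f c) <= R1 ->
    Cmod (C_derive f c) * (1 - Cmod c ^ 2) <= 2 * Cmod (f c) * (k - ln (Cmod (f c))).
Proof.
intros HR1. set (M := 306 * ((1 + R1) * (2 + R1))).
assert (HM : 1 <= M) by (unfold M; nra).
(* M is the crude bound at |f| = R1. This choice gives k - ln |f| >= M wherever |f| <= R1, with
   equality on |f| = R1. *)
set (k := ln R1 + M). exists k. split; [unfold k; lra|].
intros f c Hf Hc Hfc.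
set (Q := fun _ : R => 0).
set (D := density_ratio (punctured_weight k) Q f).
assert (Hln : forall w, Cmod w < 1 -> Cmod (f w) <= R1 -> 0 < Cmod (f w) /\ M <= k - ln (Cmod (f w))).
{ intros w Hw Hle. destruct (Hf w Hw) as [_ [F0 _]]. apply Cmod_gt_0 in F0. split; auto.
  unfold k. destruct Hle as [h|h]; [apply ln_increasing in h; lra|rewrite h; lra]. }
assert (ED : forall s w, Cmod w < 1 -> Cmod (f w) <= R1 -> D s w =
  Cmod (C_derive f w) / (2 * Cmod (f w) * (k - ln (Cmod (f w)))) * (s ^ 2 - Cmod w ^ 2)).
{ intros s w Hw Hle. destruct (Hln w Hw Hle). unfold D, density_ratio, Q.
  rewrite Rplus_0_r, exp_punctured_weight by lra. reflexivity. }
assert (Bound : forall s, Cmod c < s < 1 -> D s c <= 1).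
{ intros s Hs. pose proof (Cmod_ge_0 c) as Hc0.
  destruct (usc_max_on_compact (fun w => Cmod w <= s /\ Cmod (f w) <= R1) (D s) s) as [q [[Hq HqR] Hmax]].
  - exists c. lra.
  - now intros z [Hz _].
  - intros q Hq.
    assert (Hqs : Cmod q <= s).
    { apply closed_disc_closed. intros eps He. destruct (Hq eps He) as [z [[Hz _] Hz']]. now exists z. }
    split; auto. apply Rnot_lt_le. intros Hlt.
    destruct (Hf q ltac:(lra)) as [Dq _].
    destruct (ex_derive_C_continuous f q Dq (Cmod (f q) - R1)) as [d [Hd Kd]]; [lra|].
    destruct (Hq d Hd) as [z [[_ Hz] Hz']]. specialize (Kd z Hz').
    pose proof (Cmod_triangle_inv (f q) (f z)). rewrite Cmod_sub_sym in H. lra.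
  - intros q [Hq HqR] eps He. destruct (Hln q ltac:(lra) HqR).
    destruct (usc_of_Ccontinuous (D s) q) with (eps := eps) as [d [Hd Kd]]; auto.
    + apply Ccontinuous_density_ratio; auto; [lra| |].
      * eapply deriv2_at_continuous, deriv2_at_punctured_weight; lra.
      * eapply deriv2_at_continuous, deriv2_at_zero.
    + exists d. auto.
  - eapply Rle_trans; [apply Hmax; lra|].
    destruct (Hln q ltac:(lra) HqR) as [X0 L0].
    pose proof (Cmod_ge_0 q) as Hq0.
    destruct (Rle_dec (D s q) 0) as [h|h]; [lra|]. apply Rnot_le_lt in h.
    assert (Hqs : Cmod q < s).
    { destruct Hq as [|E]; auto. rewrite ED in h by lra. rewrite E, (Rminus_diag_eq (s ^ 2)) in h by reflexivity. lra. }
    destruct HqR as [HqR|HqR].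
    (* When |f q| < R1 strictly, a whole disc around q lies in the region, so q is a genuine local
       maximum. *)
    + destruct (Hf q ltac:(lra)) as [Dq _].
      destruct (ex_derive_C_continuous f q Dq (R1 - Cmod (f q))) as [d [Hd Kd]]; [lra|].
      pose proof (density_ratio_local_max (punctured_weight k) Q f q s d _ _ _ _ Hf Hqs
        ltac:(lra) Hd (deriv2_at_punctured_weight k (ln (Cmod (f q))) ltac:(lra)) (deriv2_at_zero _) h) as K.
      rewrite ED in * by lra.
      set (x := Cmod (f q)) in *. set (m := Cmod (C_derive f q)) in *.
      set (u := s ^ 2 - Cmod q ^ 2) in *. set (L := k - ln x) in *.
      assert (Hu : 0 < u) by (unfold u; nra).
      assert (K' : m ^ 2 * (1 / L ^ 2 / x ^ 2) <= 4 * s ^ 2 / u ^ 2).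
      { eapply Rle_trans; [|apply K].
        - apply Req_le. unfold Rdiv. ring.
        - intros w Hw Hwd. apply Hmax. split; [lra|]. specialize (Kd w Hwd).
          pose proof (Cmod_triangle_inv (f w) (f q)). fold x in H. lra. }
      assert (0 < L) by lra.
      (* The curvatures agree, so the squared ratio is bounded by s^2 < 1 and no factor is lost. *)
      assert (K2 : (m / (2 * x * L) * u) ^ 2 <= s ^ 2).
      { apply (Rmult_le_compat_r (u ^ 2 / 4)) in K'; [|nra].
        replace (4 * s ^ 2 / u ^ 2 * (u ^ 2 / 4)) with (s ^ 2) in K' by (field; lra).
        replace (m ^ 2 * (1 / L ^ 2 / x ^ 2) * (u ^ 2 / 4)) with ((m / (2 * x * L) * u) ^ 2) in K' by (field; lra).
        exact K'. }
      apply Rnot_lt_le. intros Hlt. nra.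
    (* When |f q| = R1 the crude bound gives m (s^2 - |q|^2) <= M, while the denominator 2 x L
       equals 2 R1 M with R1 >= 1. *)
    + rewrite ED by lra.
      pose proof (landau_crude f q Hf ltac:(lra)) as Cr. rewrite HqR in Cr. fold M in Cr.
      set (m := Cmod (C_derive f q)) in *. set (x := Cmod (f q)) in *. set (L := k - ln x) in *.
      assert (Hm : m * (s ^ 2 - Cmod q ^ 2) <= M).
      { eapply Rle_trans; [|exact Cr]. apply Rmult_le_compat_l; [apply Cmod_ge_0|]. nra. }
      apply Rmult_le_reg_r with (2 * x * L); [nra|].
      replace (m / (2 * x * L) * (s ^ 2 - Cmod q ^ 2) * (2 * x * L)) with (m * (s ^ 2 - Cmod q ^ 2)) by (field; lra).
      nra. }
destruct (Hln c Hc Hfc) as [X0 L0].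
assert (E : Cmod (C_derive f c) / (2 * Cmod (f c) * (k - ln (Cmod (f c)))) * (1 - Cmod c ^ 2) <= 1).
{ apply le_of_smaller_discs.
  - apply Rdiv_le_0_compat; [apply Cmod_ge_0|nra].
  - split; [apply Cmod_ge_0|exact Hc].
  - intros s Hs. rewrite <- ED by auto. now apply Bound. }
set (x := Cmod (f c)) in *. set (L := k - ln x) in *.
assert (HxL : 0 < 2 * x * L) by nra.
apply (Rmult_le_compat_r (2 * x * L)) in E; [|lra].
replace (Cmod (C_derive f c) / (2 * x * L) * (1 - Cmod c ^ 2) * (2 * x * L))
  with (Cmod (C_derive f c) * (1 - Cmod c ^ 2)) in E by (field; lra).
lra.
Qed.

(** * Integration of Landau's inequality along a ray *)

Lemma growth_until_exit (g g' : R -> R) (k l t : R) :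
  0 <= t < 1 -> (forall u, 0 <= u <= t -> is_derive g u (g' u)) ->
  (forall u, 0 <= u <= t -> g u <= l) -> l < k ->
  (forall u, 0 <= u <= t -> g' u * (1 - u ^ 2) <= 2 * (k - g u)) ->
  (1 - t) / (1 + t) * (k - g 0) <= k - g t.
Proof.
intros Ht Hd Hl Hk Hb.
(* (1 + u)/(1 - u) is the integrating factor, the exponential of the integral of 2/(1 - u^2); the
   hypothesis says exactly that E' >= 0. *)
set (E := fun u => (k - g u) * ((1 + u) / (1 - u))).
assert (HE : E 0 <= E t).
{ destruct (Req_dec t 0) as [->|Ht0]; [lra|].
  destruct (MVT_cor2 E (fun u => - g' u * ((1 + u) / (1 - u)) + (k - g u) * (2 / (1 - u) ^ 2)) 0 t)
    as [y [Ey Hy]]; [lra| |].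
  - intros u Hu. apply is_derive_Reals. unfold E.
    assert (D1 : is_derive (fun u => k - g u) u (- g' u)).
    { replace (- g' u) with (0 - g' u) by ring.
      apply (is_derive_minus (V := R_NormedModule) (fun _ => k) g); [|apply Hd; lra].
      apply (is_derive_const (V := R_NormedModule)). }
    assert (D2 : is_derive (fun u => (1 + u) / (1 - u)) u (2 / (1 - u) ^ 2)).
    { auto_derive; [lra|field; lra]. }
    exact (is_derive_mult (K := R_AbsRing) _ _ _ _ _ D1 D2 Rmult_comm).
  - assert (0 <= - g' y * ((1 + y) / (1 - y)) + (k - g y) * (2 / (1 - y) ^ 2)); [|nra].
    replace (- g' y * ((1 + y) / (1 - y)) + (k - g y) * (2 / (1 - y) ^ 2))
      with ((2 * (k - g y) - g' y * (1 - y ^ 2)) / (1 - y) ^ 2) by (field; lra).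
    apply Rdiv_le_0_compat; [specialize (Hb y ltac:(lra)); lra|apply pow_lt; lra]. }
unfold E in HE. replace ((1 + 0) / (1 - 0)) with 1 in HE by field.
apply Rmult_le_reg_r with ((1 + t) / (1 - t)); [apply Rdiv_lt_0_compat; lra|].
replace ((1 - t) / (1 + t) * (k - g 0) * ((1 + t) / (1 - t))) with (k - g 0) by (field; lra).
lra.
Qed.

(** The inequality is available only where g <= l. If g exceeds l somewhere, let t be the first
    exit: there g t = l, and since (1 - t)/(1 + t) decreases in t, the estimate at t implies the
    second alternative at [T]. *)
Lemma growth (g g' : R -> R) (k l T : R) :
  0 <= T < 1 -> (forall u, 0 <= u <= T -> is_derive g u (g' u)) ->
  g 0 <= l -> l < k ->
  (forall u, 0 <= u <= T -> g u <= l -> g' u * (1 - u ^ 2) <= 2 * (k - g u)) ->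
  (1 - T) / (1 + T) * (k - g 0) <= k - g T \/ (1 - T) / (1 + T) * (k - g 0) <= k - l.
Proof.
intros HT Hd H0 Hk Hb.
assert (Cont : forall u, 0 <= u <= T -> forall eps, 0 < eps -> exists d, 0 < d /\
  forall v, Rabs (v - u) < d -> Rabs (g v - g u) < eps).
{ intros u Hu. apply continuous_R_eps, (ex_derive_continuous (V := R_NormedModule)).
  exists (g' u). now apply Hd. }
destruct (classic (forall u, 0 <= u <= T -> g u <= l)) as [Hall|Hnot].
{ left. apply (growth_until_exit g g' k l T); auto. }
right.
(* The exit parameter is the supremum of this set; continuity of g shows that it belongs to the set
   and that g equals l there. *)
set (S := fun t => 0 <= t <= T /\ forall u, 0 <= u <= t -> g u <= l).
destruct (completeness S) as [t [Ht1 Ht2]].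
{ exists T. now intros x [Hx _]. }
{ exists 0. split; [lra|]. intros u Hu. replace u with 0 by lra. exact H0. }
assert (Ht : 0 <= t <= T).
{ split; [apply Ht1; split; [lra|]; intros u Hu; replace u with 0 by lra; exact H0|].
  apply Ht2. now intros x [Hx _]. }
assert (Hlt : forall u, 0 <= u < t -> g u <= l).
{ intros u Hu. apply NNPP. intros HN.
  assert (t <= u); [|lra]. apply Ht2. intros x [Hx Hx'].
  apply Rnot_lt_le. intros Hux. apply HN, Hx'. lra. }
assert (Hgt : g t <= l).
{ apply Rnot_lt_le. intros Hc.
  destruct (Req_dec t 0) as [E|E]; [rewrite E in Hc; lra|].
  destruct (Cont t Ht (g t - l)) as [d [Hd0 Kd]]; [lra|].
  set (v := t - Rmin (t / 2) (d / 2)).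
  assert (0 < Rmin (t / 2) (d / 2)) by (apply Rmin_pos; lra).
  pose proof (Rmin_l (t / 2) (d / 2)). pose proof (Rmin_r (t / 2) (d / 2)).
  specialize (Kd v ltac:(unfold v; apply Rabs_def1; lra)).
  apply Rabs_def2 in Kd. specialize (Hlt v ltac:(unfold v; lra)). lra. }
assert (Hle : forall u, 0 <= u <= t -> g u <= l).
{ intros u Hu. destruct (Req_dec u t) as [->|]; auto. apply Hlt; lra. }
assert (HtT : t < T).
{ apply Rnot_le_lt. intros h. apply Hnot. intros u Hu. apply Hle. lra. }
assert (Eg : g t = l).
{ apply Rle_antisym; auto. apply Rnot_lt_le. intros Hc.
  destruct (Cont t Ht (l - g t)) as [d [Hd0 Kd]]; [lra|].
  set (e := Rmin (d / 2) (T - t)).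
  assert (0 < e) by (apply Rmin_pos; lra).
  assert (e <= d / 2) by apply Rmin_l. assert (e <= T - t) by apply Rmin_r.
  assert (t + e <= t); [|lra]. apply Ht1. split; [lra|].
  intros u Hu. destruct (Rle_dec u t); [apply Hle; lra|].
  specialize (Kd u ltac:(apply Rabs_def1; lra)). apply Rabs_def2 in Kd. lra. }
rewrite <- Eg.
apply Rle_trans with ((1 - t) / (1 + t) * (k - g 0)).
- apply Rmult_le_compat_r; [lra|].
  apply Rmult_le_reg_r with ((1 + T) * (1 + t)); [nra|].
  replace ((1 - T) / (1 + T) * ((1 + T) * (1 + t))) with ((1 - T) * (1 + t)) by (field; lra).
  replace ((1 - t) / (1 + t) * ((1 + T) * (1 + t))) with ((1 - t) * (1 + T)) by (field; lra).
  nra.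
- apply (growth_until_exit g g' k l t); auto; try lra.
  + intros u Hu. apply Hd. lra.
  + intros u Hu. apply Hb; [lra|]. now apply Hle.
Qed.

(** Divided by |f|, Landau's inequality becomes linear in ln |f|: along the ray its derivative Re(f'
    e / f) is at most |f'| / |f|. *)
Lemma Cmod_growth (f : C -> C) (R1 k : R) (c : C) :
  0 < R1 -> ln R1 < k ->
  (forall w, Cmod w < 1 -> ex_derive f w /\ f w <> RtoC 0) ->
  (forall w, Cmod w < 1 -> Cmod (f w) <= R1 ->
    Cmod (C_derive f w) * (1 - Cmod w ^ 2) <= 2 * Cmod (f w) * (k - ln (Cmod (f w)))) ->
  Cmod c < 1 -> Cmod (f (RtoC 0)) <= R1 ->
  let a := (1 - Cmod c) / (1 + Cmod c) in
  a * (k - ln (Cmod (f (RtoC 0)))) <= k - ln (Cmod (f c)) \/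
  a * (k - ln (Cmod (f (RtoC 0)))) <= k - ln R1.
Proof.
intros HR1 Hk Hf Hb Hc H0 a. pose proof (Cmod_ge_0 c) as Hc0.
(* The direction c/|c| exists only for nonzero c. *)
destruct (Req_dec (Cmod c) 0) as [Ec|Ec].
{ left. unfold a. rewrite Ec. apply Cmod_eq_0 in Ec. rewrite Ec. apply Req_le. field. }
set (e := (c / RtoC (Cmod c))%C).
assert (Ec' : RtoC (Cmod c) <> RtoC 0).
{ intros E. apply (f_equal fst) in E. now simpl in E. }
assert (He : Cmod e = 1).
{ unfold e. rewrite Cmod_div, Cmod_R, Rabs_pos_eq by auto. field. exact Ec. }
assert (Hle : forall x y, 0 < x -> ln x <= ln y -> 0 < y -> x <= y).
{ intros x y Hx Hxy Hy. apply Rnot_lt_le. intros h. apply ln_increasing in h; auto. lra. }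
destruct (growth (fun t => ln (Cmod (f (RtoC 0 + RtoC t * e)%C)))
   (fun t => Re (C_derive f (RtoC 0 + RtoC t * e)%C / f (RtoC 0 + RtoC t * e)%C * e)%C)
   k (ln R1) (Cmod c)) as [K|K]; auto.
- intros u Hu.
  assert (Hu' : Cmod (RtoC 0 + RtoC u * e)%C < 1).
  { rewrite Cplus_0_l, Cmod_mult, He, Cmod_R, Rabs_pos_eq; lra. }
  destruct (Hf _ Hu') as [D F0].
  apply is_derive_ln_Cmod_line; auto. apply C_derive_correct; auto.
- replace (RtoC 0 + RtoC 0 * e)%C with (RtoC 0) by ring.
  assert (0 < Cmod (f (RtoC 0))) by (apply Cmod_gt_0, Hf; rewrite Cmod_0; lra).
  destruct H0 as [h|h]; [left; now apply ln_increasing|rewrite h; lra].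
- intros u Hu Hl.
  assert (Eu : Cmod (RtoC 0 + RtoC u * e)%C = u).
  { rewrite Cplus_0_l, Cmod_mult, He, Cmod_R, Rabs_pos_eq; lra. }
  set (w := (RtoC 0 + RtoC u * e)%C) in *.
  destruct (Hf w ltac:(lra)) as [D F0]. apply Cmod_gt_0 in F0 as F0'.
  specialize (Hb w ltac:(lra) (Hle _ _ F0' Hl HR1)). rewrite Eu in Hb.
  apply Rle_trans with (Cmod (C_derive f w) / Cmod (f w) * (1 - u ^ 2)).
  + apply Rmult_le_compat_r; [nra|].
    eapply Rle_trans; [apply Rle_abs|]. eapply Rle_trans; [apply Rabs_Re_le|].
    rewrite Cmod_mult, He, Cmod_div by auto. lra.
  + apply Rmult_le_reg_r with (Cmod (f w)); auto.
    replace (Cmod (C_derive f w) / Cmod (f w) * (1 - u ^ 2) * Cmod (f w))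
      with (Cmod (C_derive f w) * (1 - u ^ 2)) by (field; lra). lra.
- left. replace (RtoC 0 + RtoC 0 * e)%C with (RtoC 0) in K by ring.
  replace (RtoC 0 + RtoC (Cmod c) * e)%C with c in K; [exact K|].
  unfold e. field. exact Ec'.
- right. replace (RtoC 0 + RtoC 0 * e)%C with (RtoC 0) in K by ring. exact K.
Qed.

(** * Holomorphic motions *)

Lemma locally_C_eps (P : C -> Prop) (c : C) : locally c P ->
  exists d, 0 < d /\ forall w, Cmod (w - c)%C < d -> P w.
Proof.
intros [d Hd]. exists d. split; [apply cond_pos|].
intros w Hw. apply Hd, C_NormedModule_mixin_compat1, Hw.
Qed.

Definition normalized_motion (h : C -> sphere -> sphere) : Prop :=
  holomorphic_motion (fun _ => True) h /\ normalized h.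

Lemma motion_finite (h : C -> sphere -> sphere) (z c : C) :
  normalized_motion h -> Cmod c < 1 -> h c (Fin z) = Fin (traj h z c).
Proof.
intros [[_ [Hinj _]] Hn] Hc. unfold traj.
destruct (h c (Fin z)) as [v|] eqn:E; [reflexivity|].
destruct (Hn c Hc) as [_ [_ HI]]. rewrite <- HI in E.
apply (Hinj c Hc) in E; auto. discriminate.
Qed.

Lemma traj_inj (h : C -> sphere -> sphere) (z1 z2 c : C) :
  normalized_motion h -> Cmod c < 1 -> z1 <> z2 -> traj h z1 c <> traj h z2 c.
Proof.
intros Hm Hc Hz E. pose proof (motion_finite h z1 c Hm Hc) as E1.
rewrite E, <- (motion_finite h z2 c Hm Hc) in E1.
destruct Hm as [[_ [Hinj _]] _]. apply (Hinj c Hc) in E1; auto. now injection E1.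
Qed.

Lemma traj_base (h : C -> sphere -> sphere) (z : C) :
  normalized_motion h -> traj h z (RtoC 0) = z.
Proof. intros [[H0 _] _]. unfold traj. now rewrite H0. Qed.

Lemma traj_fixed (h : C -> sphere -> sphere) (j c : C) :
  normalized_motion h -> Cmod c < 1 -> j = RtoC 0 \/ j = RtoC 1 -> traj h j c = j.
Proof.
intros [_ Hn] Hc Hj. destruct (Hn c Hc) as [E0 [E1 _]]. unfold traj.
destruct Hj as [-> | ->]; [rewrite E0|rewrite E1]; reflexivity.
Qed.

(** The definition may present a finite value in the chart at infinity. As the trajectory avoids
    [Inf], the chart function has no zero near c and its inverse is differentiable. *)
Lemma ex_derive_traj (h : C -> sphere -> sphere) (z c : C) :
  normalized_motion h -> Cmod c < 1 -> ex_derive (traj h z) c.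
Proof.
intros Hm Hc. assert (Hm' := Hm). destruct Hm' as [[_ [_ Hh]] _].
destruct (Hh (Fin z) I c Hc) as [b [g [HL [l Hl]]]].
apply locally_C_eps in HL. destruct HL as [d [Hd HL]].
set (e := Rmin d (1 - Cmod c)).
assert (He : 0 < e) by (apply Rmin_pos; lra).
assert (E : forall w, Cmod (w - c)%C < e -> Fin (traj h z w) = chart_inv b (g w)).
{ intros w Hw. pose proof (Rmin_l d (1 - Cmod c)). pose proof (Rmin_r d (1 - Cmod c)).
  fold e in H, H0. rewrite <- motion_finite; auto.
  - apply HL. lra.
  - replace w with ((w - c) + c)%C by ring. eapply Rle_lt_trans; [apply Cmod_triangle|]. lra. }
destruct b.
- assert (G : forall w, Cmod (w - c)%C < e -> g w <> RtoC 0 /\ (/ g w)%C = traj h z w).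
  { intros w Hw. specialize (E w Hw). unfold chart_inv, sphere_inv in E.
    destruct (Ceq_dec (g w) (RtoC 0)) as [E0|N0]; [discriminate|].
    split; auto. now injection E. }
  assert (Hcc : Cmod (c - c)%C < e).
  { replace (c - c)%C with (RtoC 0) by ring. now rewrite Cmod_0. }
  eexists. apply (is_derive_C_ext_loc (fun w => (/ g w)%C) (traj h z) c _ e); auto.
  + intros w Hw. now apply G.
  + apply is_derive_Cinv; [exact Hl|]. now apply G.
- exists l. apply (is_derive_C_ext_loc g (traj h z) c l e); auto.
  intros w Hw. specialize (E w Hw). simpl in E. now injection E.
Qed.

Lemma is_derive_traj (h : C -> sphere -> sphere) (z c : C) :
  normalized_motion h -> Cmod c < 1 -> is_derive (traj h z) c (velocity h z c).
Proof. intros Hm Hc. apply C_derive_correct; [exact c|now apply ex_derive_traj]. Qed.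

(** By injectivity the trajectory of a point other than 0 and 1 omits 0 and 1, so the crude theorem
    applies to the trajectory itself; the points 0 and 1 have velocity 0. *)
Lemma velocity_bound (h : C -> sphere -> sphere) (z c : C) :
  normalized_motion h -> Cmod c < 1 ->
  Cmod (velocity h z c) * (1 - Cmod c ^ 2)
    <= 306 * ((1 + Cmod (traj h z c)) * (2 + Cmod (traj h z c))).
Proof.
intros Hm Hc.
destruct (classic (z = RtoC 0 \/ z = RtoC 1)) as [Hz|Hz].
- assert (E : velocity h z c = RtoC 0).
  { apply is_C_derive_unique.
    apply (is_derive_C_ext_loc (fun _ => z) (traj h z) c _ (1 - Cmod c)); [lra| |apply is_derive_Cconst].
    intros w Hw. symmetry. apply traj_fixed; auto.
    replace w with ((w - c) + c)%C by ring. eapply Rle_lt_trans; [apply Cmod_triangle|]. lra. }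
  rewrite E, Cmod_0. pose proof (Cmod_ge_0 (traj h z c)). nra.
- apply landau_crude; auto. intros w Hw. split; [now apply ex_derive_traj|].
  split; intros E; [apply (traj_inj h z (RtoC 0) w)|apply (traj_inj h z (RtoC 1) w)]; auto;
  rewrite E, traj_fixed; auto.
Qed.

(* The cross-ratio of (z1, z2, j, infinity). *)
Definition cross_ratio (h : C -> sphere -> sphere) (j z1 z2 w : C) : C :=
  ((traj h z2 w - traj h z1 w) / (j - traj h z1 w))%C.

Lemma cross_ratio_holomorphic (h : C -> sphere -> sphere) (j z1 z2 w : C) :
  normalized_motion h -> j = RtoC 0 \/ j = RtoC 1 -> z1 <> z2 -> z1 <> j -> Cmod w < 1 ->
  ex_derive (cross_ratio h j z1 z2) w /\ cross_ratio h j z1 z2 w <> RtoC 0 /\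
  (j - traj h z1 w)%C <> RtoC 0.
Proof.
intros Hm Hj H12 H1j Hw.
assert (D : (j - traj h z1 w)%C <> RtoC 0).
{ rewrite <- (traj_fixed h j w Hm Hw Hj). apply Cminus_neq_0, traj_inj; auto. }
split; [|split; auto].
- eexists. apply (is_derive_Cdiv (fun w => (traj h z2 w - traj h z1 w)%C) (fun w => (j - traj h z1 w)%C)); auto.
  + apply is_derive_Cminus; apply is_derive_traj; auto.
  + apply is_derive_Cminus; [apply is_derive_Cconst|apply is_derive_traj; auto].
- unfold cross_ratio. apply Cmod_gt_0. rewrite Cmod_div by auto.
  apply Rdiv_lt_0_compat; apply Cmod_gt_0; auto.
  apply Cminus_neq_0, traj_inj; auto.
Qed.

(** The value 1 would mean that z2 meets j, which injectivity forbids unless z2 = j; then the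
    function is the constant 1 and the inequality reduces to 0 <= 2k. The threshold 2 is a distance
    at most 1 divided by |j - z1| >= 1/2. One [k] serves all pairs of points. *)
Lemma cross_ratio_landau (h : C -> sphere -> sphere) : normalized_motion h ->
  exists k, ln 2 < k /\ forall j z1 z2 w : C,
    j = RtoC 0 \/ j = RtoC 1 -> z1 <> z2 -> z1 <> j -> Cmod w < 1 ->
    Cmod (cross_ratio h j z1 z2 w) <= 2 ->
    Cmod (C_derive (cross_ratio h j z1 z2) w) * (1 - Cmod w ^ 2) <=
    2 * Cmod (cross_ratio h j z1 z2 w) * (k - ln (Cmod (cross_ratio h j z1 z2 w))).
Proof.
intros Hm. destruct (landau 2 ltac:(lra)) as [k [Hk L]]. exists k. split; auto.
intros j z1 z2 w Hj H12 H1j Hw Hle.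
destruct (Ceq_dec z2 j) as [E2|N2].
- assert (E : forall v, Cmod v < 1 -> cross_ratio h j z1 z2 v = RtoC 1).
  { intros v Hv. destruct (cross_ratio_holomorphic h j z1 z2 v Hm Hj H12 H1j Hv) as [_ [_ D]].
    unfold cross_ratio. rewrite E2, traj_fixed; auto. field. exact D. }
  rewrite E, Cmod_1, ln_1 by auto.
  replace (C_derive (cross_ratio h j z1 z2) w) with (RtoC 0).
  + rewrite Cmod_0. assert (0 < ln 2) by (rewrite <- ln_1; apply ln_increasing; lra). lra.
  + symmetry. apply is_C_derive_unique.
    apply (is_derive_C_ext_loc (fun _ => RtoC 1) _ w _ (1 - Cmod w)); [lra| |apply is_derive_Cconst].
    intros v Hv. symmetry. apply E.
    replace v with ((v - w) + w)%C by ring. eapply Rle_lt_trans; [apply Cmod_triangle|]. lra.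
- apply L; auto. intros v Hv.
  destruct (cross_ratio_holomorphic h j z1 z2 v Hm Hj H12 H1j Hv) as [D [F0 D1]].
  split; [exact D|]. split; [exact F0|]. intros E.
  apply (traj_inj h z2 j v Hm Hv N2). rewrite (traj_fixed h j v Hm Hv Hj).
  unfold cross_ratio in E.
  replace (traj h z2 v) with ((traj h z2 v - traj h z1 v) / (j - traj h z1 v) * (j - traj h z1 v) + traj h z1 v)%C
    by (field; exact D1).
  rewrite E. ring.
Qed.

(** * The two estimates for a pair of trajectories *)

Lemma far_from_0_or_1 (z : C) :
  exists j, (j = RtoC 0 \/ j = RtoC 1) /\ 1 / 2 <= Cmod (j - z)%C.
Proof.
destruct (Rle_dec (1 / 2) (Cmod (RtoC 0 - z)%C)) as [h|h].
- exists (RtoC 0). auto.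
- exists (RtoC 1). split; auto.
  pose proof (Cmod_plus_Cmod_minus_1 z) as H.
  rewrite (Cmod_sub_sym z (RtoC 1)) in H. replace (RtoC 0 - z)%C with (- z)%C in h by ring.
  rewrite Cmod_opp in h. lra.
Qed.

(** In the constant, 2k comes from Landau's theorem, 2 ln(1 + R0) from replacing |F| by |z2(c) -
    z1(c)| = |F| |j - z1(c)| in the logarithm, and 612 = 2 * 306 from the term F V(z1), where |F| <=
    2 |z2(c) - z1(c)|. *)
Lemma velocity_diff_bound (h : C -> sphere -> sphere) (k R0 : R) (z1 z2 c j : C) :
  normalized_motion h -> Cmod c < 1 -> z1 <> z2 -> j = RtoC 0 \/ j = RtoC 1 ->
  1 / 2 <= Cmod (j - traj h z1 c)%C -> Cmod (traj h z1 c) <= R0 ->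
  Cmod (C_derive (cross_ratio h j z1 z2) c) * (1 - Cmod c ^ 2) <=
    2 * Cmod (cross_ratio h j z1 z2 c) * (k - ln (Cmod (cross_ratio h j z1 z2 c))) ->
  Cmod (velocity h z2 c - velocity h z1 c)%C * (1 - Cmod c ^ 2) <=
    Cmod (traj h z2 c - traj h z1 c)%C *
     (2 * ln (1 / Cmod (traj h z2 c - traj h z1 c)%C)
      + (2 * k + 2 * ln (1 + R0) + 612 * ((1 + R0) * (2 + R0)))).
Proof.
intros Hm Hc H12 Hj Hfar HR0 HL.
assert (H1j : z1 <> j).
{ intros ->. rewrite traj_fixed in Hfar; auto. replace (j - j)%C with (RtoC 0) in Hfar by ring.
  rewrite Cmod_0 in Hfar. lra. }
destruct (cross_ratio_holomorphic h j z1 z2 c Hm Hj H12 H1j Hc) as [DF [F0 D0]].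
set (F := cross_ratio h j z1 z2) in *.
set (y := (j - traj h z1 c)%C) in *.
assert (EV : (velocity h z2 c - velocity h z1 c = C_derive F c * y - F c * velocity h z1 c)%C).
{ transitivity (C_derive (fun w => traj h z2 w - traj h z1 w)%C c).
  - symmetry. apply is_C_derive_unique. apply is_derive_Cminus; apply is_derive_traj; auto.
  - apply is_C_derive_unique.
    apply (is_derive_C_ext_loc (fun w => F w * (j - traj h z1 w))%C _ c _ (1 - Cmod c)); [lra| |].
    + intros w Hw.
      assert (Hw' : Cmod w < 1).
      { replace w with ((w - c) + c)%C by ring. eapply Rle_lt_trans; [apply Cmod_triangle|]. lra. }
      destruct (cross_ratio_holomorphic h j z1 z2 w Hm Hj H12 H1j Hw') as [_ [_ Dw]].
      unfold F, cross_ratio. field. exact Dw.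
    + apply is_derive_C_eq with (C_derive F c * y + F c * (RtoC 0 - velocity h z1 c))%C; [|ring].
      apply (is_derive_Cmult F (fun w => j - traj h z1 w)%C).
      * apply C_derive_correct; auto.
      * apply is_derive_Cminus; [apply is_derive_Cconst|apply is_derive_traj; auto]. }
rewrite EV.
set (d := Cmod (traj h z2 c - traj h z1 c)%C).
assert (Hd : 0 < d) by (apply Cmod_gt_0, Cminus_neq_0, traj_inj; auto).
assert (EF : Cmod (F c) * Cmod y = d).
{ unfold F, cross_ratio. fold y. rewrite Cmod_div by auto. fold d. field. lra. }
set (x := Cmod (F c)) in *. set (Y := Cmod y) in *.
assert (Hx : 0 < x) by now apply Cmod_gt_0.
assert (HY : Y <= 1 + R0).
{ unfold Y, y, Cminus. eapply Rle_trans; [apply Cmod_triangle|]. rewrite Cmod_opp.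
  destruct Hj as [-> | ->]; rewrite ?Cmod_0, ?Cmod_1; lra. }
assert (Hlnx : ln (1 / d) + ln (1 + R0) >= - ln x).
{ rewrite <- EF. unfold Rdiv. rewrite Rmult_1_l, ln_Rinv, ln_mult by nra.
  assert (ln Y <= ln (1 + R0)).
  { destruct HY as [h'|h']; [left; apply ln_increasing; lra|rewrite h'; lra]. } lra. }
set (om := 1 - Cmod c ^ 2) in *.
assert (Hom : 0 < om) by (unfold om; pose proof (Cmod_ge_0 c); nra).
pose proof (velocity_bound h z1 c Hm Hc) as HV. fold om in HV.
assert (HV' : Cmod (velocity h z1 c) * om <= 306 * ((1 + R0) * (2 + R0))).
{ eapply Rle_trans; [exact HV|]. apply Rmult_le_compat_l; [lra|].
  pose proof (Cmod_ge_0 (traj h z1 c)). apply Rmult_le_compat; lra. }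
apply Rle_trans with (Cmod (C_derive F c) * om * Y + x * (Cmod (velocity h z1 c) * om)).
{ replace (Cmod (C_derive F c) * om * Y + x * (Cmod (velocity h z1 c) * om))
   with ((Cmod (C_derive F c) * Y + x * Cmod (velocity h z1 c)) * om) by ring.
  apply Rmult_le_compat_r; [lra|]. unfold Cminus at 1.
  eapply Rle_trans; [apply Cmod_triangle|]. rewrite Cmod_opp, !Cmod_mult. unfold x, Y. lra. }
assert (T1 : Cmod (C_derive F c) * om * Y <= d * (2 * k + 2 * (ln (1 / d) + ln (1 + R0)))).
{ apply Rle_trans with (2 * x * (k - ln x) * Y).
  - apply Rmult_le_compat_r; lra.
  - replace (2 * x * (k - ln x) * Y) with (d * (2 * k + 2 * - ln x)) by (rewrite <- EF; ring).
    apply Rmult_le_compat_l; lra. }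
assert (T2 : x * (Cmod (velocity h z1 c) * om) <= 2 * d * (306 * ((1 + R0) * (2 + R0)))).
{ apply Rmult_le_compat; [lra| | |exact HV'].
  - apply Rmult_le_pos; [apply Cmod_ge_0|lra].
  - rewrite <- EF. nra. }
lra.
Qed.

(** Without exit, |F(c)| is bounded through the initial value |F(0)| = |z2 - z1| / |j - z1|, and |j
    - z1(c)| <= 1 + R0 converts back. The summand ln 2 in the constant absorbs |j - z1| >= 1/2. *)
Lemma traj_diff_bound (h : C -> sphere -> sphere) (k R0 : R) (z1 z2 c j : C) :
  normalized_motion h -> Cmod c < 1 -> z1 <> z2 -> j = RtoC 0 \/ j = RtoC 1 ->
  1 / 2 <= Cmod (j - z1)%C -> Cmod (z2 - z1)%C <= 1 -> 0 < R0 -> Cmod (traj h z1 c) <= R0 ->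
  Cmod (traj h z2 c - traj h z1 c)%C <= 1 -> ln 2 < k ->
  (forall w, Cmod w < 1 -> Cmod (cross_ratio h j z1 z2 w) <= 2 ->
    Cmod (C_derive (cross_ratio h j z1 z2) w) * (1 - Cmod w ^ 2) <=
    2 * Cmod (cross_ratio h j z1 z2 w) * (k - ln (Cmod (cross_ratio h j z1 z2 w)))) ->
  Cmod (traj h z2 c - traj h z1 c)%C <=
    (1 + R0) * exp (k + ln 2) * Rpower (Cmod (z2 - z1)%C) ((1 - Cmod c) / (1 + Cmod c)).
Proof.
intros Hm Hc H12 Hj Hfar Hz HR0 Hzc Hdc Hk HL.
assert (H1j : z1 <> j).
{ intros ->. replace (j - j)%C with (RtoC 0) in Hfar by ring.
  rewrite Cmod_0 in Hfar. lra. }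
pose proof (fun w Hw => cross_ratio_holomorphic h j z1 z2 w Hm Hj H12 H1j Hw) as HF.
set (F := cross_ratio h j z1 z2) in *.
assert (Hln2 : 0 < ln 2) by (rewrite <- ln_1; apply ln_increasing; lra).
assert (Hy0 : (j - z1)%C <> RtoC 0) by (apply Cminus_neq_0; auto).
assert (HD0 : 0 < Cmod (z2 - z1)%C) by (apply Cmod_gt_0, Cminus_neq_0; auto).
assert (E0 : Cmod (F (RtoC 0)) = Cmod (z2 - z1)%C / Cmod (j - z1)%C).
{ unfold F, cross_ratio. rewrite !traj_base by auto. now rewrite Cmod_div. }
set (D := Cmod (z2 - z1)%C) in *. set (Y := Cmod (j - z1)%C) in *.
assert (HF0 : Cmod (F (RtoC 0)) <= 2).
{ rewrite E0. apply Rmult_le_reg_r with Y; [lra|].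
  replace (D / Y * Y) with D by (field; lra). lra. }
assert (HlnY : - ln 2 <= ln Y).
{ rewrite <- ln_Rinv by lra. destruct Hfar as [h'|h'].
  - left. apply ln_increasing; lra.
  - rewrite <- h'. apply Req_le. f_equal. lra. }
assert (HlnF0 : ln (Cmod (F (RtoC 0))) = ln D - ln Y).
{ rewrite E0. apply ln_div; lra. }
pose proof (Cmod_growth F 2 k c ltac:(lra) Hk
  (fun w Hw => conj (proj1 (HF w Hw)) (proj1 (proj2 (HF w Hw)))) HL Hc HF0) as G.
simpl in G. set (a := (1 - Cmod c) / (1 + Cmod c)) in *.
pose proof (Cmod_ge_0 c) as Hc0.
assert (Ha : 0 < a <= 1).
{ unfold a. split; [apply Rdiv_lt_0_compat; lra|].
  apply Rmult_le_reg_r with (1 + Cmod c); [lra|].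
  replace ((1 - Cmod c) / (1 + Cmod c) * (1 + Cmod c)) with (1 - Cmod c) by (field; lra). lra. }
unfold Rpower. rewrite Rmult_assoc, <- exp_plus.
rewrite HlnF0 in G.
assert (HaY : - ln 2 <= a * ln Y).
{ destruct (Rle_dec 0 (ln Y)); nra. }
destruct G as [G|G].
- destruct (HF c Hc) as [_ [F0 Dc]]. apply Cmod_gt_0 in F0.
  assert (EF : Cmod (traj h z2 c - traj h z1 c)%C = Cmod (j - traj h z1 c)%C * Cmod (F c)).
  { rewrite <- Cmod_mult. f_equal. unfold F, cross_ratio. field. exact Dc. }
  rewrite EF. apply Rmult_le_compat; auto using Cmod_ge_0.
  + unfold Cminus. eapply Rle_trans; [apply Cmod_triangle|]. rewrite Cmod_opp.
    destruct Hj as [-> | ->]; rewrite ?Cmod_0, ?Cmod_1; lra.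
  + rewrite <- (exp_ln (Cmod (F c))) by auto. apply exp_le_exp. nra.
(* After an exit, a (k - ln |F(0)|) <= k - ln 2 makes the right side at least 1, which already
   dominates |z2(c) - z1(c)|. *)
- assert (HD : ln D <= 0).
  { rewrite <- ln_1. destruct Hz as [h'|h']; [left; now apply ln_increasing|rewrite h'; lra]. }
  assert (HaY' : a * ln Y >= - ln 2) by lra.
  assert (0 <= k + ln 2 + a * ln D) by nra.
  assert (1 <= exp (k + ln 2 + a * ln D)) by (rewrite <- exp_0; now apply exp_le_exp).
  nra.
Qed.

Theorem theorem9 :
  forall h : C -> sphere -> sphere,
    holomorphic_motion (fun _ => True) h ->
    normalized h ->
    forall r R0 : R, 0 < r < 1 -> 0 < R0 ->
    exists M K : R, 0 < M /\ 0 < K /\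
      forall (delta : R) (c z1 z2 : C),
        0 < delta < 1 ->
        Cmod c <= r ->
        z1 <> z2 ->
        Cmod (traj h z1 c) <= R0 ->
        Cmod (traj h z2 c) <= R0 ->
        Cmod (traj h z2 c - traj h z1 c)%C < delta ->
        Cmod (traj h z1 (RtoC 0) - traj h z2 (RtoC 0))%C <= delta ->
        (exists epsilon : R,
           epsilon <= M / ln (1 / delta) /\
           Cmod (velocity h z2 c - velocity h z1 c)%C <=
             (2 + epsilon) / (1 - Cmod c ^ 2) *
             Cmod (traj h z2 c - traj h z1 c)%C *
             ln (1 / Cmod (traj h z2 c - traj h z1 c)%C)) /\
        Cmod (traj h z2 c - traj h z1 c)%C <=
          K * Rpower (Cmod (z2 - z1)%C) ((1 - Cmod c) / (1 + Cmod c)).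
Proof.
intros h Hh Hn r R0 Hr HR0.
assert (Hm : normalized_motion h) by (split; auto).
destruct (cross_ratio_landau h Hm) as [k [Hk HL]].
assert (Hln2 : 0 < ln 2) by (rewrite <- ln_1; apply ln_increasing; lra).
assert (HlnR : 0 < ln (1 + R0)) by (rewrite <- ln_1; apply ln_increasing; lra).
set (M := 2 * k + 2 * ln (1 + R0) + 612 * ((1 + R0) * (2 + R0))).
assert (HM : 0 < M) by (unfold M; nra).
exists M, ((1 + R0) * exp (k + ln 2)). split; [exact HM|].
split. { apply Rmult_lt_0_compat; [lra|apply exp_pos]. }
intros delta c z1 z2 Hdelta Hcr H12 Hz1 Hz2 Hd Hd0.
assert (Hc : Cmod c < 1) by lra.
rewrite !traj_base, Cmod_sub_sym in Hd0 by auto.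
split.
- destruct (far_from_0_or_1 (traj h z1 c)) as [j [Hj Hfar]].
  assert (H1j : z1 <> j).
  { intros ->. rewrite traj_fixed in Hfar; auto. replace (j - j)%C with (RtoC 0) in Hfar by ring.
    rewrite Cmod_0 in Hfar. lra. }
  destruct (cross_ratio_holomorphic h j z1 z2 c Hm Hj H12 H1j Hc) as [_ [_ D0]].
  assert (HF : Cmod (cross_ratio h j z1 z2 c) <= 2).
  { unfold cross_ratio. rewrite Cmod_div by auto.
    apply Rmult_le_reg_r with (Cmod (j - traj h z1 c)%C); [lra|].
    unfold Rdiv. rewrite Rmult_assoc, Rinv_l, Rmult_1_r by lra. lra. }
  pose proof (velocity_diff_bound h k R0 z1 z2 c j Hm Hc H12 Hj Hfar Hz1
    (HL j z1 z2 c Hj H12 H1j Hc HF)) as B.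
  set (d := Cmod (traj h z2 c - traj h z1 c)%C) in *.
  assert (Hdpos : 0 < d) by (apply Cmod_gt_0, Cminus_neq_0, traj_inj; auto).
  assert (Hl1 : 0 < ln (1 / delta)).
  { unfold Rdiv. rewrite Rmult_1_l, ln_Rinv by lra.
    assert (ln delta < ln 1) by (apply ln_increasing; lra). rewrite ln_1 in H. lra. }
  assert (Hl2 : ln (1 / delta) <= ln (1 / d)).
  { unfold Rdiv. rewrite !Rmult_1_l, !ln_Rinv by lra.
    assert (ln d < ln delta) by (apply ln_increasing; lra). lra. }
  (* Taken at the actual distance d < delta rather than at delta, so that (2 + epsilon) ln(1/d)
     equals 2 ln(1/d) + M exactly. *)
  exists (M / ln (1 / d)). split.
  + apply Rmult_le_compat_l; [lra|]. apply Rinv_le_contravar; lra.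
  + fold M in B. set (om := 1 - Cmod c ^ 2) in *.
    assert (Hom : 0 < om) by (unfold om; pose proof (Cmod_ge_0 c); nra).
    apply Rmult_le_reg_r with om; auto.
    replace ((2 + M / ln (1 / d)) / om * d * ln (1 / d) * om)
      with (d * (2 * ln (1 / d) + M)) by (field; lra).
    exact B.
(* Now j must be far from z1 at parameter 0, since |F(0)| is the initial value of the
   integration. *)
- destruct (far_from_0_or_1 z1) as [j [Hj Hfar]].
  assert (H1j : z1 <> j).
  { intros ->. replace (j - j)%C with (RtoC 0) in Hfar by ring. rewrite Cmod_0 in Hfar. lra. }
  apply traj_diff_bound with j; auto; lra.
Qed.
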